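(* With the notation of the context, $$P_{F_{\mathfrak p}}^{\chi_f}(0)=(-1)^{d+1}\,\chi_f(\sigma_M)\, q^{g}\, J_{(a)}(\mathfrak p),$$ where $P_{F_{\mathfrak p}}^{\chi_f}(t)$ is the characteristic polynomial of the $q$-Frobenius on the $\chi_f$-eigenspace of $H^1(\overline Y_{\mathfrak p},\mathbb Q_l)$ and $J_{(a)}(\mathfrak p)$ is the Jacobi sum $$J_{(a)}(\mathfrak p):=(-1)^{d+1}\sum_{\substack{z_1,\dots,z_d\in k(\mathfrak p)^\times\\ z_1+\cdots+z_d=-1}}\chi_{\mathfrak p}^{a_1}(z_1)\cdots\chi_{\mathfrak p}^{a_d}(z_d),\qquad a=(a_1,\dots,a_d).$$
   Context: Setting. $m$ is a prime, $\epsilon_m$ a primitive $m$-th root of unity, $K=\mathbb Q(\epsilon_m)$, $A=\mathbb Z[\epsilon_m,\frac1{mn}]$ for a positive integer $n$. $X_K$ is a proper geometrically irreducible curve of genus $g$ over $K$, and $Y_K\to X_K$ is a Galois covering with group $G=\mathbb Z/m$, ramified exactly at distinct points $x_0,\dots,x_d$; $n$ is chosen so that $X_K$ has good reduction over $\mathrm{Spec}(A)$, the $x_i$ do not coalesce modulo any prime of $A$, and the covering has a model over $A$. $\mathfrak p$ is a maximal ideal of $A$ over a rational prime $p$, with residue field $k(\mathfrak p)$ of $q=p^h$ elements (so $p\neq m$ and $m\mid q-1$). $X_{\mathfrak p}$ is the reduction of $X_K$ (proper, smooth, geometrically irreducible, genus $g$), and $Y_{\mathfrak p}$ a proper smooth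 model of the reduction of $Y_K$. It is assumed that $Y_{\mathfrak p}\to X_{\mathfrak p}$ is a Galois covering with group $G$, ramified at the reductions $\overline x_0,\dots,\overline x_d$ (distinct $k(\mathfrak p)$-rational points), with function fields $\Sigma_{Y_{\mathfrak p}}=\Sigma_{X_{\mathfrak p}}(\sqrt[m]{f})$, $\mathrm{div}(f)=a_0\overline x_0+\cdots+a_d\overline x_d+m\overline D$, $0<a_i<m$, $\overline D$ a divisor on $X_{\mathfrak p}$. (So $a_0+\cdots+a_d\equiv 0 \bmod m$.) $T=\{\overline x_0,\dots,\overline x_d\}$, $E=\overline x_0+\cdots+\overline x_d$, $E'=\overline x_1+\cdots+\overline x_d$; $\mathfrak m,\mathfrak m'\subset\mathcal O_{X_{\mathfrak p}}$ are the ideals of $E,E'$; $\mathcal O_{\mathfrak m'}=H^0(X_{\mathfrak p},\mathcal O_{X_{\mathfrak p}}/\mathfrak m')=k(\overline x_1)\times\cdots\times k(\overline x_d)=k(\mathfrak p)^d$. Characters. For $z\in k(\mathfrak p)^\times$, $\chi_{\mathfrak p}(z)$ is the unique $m$-th root of unity in $K$ with $\chi_{\mathfrak p}(z)\equiv z^{(q-1)/m}\bmod \mathfrak p$. For $\sigma\in \mathrm{Gal}(\Sigma_{Y_{\mathfrak p}}/\Sigma_{X_{\mathfrak p}})$ with $\sigma(\sqrt[m]{f})=z\sqrt[m]{f}$, $\chi_f(\sigma)$ is the $m$-th root of unity in $K$ congruent to $z$ modulo $\mathfrak p$; thus the Frobenius element at a closed point $x\notin T$ (with $x\notin\mathrm{supp}\,\mathrm{div}(f)$)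 has $\chi_f$-value $\chi_{\mathfrak p}(N_{k(x)/k(\mathfrak p)}f(x))$. Level structures and ray class group. An $\mathfrak m$-level structure is a pair $(L,\iota_{\mathfrak m})$, with $L$ a line bundle on $X_{\mathfrak p}$ and $\iota_{\mathfrak m}:L\to\mathcal O_{X_{\mathfrak p}}/\mathfrak m$ a surjection of $\mathcal O_{X_{\mathfrak p}}$-modules, up to isomorphisms of $L$ compatible with $\iota_{\mathfrak m}$; $\mathfrak m'$-level structures and level structures at $\overline x_0$ are defined likewise. Two divisors supported outside $T$ are $\mathfrak m$-equivalent if they differ by $\mathrm{div}(g)$ with $g\equiv 1\bmod\mathfrak m$. Classes of $\mathfrak m$-level structures correspond bijectively to $\mathfrak m$-equivalence classes of divisors supported outside $T$ (to $(L,\iota_{\mathfrak m})$ corresponds the divisor of any rational section $s$ of $L$, regular at $T$, with $\iota_{\mathfrak m}(s)=1$ in $\mathcal O_{X_{\mathfrak p}}/\mathfrak m$). $D_1$ is a fixed divisor of degree $1$ supported outside $T$, whose Artin symbol in $\mathrm{Gal}(\Sigma_{Y_{\mathfrak p}}/\Sigma_{X_{\mathfrak p}})$ is trivial. For a divisor $N$ of degree $0$ supported outside $T$, $\sigma_N$ is the element associated with $N$ by the Artin map in the Galois group of the $\mathfrak m$-ray class field extension, and $\chi_f(\sigma_N)$ is the value of $\chi_f$ on its image in $\mathrm{Gal}(\Sigma_{Y_{\mathfrak p}}/\Sigma_{X_{\mathfrak p}})$. The divisor $M$. Let $\kappa$ be a canonical divisor of $X_{\mathfrak p}$. Choose an effective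 divisor linearly equivalent to $\kappa+E$ not containing $\overline x_0$ in its support, let $L\simeq\mathcal O_{X_{\mathfrak p}}(\kappa+E)$ be its line bundle, and let $\iota_{\overline x_0}:L\to\mathcal O_{X_{\mathfrak p}}/\mathfrak m_{\overline x_0}$ be normalized by $\iota_{\overline x_0}(1)=1$. For an $\mathfrak m'$-level structure $\iota'$ on $L$, $H^0(\iota')$ induces an isomorphism $[\iota']:H^0(X_{\mathfrak p},L)/H^0(X_{\mathfrak p},L(-E))\simeq\mathcal O_{\mathfrak m'}$, and $H^0(\iota_{\overline x_0})$ kills $H^0(X_{\mathfrak p},L(-E))$, giving a linear form $\omega=H^0(\iota_{\overline x_0})\circ[\iota']^{-1}:\mathcal O_{\mathfrak m'}\to k(\overline x_0)=k(\mathfrak p)$. The structure $\iota'$ is chosen so that $\omega(z_1,\dots,z_d)=-z_1-\cdots-z_d$. $M$ is a divisor of degree $0$ supported outside $T$ such that the $\mathfrak m$-level structure associated with $M+(2g+d-1)D_1$ is $(L,\iota_{\overline x_0}\times\iota')$. Characteristic polynomial. $\overline Y_{\mathfrak p}$ is the base change of $Y_{\mathfrak p}$ to an algebraic closure of $k(\mathfrak p)$, $l\ne p$ a prime, and $H^1(\overline Y_{\mathfrak p},\mathbb Q_l)^{\chi_f}$ is the $\chi_f$-eigenspace for $G$ of the étale cohomology (with coefficients extended to $\mathbb Q_l(\epsilon_m)$, $\mathbb Q(\epsilon_m)\subset\mathbb Q_l(\epsilon_m)$). $P_{F_{\mathfrak p}}^{\chi_f}(t)=\det(t-F_{\mathfrak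 p})\in\mathbb Z[\epsilon_m][t]$ is the characteristic polynomial of the $q$-Frobenius on it. The conventions for the actions are those for which $$P_{F_{\mathfrak p}}^{\chi_f}(t)=\sum_{i=0}^{2g+d-1}\ \sum_{[N]}L_{\mathfrak m}(N,i)\,\chi_f(\sigma_N)\,t^{2g+d-1-i},$$ where $[N]$ runs over the $\mathfrak m$-equivalence classes of degree-$0$ divisors supported outside $T$ and $L_{\mathfrak m}(N,i)$ is the number of effective divisors supported outside $T$ that are $\mathfrak m$-equivalent to $N+iD_1$. *)

(* Defs.v *)
From HB Require Import structures.
From mathcomp Require Import all_boot all_order all_algebra.
From mathcomp Require Import boolp classical_sets functions cardinality fsbigop.
From mathcomp Require Import finmap.
From mathcomp Require Export freeg.

Set Implicit Arguments.
Unset Strict Implicit.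
Unset Printing Implicit Defensive.

Import Order.TTheory GRing.Theory Num.Theory.

Local Open Scope classical_set_scope.
Local Open Scope ring_scope.

(** * Discrete valuations, function fields in one variable over a finite field *)

(* Normalized discrete valuations; the value at [0] (which should be +oo) is
   the junk value [0], so that distinct records are distinct valuations.
   Inequalities that must count [v 0] as +oo are written with [vge]. *)
Record dvaluation (F : fieldType) := DValuation {
  dval :> F -> int ;
  dval0 : dval 0 = 0 ;
  dvalM : forall a b, a != 0 -> b != 0 -> dval (a * b) = dval a + dval b ;
  dvalD : forall a b, a != 0 -> b != 0 -> a + b != 0 ->
    Num.min (dval a) (dval b) <= dval (a + b) ;
  dval_surj : exists2 a, a != 0 & dval a = 1 }.

HB.instance Definition _ (F : fieldType) := gen_eqMixin (dvaluation F).
HB.instance Definition _ (F : fieldType) := gen_choiceMixin (dvaluation F).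

Definition vge (F : fieldType) (v : dvaluation F) (a : F) (n : int) : Prop :=
  a = 0 \/ n <= v a.

(* The function field of a proper smooth geometrically irreducible curve over
   the finite (hence perfect) field [k]: finitely generated of transcendence
   degree one, with [k] algebraically closed in it. *)
Definition function_field (k : finFieldType) (S : fieldType)
    (c : {rmorphism k -> S}) : Prop :=
  (exists2 t : S, ~ algebraicOver c t &
     exists (n : nat) (b : 'I_n -> S), forall h : S,
     exists (a : 'I_n -> {poly k}) (s : {poly k}), s != 0 /\
       (map_poly c s).[t] * h = \sum_i (map_poly c (a i)).[t] * b i) /\
  (forall h : S, algebraicOver c h -> exists a, h = c a).

(* The closed points of the curve with function field [S] are all the discrete
   valuations of [S]: these are trivial on the finite field [k]. *)
Notation place S := (dvaluation S) (only parsing).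
Notation divisor S := {freeg (dvaluation S) / int} (only parsing).

(* The dimension of [U / W], for subspaces [W] of [U] of a [k]-vector space with
   scalar multiplication [sc]; it is 0 when [U / W] is infinite-dimensional. *)
Definition quot_dim (k : fieldType) (V : zmodType) (sc : k -> V -> V)
    (U W : set V) : nat :=
  xget 0%N [set n : nat | exists b : 'I_n -> V, (forall i, U (b i)) /\
    forall v, U v -> exists! a : {ffun 'I_n -> k},
      W (v - \sum_i sc (a i) (b i))].

Section Curve.
Variables (k : finFieldType) (S : fieldType) (c : {rmorphism k -> S}).
Implicit Types (x : place S) (D N : divisor S).

Definition place_deg x : nat :=
  quot_dim (fun (a : k) (h : S) => c a * h)
    [set h | vge x h 0] [set h | vge x h 1].

Definition div_deg D : int :=
  \sum_(x <- dom D) coeff x D * (place_deg x)%:Z.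

Definition div_le D N : Prop := forall x, coeff x D <= coeff x N.
Definition effective D : Prop := div_le 0 D.
Definition is_div (h : S) D : Prop :=
  h != 0 /\ forall x, coeff x D = x h.
Definition lin_equiv D N : Prop := exists h, is_div h (D - N).

(* Repartitions.  As a vector space H^1(X, O(D)) is the quotient of [adele] by
   [adele_le D] plus the constant repartitions, so [genus] is dim H^1(X, O). *)
Definition adele : set (place S -> S) :=
  [set al | finite_set [set x | ~ vge x (al x) 0]].
Definition adele_le D : set (place S -> S) :=
  [set al | forall x, vge x (al x) (- coeff x D)].

Definition genus : nat :=
  quot_dim (fun (a : k) (al : place S -> S) => (fun x => c a * al x))
    adele [set al | exists h : S, adele_le 0 (fun x => al x - h)].

(* Weil differentials, i.e. rational sections of the dualizing sheaf. *)
Definition weil_differential (om : (place S -> S) -> k) : Prop :=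
  [/\ forall (a : k) al be, adele al -> adele be ->
        om (fun x => c a * al x + be x) = a * om al + om be,
      forall h : S, om (fun=> h) = 0 &
      exists D, forall al, adele_le D al -> om al = 0].

(* [W] is the divisor of a non-zero Weil differential. *)
Definition canonical_divisor (W : divisor S) : Prop :=
  exists2 om, weil_differential om &
    (exists2 al, adele al & om al != 0) /\
    (forall D, (forall al, adele_le D al -> om al = 0) <-> div_le D W).

(* The line bundle O(C), as a subsheaf of the constant sheaf [S]: stalks and
   global sections. *)
Definition stalk C x : set S := [set h | vge x h (- coeff x C)].
Definition sections C : set S := [set h | forall x, stalk C x h].

(* An O_X-linear surjection from O(C) to the skyscraper sheaf k(x) = k at a
   rational point [x]; only the values of [io] on the stalk matter. *)
Definition level_at x C (io : S -> k) : Prop :=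
  [/\ forall h h', stalk C x h -> stalk C x h' -> io (h + h') = io h + io h',
      forall (b h : S) (r : k), vge x (b - c r) 1 -> stalk C x h ->
        io (b * h) = r * io h &
      forall r, exists2 h, stalk C x h & io h = r].

(** ** The modulus [T 0 + ... + T d] *)
Variables (d : nat) (T : 'I_d.+1 -> place S).

Definition outside D : Prop := forall i, coeff (T i) D = 0.

Definition mequiv D N : Prop :=
  exists2 h, is_div h (D - N) & forall i, vge (T i) (h - 1) 1.

Definition mclass N : set (divisor S) := [set D | outside D /\ mequiv D N].

(* The ray classes of degree 0. *)
Definition mclasses0 : set (set (divisor S)) :=
  [set mclass N | N in [set N | div_deg N = 0 /\ outside N]].

(* The number of effective divisors that are m-equivalent to [N + i D1]. *)
Definition Lm (D1 N : divisor S) (i : nat) : nat :=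
  #|` fset_set [set D | [/\ effective D, outside D & mequiv D (N + D1 *+ i)]] |.

(* A surjection O(C) -> O_X / m is a family of surjections to the k(T i).  The
   divisor of the section [s] of O(C) is div(s) + C. *)
Definition mlevel_structure C (io : 'I_d.+1 -> S -> k) : Prop :=
  forall i, level_at (T i) C (io i).

Definition level_divisor C (io : 'I_d.+1 -> S -> k) N : Prop :=
  outside N /\
  exists (s : S) (Ds : divisor S),
    [/\ is_div s Ds,
        forall i, stalk C (T i) s /\ io i s = 1 &
        mequiv N (Ds + C)].

(* The graph of the linear form H^0(io_0) o [io']^-1 from k^d to k, where io' is
   the family of the [io i] with [i > 0]. *)
Definition omega_graph C (io : 'I_d.+1 -> S -> k) (z : 'I_d -> k)
    (r : k) : Prop :=
  exists s, [/\ sections C s, forall i, io (fintype.lift ord0 i) s = z i & io ord0 s = r].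

(** ** The Artin map of the covering with function field [Q] *)
Variables (Q : fieldType) (u : {rmorphism S -> Q}).

Definition Gal_elt (s : {rmorphism Q -> Q}) : Prop := forall h, s (u h) = u h.

Definition place_above (w : place Q) x : Prop :=
  exists2 e : nat, (0 < e)%N & forall h, w (u h) = x h *+ e.

Definition frobenius_at x (s : {rmorphism Q -> Q}) : Prop :=
  Gal_elt s /\ exists2 w, place_above w x &
    forall b, vge w b 0 -> vge w (s b - b ^+ (#|k| ^ place_deg x)) 1.

(* The graph of the homomorphism from divisors prime to [T] to the (abelian)
   Galois group sending each place to its Frobenius element. *)
Inductive artin_symbol : divisor S -> {rmorphism Q -> Q} -> Prop :=
| artin_frob (x : place S) (s : {rmorphism Q -> Q}) : (forall i, x != T i) -> frobenius_at x s ->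
    artin_symbol << x >> s
| artin_sub (N N' : divisor S) (s s' t : {rmorphism Q -> Q}) : artin_symbol N s -> artin_symbol N' s' ->
    (forall z, t (s' z) = s z) -> artin_symbol (N - N') t.

End Curve.

(** * Residue map and characters *)

(* The ring Z[eps, 1/N], and a surjection from it onto [k]: the reduction
   modulo a maximal ideal with residue field [k].  The values of [red] outside
   the ring are irrelevant. *)
Definition cyclo_ring (K : fieldType) (eps : K) (N : nat) : set K :=
  [set z | exists (r : {poly int}) (e : nat),
     z * N%:R ^+ e = (map_poly intr r).[eps]].

Definition residue_map (K : fieldType) (eps : K) (N : nat) (k : fieldType)
    (red : K -> k) : Prop :=
  let A := cyclo_ring eps N in
  [/\ red 1 = 1,
      forall y z, A y -> A z -> red (y - z) = red y - red z,
      forall y z, A y -> A z -> red (y * z) = red y * red z &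
      forall r, exists2 z, A z & red z = r].

Section Characters.
Variables (K : fieldType) (m : nat) (eps : K) (k : finFieldType) (red : K -> k).

(* The m-th root of unity in [K] whose residue is [z], if there is one. *)
Definition root_lift (z : k) : K :=
  if [pick i : 'I_m | red (eps ^+ i) == z] is Some i then eps ^+ i else 0.

Definition chi_p (z : k) : K := root_lift (z ^+ ((#|k| - 1) %/ m)).

Definition jacobi_sum (d : nat) (a : 'I_d -> nat) : K :=
  (-1) ^+ d.+1 *
  \sum_(z : {ffun 'I_d -> k} | [forall i, z i != 0] && (\sum_i z i == -1))
    \prod_i chi_p (z i) ^+ a i.

Variables (S : fieldType) (c : {rmorphism k -> S}).
Variables (Q : fieldType) (u : {rmorphism S -> Q}) (y : Q).

Definition chi_f (s : {rmorphism Q -> Q}) : K :=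
  if [pick z : k | s y == u (c z) * y] is Some z then root_lift z else 0.

Variables (d : nat) (T : 'I_d.+1 -> place S).

(* chi_f (sigma_N) *)
Definition chi_artin (N : divisor S) : K :=
  xget 0 [set z | exists2 s, artin_symbol c T u N s & z = chi_f s].

End Characters.

(** * The first l-adic cohomology group of the covering *)

(* [E], with its valuation [w], is a completion at a place over [l] of the
   number field [K]; for K = Q(eps) it is Q_l(eps). *)
Definition ladic_completion (K E : fieldType) (l : nat) (w : dvaluation E)
    (iota : {rmorphism K -> E}) : Prop :=
  [/\ 0 < w l%:R,
      forall (b : E) (n : int), exists z : K, vge w (b - iota z) n &
      forall s : nat -> E,
        (forall n : int, exists i0, forall i j, (i0 <= i)%N -> (i0 <= j)%N ->
           vge w (s i - s j) n) ->
        exists b : E, forall n : int, exists i0, forall i, (i0 <= i)%N ->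
           vge w (s i - b) n].

(* [Om] is an algebraic closure of [Q], so that its automorphisms over [Q]
   restrict isomorphically to those of the separable closure; endomorphisms over
   [Q] are automorphisms.  The algebraic closure of [k] in [Om] is the constant
   field of the geometric curves. *)
Section Cohomology.
Variables (k : finFieldType) (S : fieldType) (c : {rmorphism k -> S}).
Variables (Q : fieldType) (u : {rmorphism S -> Q}) (y : Q).
Variables (Om : closedFieldType) (v : {rmorphism Q -> Om}).

Definition geom_const : set Om := [set z | algebraicOver (v \o u \o c) z].

Definition GalX (s : {rmorphism Om -> Om}) : Prop :=
  (forall h, s (v (u h)) = v (u h)) /\ (forall z, geom_const z -> s z = z).

Definition GalY (s : {rmorphism Om -> Om}) : Prop :=
  (forall b, s (v b) = v b) /\ (forall z, geom_const z -> s z = z).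

Definition valuation_ring (O : set Om) : Prop :=
  [/\ O 1, forall a b, O a -> O b -> O (a - b) /\ O (a * b) &
      forall a, O a \/ O a^-1].

(* [s] acts trivially on the residue ring of [O]. *)
Definition inertia (O : set Om) (s : {rmorphism Om -> Om}) : Prop :=
  forall a, O a -> s a - a = 0 \/ (O (s a - a) /\ ~ O (s a - a)^-1).

Variables (E : fieldType) (w : dvaluation E).

(* Continuous homomorphisms to [E] from the fundamental group of the geometric
   curve, i.e. from [GalY] modulo the inertia subgroups: this is the cohomology
   H^1 of the geometric covering with coefficients in [E].  The functions are
   made to vanish off [GalY] so that each homomorphism is represented once. *)
Definition H1 : set ({rmorphism Om -> Om} -> E) :=
  [set phi |
    [/\ forall s, ~ GalY s -> phi s = 0,
        forall s t st : {rmorphism Om -> Om}, GalY s -> GalY t -> GalY st ->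
          (forall z, st z = s (t z)) -> phi st = phi s + phi t,
        forall n : int, exists r : seq Om, forall s, GalY s ->
          (forall z, z \in r -> s z = z) -> vge w (phi s) n &
        forall O s, valuation_ring O -> GalY s -> inertia O s -> phi s = 0]].

(* [t] in [GalX] acts on [H1] by (t phi)(s) = phi (t^-1 s t): this is the action
   of the restriction [t0] of [t] to [Q] by transport of structure. *)
Definition H1_eigen (chi : {rmorphism Q -> Q} -> E) :
    set ({rmorphism Om -> Om} -> E) :=
  [set phi | H1 phi /\
    forall (t : {rmorphism Om -> Om}) (t0 : {rmorphism Q -> Q}),
      GalX t -> (forall b, t (v b) = v (t0 b)) ->
      forall s s', GalY s -> GalY s' -> (forall z, t (s' z) = s (t z)) ->
        phi s' = chi t0 * phi s].

Definition frobenius_lift (Fr : {rmorphism Om -> Om}) : Prop :=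
  (forall b, Fr (v b) = v b) /\ (forall z, geom_const z -> Fr z = z ^+ #|k|).

(* [R] is the characteristic polynomial det(t - F) on the eigenspace, where the
   pull-back F by the q-Frobenius endomorphism of the geometric curve is the
   inverse of the transport of structure by the arithmetic Frobenius [Fr]:
   (F phi)(s) = phi (Fr s Fr^-1). *)
Definition frobenius_char_poly (chi : {rmorphism Q -> Q} -> E) (R : {poly E}) :
    Prop :=
  exists (n : nat) (b : 'I_n -> {rmorphism Om -> Om} -> E) (A : 'M[E]_n)
    (Fr : {rmorphism Om -> Om}),
  [/\ forall i, H1_eigen chi (b i),
      forall phi, H1_eigen chi phi -> exists! a : {ffun 'I_n -> E},
        forall s, phi s = \sum_i a i * b i s,
      frobenius_lift Fr,
      forall i s s', GalY s -> GalY s' -> (forall z, s' (Fr z) = Fr (s z)) ->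
        b i s' = \sum_j A i j * b j s &
      R = char_poly A].

End Cohomology.

(* Main.v *)
(* P(0) is the sum of chi_f over the effective divisors of degree 2g+d-1 prime to T, since chi_f of the Artin
   symbol depends only on the ray class.  At a place x the Frobenius multiplies y by the (q-1)/m-th power of the
   tame symbol of f, so Weil reciprocity expresses how chi_f varies in a linear equivalence class through the
   values at T of the sections.  Outside the class of kappa + E, Riemann-Roch makes evaluation at T surjective,
   and the sum of a non-trivial character of the torus is 0.  In the class of kappa + E the values fill the
   hyperplane z_0 + ... + z_d = 0 with fibres of q^g elements; dividing by z_0 gives q^g times the Jacobi sum,
   translated by chi_f(sigma_M).

   Weil reciprocity is proved as for determinant lines, the determinant of a linear map between the spaces L(D)
   being replaced by a product over k^*-orbits of vectors.  Frobenius elements exist because weak approximation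
   reduces the congruence for a general element to one all of whose conjugates are integral, and Lagrange
   resolvents expand such an element in powers of a local m-th root. *)
Require Import Defs.
From HB Require Import structures.
From mathcomp Require Import all_boot all_order all_algebra all_field.
From mathcomp Require Import boolp classical_sets functions cardinality fsbigop.
From mathcomp Require Import finmap.
From mathcomp Require Import zify ring.

Set Implicit Arguments.
Unset Strict Implicit.
Unset Printing Implicit Defensive.

Import Order.TTheory GRing.Theory Num.Theory.
Local Open Scope classical_set_scope.
Local Open Scope ring_scope.

(** * Valuations and weak approximation *)

(** Degrees and dimensions are obtained by counting over the finite field k. Places come only from
    valuation rings supplied by Chevalley's theorem. The degree of S over k(t) is replaced by the
    length of a family spanning S over the fractions of k[t]; counting finite expansions in powers
    of t then bounds the number of elements incongruent modulo t. Likewise L(D) enters through its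
    cardinality, with rank formulas replaced by fibres of constant size. Two facts of duality carry
    the character sum: ell(kappa) = g, and H^1(D - E) = 0 if D has the degree of kappa + E without
    being equivalent to it. That degree is 2g + d - 1, the index of the constant term. Summing over
    sections instead of divisors multiplies everything by q - 1, which is invertible in
    characteristic 0. Orbit products give reciprocity only up to signs. These drop out: once
    everything is raised to the power (q-1)/m, the part of div(f) divisible by m contributes
    (q-1)-th powers, and at a branch point the signs cancel because the divisor of the other
    function has degree 0. *)

Section Valuations.
Variable F : fieldType.
Implicit Types (v x y : dvaluation F) (a b h : F) (n : int).

Lemma dval_eq v v' : (forall h, v h = v' h) -> v = v'.
Proof.
case: v v' => [f f0 fM fD fs] [g g0 gM gD gs] /= fg.
have {}fg : f = g by apply: funext.
move: g0 gM gD gs; rewrite -fg => g0 gM gD gs.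
by congr DValuation; apply: Prop_irrelevance.
Qed.

Lemma dval1 v : v 1 = 0.
Proof.
have h : v 1 = v 1 + v 1 by rewrite -{1}[1]mulr1 dvalM ?oner_neq0.
lia.
Qed.

Lemma dvalX v a i : a != 0 -> v (a ^+ i) = v a * i%:Z.
Proof.
move=> a0; elim: i => [|i IH]; first by rewrite expr0 dval1 mulr0.
by rewrite exprS dvalM ?expf_neq0 // IH; lia.
Qed.

Lemma dvalV v a : v a^-1 = - v a.
Proof.
have [->|a0] := eqVneq a 0; first by rewrite invr0 dval0 oppr0.
have := dvalM v a0 (invr_neq0 a0); rewrite divff // dval1 => h; lia.
Qed.

Lemma dvalXz v a (i : int) : a != 0 -> v (a ^ i) = v a * i.
Proof.
move=> a0; case: i => i; first by rewrite -exprnP dvalX.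
by rewrite NegzE -exprnN dvalV dvalX //; lia.
Qed.

Lemma dval_unity v a i : a ^+ i.+1 = 1 -> v a = 0.
Proof.
move=> ai; have a0 : a != 0.
  by apply: contra_eq_neq ai => ->; rewrite expr0n eq_sym oner_neq0.
have := dvalX v i.+1 a0; rewrite ai dval1 => /esym/eqP.
by rewrite mulf_eq0 => /orP[/eqP//|]; lia.
Qed.

Lemma dvalN v a : v (- a) = v a.
Proof.
have [->|a0] := eqVneq a 0; first by rewrite oppr0.
by rewrite -mulN1r dvalM ?oppr_eq0 ?oner_neq0 // (@dval_unity _ _ 1) ?sqrrN ?expr1n // add0r.
Qed.

Lemma vge0 v n : vge v 0 n. Proof. by left. Qed.

Lemma vgeE v a n : a != 0 -> vge v a n <-> n <= v a.
Proof. by move=> a0; split=> [[/eqP|//]|]; [rewrite (negbTE a0)|right]. Qed.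

Lemma vgeW v a n n' : n' <= n -> vge v a n -> vge v a n'.
Proof. by move=> le [->|h]; [left|right; apply: le_trans h]. Qed.

Lemma vgeN v a n : vge v a n -> vge v (- a) n.
Proof. by case=> [->|h]; [left; rewrite oppr0|right; rewrite dvalN]. Qed.

Lemma vgeD v a b n : vge v a n -> vge v b n -> vge v (a + b) n.
Proof.
have [->|a0] := eqVneq a 0; first by rewrite add0r.
have [->|b0] := eqVneq b 0; first by rewrite addr0.
have [->|ab0] := eqVneq (a + b) 0; first by left.
rewrite !vgeE // => h1 h2; apply: le_trans (dvalD v a0 b0 ab0).
by rewrite le_min h1.
Qed.

Lemma vgeB v a b n : vge v a n -> vge v b n -> vge v (a - b) n.
Proof. by move=> ha hb; apply: vgeD => //; apply: vgeN. Qed.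

Lemma vgeBC v a b n : vge v (a - b) n -> vge v (b - a) n.
Proof. by move=> /vgeN; rewrite opprB. Qed.

Lemma vgeM v a b n n' : vge v a n -> vge v b n' -> vge v (a * b) (n + n').
Proof.
have [->|a0] := eqVneq a 0; first by left; rewrite mul0r.
have [->|b0] := eqVneq b 0; first by left; rewrite mulr0.
by rewrite !vgeE ?mulf_neq0 // dvalM //; lia.
Qed.

Lemma vge1 v : vge v 1 0. Proof. by right; rewrite dval1. Qed.

Lemma vgeMl v a b n : vge v a 0 -> vge v b n -> vge v (a * b) n.
Proof. by move=> ha hb; rewrite -[n]add0r; apply: vgeM. Qed.

Lemma vgeX v a i : vge v a 0 -> vge v (a ^+ i) 0.
Proof.
move=> ha; elim: i => [|i IH]; first exact: vge1.
by rewrite exprS; apply: vgeMl.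
Qed.

Lemma vge_sum v (I : Type) (r : seq I) (P : pred I) (G : I -> F) n :
  (forall i, P i -> vge v (G i) n) -> vge v (\sum_(i <- r | P i) G i) n.
Proof.
move=> h; elim/big_rec: _ => [|i a Pi ha]; first exact: vge0.
by apply: vgeD => //; apply: h.
Qed.

Lemma dval_prod v (I : Type) (r : seq I) (P : pred I) (G : I -> F) :
  (forall i, P i -> G i != 0 /\ v (G i) = 0) ->
  \prod_(i <- r | P i) G i != 0 /\ v (\prod_(i <- r | P i) G i) = 0.
Proof.
move=> h; elim/big_rec: _ => [|i a Pi [a0 ha]]; first by rewrite oner_neq0 dval1.
have [g0 g1] := h i Pi.
by split; [rewrite mulf_neq0|rewrite dvalM // g1 ha].
Qed.

Lemma vge_trans v a b h n : vge v (a - b) n -> vge v (b - h) n -> vge v (a - h) n.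
Proof. by move=> h1 h2; rewrite -(subrKA b); apply: vgeD. Qed.

Lemma dvalD_dom v a b : a != 0 -> vge v b (v a + 1) ->
  a + b != 0 /\ v (a + b) = v a.
Proof.
move=> a0; have [->|b0] := eqVneq b 0; first by rewrite addr0.
rewrite vgeE // => hb.
have ab0 : a + b != 0.
  apply/eqP => /eqP; rewrite addr_eq0 => /eqP ab.
  by move: hb; rewrite ab dvalN; lia.
split=> //; apply/eqP; rewrite eq_le; apply/andP; split; last first.
  by apply: le_trans (dvalD v a0 b0 ab0); rewrite le_min; lia.
have nb : - b != 0 by rewrite oppr_eq0.
have := dvalD v ab0 nb; rewrite addrK dvalN => /(_ a0).
by rewrite ge_min => /orP[//|]; lia.
Qed.

Lemma dval_near v a b n : a != 0 -> v a < n -> vge v (b - a) n ->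
  b != 0 /\ v b = v a.
Proof.
move=> a0 hn hb; rewrite -(subrK a b) addrC; apply: dvalD_dom => //.
by apply: vgeW hb; lia.
Qed.

Lemma vge_expBn v a b n i : vge v a 0 -> vge v b 0 -> vge v (a - b) n ->
  vge v (a ^+ i - b ^+ i) n.
Proof.
move=> ha hb hab; rewrite subrXX mulrC; apply: vgeMl => //.
by apply: vge_sum => j _; apply: vgeMl; apply: vgeX.
Qed.

Lemma vge_mulB v a b a' b' n : vge v a 0 -> vge v b' 0 ->
  vge v (a - a') n -> vge v (b - b') n -> vge v (a * b - a' * b') n.
Proof.
move=> ha hb haa hbb.
have -> : a * b - a' * b' = a * (b - b') + b' * (a - a') by ring.
by apply: vgeD; apply: vgeMl.
Qed.

(** With [p] a uniformizer of [x], units of [x] are units of [y], so [y] is [y p] times [x]; the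
    normalization of [y] at [r] forces [y p = 1]. *)
Lemma dval_sub_eq x y : (forall h, vge x h 0 -> vge y h 0) -> x = y.
Proof.
move=> sub; have [p p0 xp] := dval_surj x; have [r r0 yr] := dval_surj y.
have sub0 h : h != 0 -> x h = 0 -> y h = 0.
  move=> h0 xh; have : vge y h 0 by apply: sub; right; rewrite xh.
  have : vge y h^-1 0 by apply: sub; right; rewrite dvalV xh.
  by rewrite !vgeE ?invr_eq0 // dvalV; lia.
have yE h : h != 0 -> y h = y p * x h.
  move=> h0; have : y (h / p ^ x h) = 0.
    apply: sub0; rewrite ?mulf_neq0 ?invr_neq0 ?expfz_neq0 //.
    by rewrite dvalM ?invr_neq0 ?expfz_neq0 // dvalV dvalXz // xp; lia.
  by rewrite dvalM ?invr_neq0 ?expfz_neq0 // dvalV dvalXz //; lia.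
have yp : 0 <= y p.
  have := sub p; rewrite !vgeE // xp => /(_ isT) //.
have y1 : y p = 1.
  have := yE r r0; rewrite yr; set a := y p in yp *; set b := x r => ab.
  have b0 : 0 < b by rewrite ltNge; apply/negP => b0; nia.
  by have [|] := leP 2 a; nia.
apply: dval_eq => h; have [->|h0] := eqVneq h 0; first by rewrite !dval0.
by rewrite yE // y1 mul1r.
Qed.

(** Neither valuation ring contains the other, by [dval_sub_eq]; the quotient of the two witnesses
    of non-inclusion has a zero at [x] and a pole at [y]. *)
Lemma dval_separate x y : x != y -> exists z, [/\ z != 0, 0 < x z & y z < 0].
Proof.
have ex x' y' : x' != y' -> exists a, [/\ a != 0, 0 <= x' a & y' a < 0].
  move=> xy; apply: contrapT => nex; move/eqP: xy; apply.
  apply: dval_sub_eq => h [->|xh]; first exact: vge0.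
  have [->|h0] := eqVneq h 0; first exact: vge0.
  right; rewrite leNgt; apply/negP => yh; apply: nex; by exists h.
move=> xy; have [a [a0 xa ya]] := ex _ _ xy.
have [b [b0 yb xb]] : exists b, [/\ b != 0, 0 <= y b & x b < 0].
  by apply: ex; rewrite eq_sym.
exists (a / b); rewrite mulf_neq0 ?invr_neq0 // !dvalM ?invr_neq0 // !dvalV.
by split=> //; lia.
Qed.

Lemma dval_separate_seq x (s : seq (dvaluation F)) : x \notin s ->
  exists z, [/\ z != 0, 0 < x z & forall y, y \in s -> y z < 0].
Proof.
elim: s => [_|y s IH].
  by have [p p0 xp] := dval_surj x; exists p; rewrite xp.
rewrite inE negb_or => /andP[xy /IH[z [z0 xz sz]]].
have [yz|yz] := ltP (y z) 0.
  by exists z; split=> // y'; rewrite inE => /orP[/eqP->//|/sz].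
have [w [w0 xw yw]] := dval_separate xy.
(* Adding a power of [w] to [z] repairs the place [y]. The exponent exceeds every |y'(z)| with y' in
   [s], so the power of [w] dominates where [w] has a pole, and [z] dominates at the other places of
   [s]. *)
pose M := (\sum_(y' <- s) `|y' z|)%N.
have Mle y' : y' \in s -> (`|y' z| <= M)%N.
  by move=> ys; rewrite /M (big_rem y') //= leq_addr.
pose r := M.+1.
have wr0 : w ^+ r != 0 by rewrite expf_neq0.
have wrE y' : y' (w ^+ r) = y' w * r%:Z by rewrite dvalX.
have key y' : y' (w ^+ r) < y' z -> y' (w ^+ r) < 0 ->
    z + w ^+ r != 0 /\ y' (z + w ^+ r) < 0.
  move=> h1 h2; rewrite addrC; have [|-> ->//] := @dvalD_dom y' (w ^+ r) z wr0.
  by right; lia.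
have key2 y' : y' z < y' (w ^+ r) -> y' z < 0 ->
    z + w ^+ r != 0 /\ y' (z + w ^+ r) < 0.
  move=> h1 h2; have [|-> ->//] := @dvalD_dom y' z (w ^+ r) z0.
  by right; lia.
have [s0 hy] : z + w ^+ r != 0 /\ y (z + w ^+ r) < 0.
  by apply: key; rewrite wrE /r; nia.
exists (z + w ^+ r); split=> //.
  have /(vgeE _ _ s0) : vge x (z + w ^+ r) 1; last by lia.
  apply: vgeD; right; first by lia.
  by rewrite wrE /r; nia.
move=> y'; rewrite inE => /orP[/eqP->//|ys].
have yzs := sz _ ys; have Ms := Mle _ ys.
have [yw'|yw'] := ltP (y' w) 0.
  by have [] : z + w ^+ r != 0 /\ y' (z + w ^+ r) < 0 by apply: key; rewrite wrE /r; nia.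
by have [] : z + w ^+ r != 0 /\ y' (z + w ^+ r) < 0 by apply: key2 => //; rewrite wrE /r; nia.
Qed.

Lemma weak_approximation (s : seq (dvaluation F)) (a : dvaluation F -> F) n :
  uniq s -> exists h, forall x, x \in s -> vge x (h - a x) n.
Proof.
move=> us.
(* [M] bounds the poles of the prescribed values at the chosen places; [N] keeps the precision [n]
   after multiplication by these values. *)
pose M := (\sum_(y <- s) \sum_(x <- s) `|y (a x)|)%N.
have Mle y x : y \in s -> x \in s -> - (M%:Z) <= y (a x).
  move=> ys xs; have : (`|y (a x)| <= M)%N; last by lia.
  apply: (@leq_trans (\sum_(x <- s) `|y (a x)|)%N); first by rewrite (big_rem x) //= leq_addr.
  by rewrite [leqRHS](big_rem y) //= leq_addr.
pose N := (`|n| + M)%N.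
have ex x : exists h, x \in s -> vge x (h - 1) N%:Z /\
    forall y, y \in s -> y != x -> vge y h N%:Z.
  have [xs|] := boolP (x \in s); last by exists 0.
  have [|z [z0 xz yz]] := @dval_separate_seq x (filter (predC1 x) s).
    by rewrite mem_filter /= eqxx.
  have zN0 : z ^+ N.+1 != 0 by rewrite expf_neq0.
  have [n0 n1] : 1 + z ^+ N.+1 != 0 /\ x (1 + z ^+ N.+1) = 0.
    have [|-> ->] := @dvalD_dom x 1 (z ^+ N.+1) (oner_neq0 _).
      by right; rewrite dval1 dvalX //; nia.
    by rewrite dval1.
  (* Since [z] vanishes at [x] and has poles at the other places, this is close to 1 at [x] and to 0
     elsewhere. *)
  exists (1 + z ^+ N.+1)^-1 => _; split.
    have -> : (1 + z ^+ N.+1)^-1 - 1 = - (z ^+ N.+1 / (1 + z ^+ N.+1)) by field.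
    apply: vgeN; right; rewrite dvalM ?invr_neq0 // dvalV n1 dvalX //; nia.
  move=> y ys yx; have {}yz : y z < 0 by apply: yz; rewrite mem_filter /= yx.
  right; rewrite dvalV addrC.
  have [|_ ->] := @dvalD_dom y (z ^+ N.+1) 1 zN0; last by rewrite dvalX //; nia.
  by right; rewrite dval1 dvalX //; nia.
have [e eP] := choice ex.
exists (\sum_(x <- s) e x * a x) => x xs.
rewrite (bigD1_seq x) //= addrAC -{2}[a x]mul1r -mulrBl.
have le1 y : y \in s -> n <= N%:Z - M%:Z by rewrite /N; lia.
apply: vgeD.
  have [h _] := eP x xs; apply: (@vgeW _ _ (N%:Z + - M%:Z)); first by rewrite /N; lia.
  by apply: vgeM => //; right; apply: Mle.
rewrite -big_filter big_seq; apply: vge_sum => y; rewrite mem_filter => /andP[yx ys].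
have [_ /(_ x xs)] := eP y ys; rewrite eq_sym yx => /(_ isT) h.
apply: (@vgeW _ _ (N%:Z + - M%:Z)); first by rewrite /N; lia.
by apply: vgeM => //; right; apply: Mle.
Qed.

End Valuations.

(** * Places from valuation rings *)

Section SpanningOverPolynomials.
Variables (k : finFieldType) (F : fieldType) (c : {rmorphism k -> F}).
Implicit Types (t h : F) (p d : {poly k}).

Definition ev t p : F := (map_poly c p).[t].

Lemma evD t p d : ev t (p + d) = ev t p + ev t d.
Proof. by rewrite /ev rmorphD hornerD. Qed.
Lemma evB t p d : ev t (p - d) = ev t p - ev t d.
Proof. by rewrite /ev rmorphB hornerD hornerN. Qed.
Lemma evM t p d : ev t (p * d) = ev t p * ev t d.
Proof. by rewrite /ev rmorphM hornerM. Qed.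
Lemma evC t (r : k) : ev t r%:P = c r.
Proof. by rewrite /ev map_polyC hornerC. Qed.
Lemma ev0 t : ev t 0 = 0. Proof. by rewrite /ev rmorph0 horner0. Qed.
Lemma ev1 t : ev t 1 = 1. Proof. by rewrite /ev rmorph1 hornerC. Qed.
Lemma evXn t i : ev t 'X^i = t ^+ i.
Proof. by rewrite /ev map_polyXn hornerXn. Qed.
Lemma evX t : ev t 'X = t. Proof. exact: (evXn t 1). Qed.
Lemma ev_sum t (I : Type) (r : seq I) (P : pred I) (G : I -> {poly k}) :
  ev t (\sum_(i <- r | P i) G i) = \sum_(i <- r | P i) ev t (G i).
Proof. by apply: (big_morph (ev t)); [exact: evD|exact: ev0]. Qed.
Lemma ev_prod t (I : Type) (r : seq I) (P : pred I) (G : I -> {poly k}) :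
  ev t (\prod_(i <- r | P i) G i) = \prod_(i <- r | P i) ev t (G i).
Proof. by apply: (big_morph (ev t)); [exact: evM|exact: ev1]. Qed.
Lemma ev_comp t p d : ev t (p \Po d) = ev (ev t d) p.
Proof. by rewrite /ev map_comp_poly horner_comp. Qed.
Lemma ev_sum_coef t p n : (size p <= n)%N -> ev t p = \sum_(i < n) c p`_i * t ^+ i.
Proof.
move=> pn; rewrite /ev (@horner_coef_wide _ n) ?size_map_poly //.
by apply: eq_bigr => i _; rewrite coef_map.
Qed.

Definition transcendental t := forall p, p != 0 -> ev t p != 0.

(* [F] is spanned by [n] elements over the field of fractions of [k[t]]. *)
Definition spans_over t n := exists (I : finType) (b : I -> F), #|I| = n /\
  forall h, exists (a : I -> {poly k}) d,
    ev t d != 0 /\ ev t d * h = \sum_i ev t (a i) * b i.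

Lemma common_denominator t (I : finType) (b : I -> F) (J : finType) (W : J -> F) :
  (forall h, exists (a : I -> {poly k}) d,
    ev t d != 0 /\ ev t d * h = \sum_i ev t (a i) * b i) ->
  exists (A : J -> I -> {poly k}) d, ev t d != 0 /\
    forall j, ev t d * W j = \sum_i ev t (A j i) * b i.
Proof.
move=> sp; have [a aP] := choice (fun j => sp (W j)).
have [d dP] := choice aP.
exists (fun j i => (\prod_(l | l != j) d l) * a j i), (\prod_l d l); split.
  by rewrite ev_prod; apply/prodf_neq0 => l _; have [] := dP l.
move=> j; rewrite (bigD1 j) //= evM mulrAC; have [_ ->] := dP j.
by rewrite mulr_suml; apply: eq_bigr => i _; rewrite evM mulrC mulrA.
Qed.

(** Powers of Q + 1 outgrow every constant multiple of powers of Q, by the Bernoulli-type inequality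
    [step]; [r] just beyond [Q * B] is enough. *)
Lemma leq_of_pow_bound (N Q B : nat) : (0 < Q)%N ->
  (forall r, N ^ r <= Q ^ r * B)%N -> (N <= Q)%N.
Proof.
move=> Q0 le; rewrite leqNgt; apply/negP => NQ.
have step r : (Q ^ r * (Q + r) <= Q * Q.+1 ^ r)%N.
  elim: r => [|r IH]; first by rewrite !expn0 addn0; lia.
  by rewrite !expnS; move: (Q ^ r)%N (Q.+1 ^ r)%N IH => u v; nia.
pose r := (Q * B).+1; have h1 := step r; have h2 := le r.
have h3 : (Q.+1 ^ r <= N ^ r)%N by rewrite leq_exp2r.
have h4 : (0 < Q ^ r)%N by rewrite expn_gt0 Q0.
have : (Q ^ r * (Q + r) <= Q ^ r * (Q * B))%N.
  by apply: leq_trans h1 _; rewrite mulnCA leq_mul2l (leq_trans h3 h2) orbT.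
by rewrite leq_pmul2l // /r; lia.
Qed.

(** The coordinates of a sum of [r] digits times powers of [t] are, up to a common denominator,
    polynomials of size at most [r + B]. Hence #|J|^r is at most q^(n(r + B)) for all [r], and
    [leq_of_pow_bound] removes the constant [B]. *)
Lemma expansions_bound t n (J : finType) (W : J -> F) : spans_over t n ->
  (forall r (f f' : 'I_r -> J), \sum_i W (f i) * t ^+ i = \sum_i W (f' i) * t ^+ i ->
     f =1 f') ->
  (#|J| <= #|k| ^ n)%N.
Proof.
move=> [I [b [<- sp]]] inj.
have [A [d [d0 dP]]] := common_denominator W sp.
pose B := (\max_(ji : J * I) size (A ji.1 ji.2))%N.
pose P r (f : 'I_r -> J) i := \sum_(j < r) A (f j) i * 'X^j.
have sP r (f : 'I_r -> J) i : (size (P r f i) <= r + B)%N.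
  apply: (leq_trans (size_sum _ _ _)); apply/bigmax_leqP => j _.
  have [->|nz] := eqVneq (A (f j) i) 0; first by rewrite mul0r size_poly0.
  rewrite size_mulXn // leq_add ?(ltnW (ltn_ord j)) //.
  exact: (@leq_bigmax _ (fun ji : J * I => size (A ji.1 ji.2)) (f j, i)).
apply: (@leq_of_pow_bound _ _ (#|k| ^ (B * #|I|))).
  by rewrite expn_gt0 (cardD1 0) inE.
move=> r; rewrite -expnM -expnD.
pose G (f : {ffun 'I_r -> J}) : {ffun I -> 'rV[k]_(r + B)} :=
  [ffun i => poly_rV (P r f i)].
have Ginj : injective G.
  move=> f f' /ffunP GG; apply/ffunP; apply: inj.
  have PP i : P r f i = P r f' i.
    by have := GG i; rewrite !ffunE => /(congr1 rVpoly); rewrite !poly_rV_K.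
  apply: (mulfI d0); rewrite !mulr_sumr.
  have E (u : 'I_r -> J) : \sum_(j < r) ev t d * (W (u j) * t ^+ j) =
      \sum_i ev t (P r u i) * b i.
    under eq_bigr do rewrite mulrA dP mulr_suml.
    rewrite exchange_big; apply: eq_bigr => i _.
    rewrite /P ev_sum mulr_suml; apply: eq_bigr => j _.
    by rewrite evM evXn mulrAC.
  by rewrite !E; apply: eq_bigr => i _; rewrite PP.
have := leq_card G Ginj; rewrite !card_ffun card_ord card_mx mul1n -expnM.
by rewrite mulnC mulnDr mulnC [(#|I| * B)%N]mulnC mulnC.
Qed.

Definition subring_set (O : set F) := [/\ O 1, forall a b, O a -> O b -> O (a - b) &
  forall a b, O a -> O b -> O (a * b)].

Section Subring.
Variables (O : set F) (sO : subring_set O).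

Lemma subring_set0 : O 0.
Proof. by case: sO => o1 oB _; rewrite -(subrr 1); apply: oB. Qed.
Lemma subring_setN a : O a -> O (- a).
Proof. by case: sO => o1 oB _ oa; rewrite -sub0r; apply: oB => //; apply: subring_set0. Qed.
Lemma subring_setD a b : O a -> O b -> O (a + b).
Proof. by case: (sO) => o1 oB _ oa ob; rewrite -[b]opprK; apply: oB => //; apply: subring_setN. Qed.
Lemma subring_setX a i : O a -> O (a ^+ i).
Proof. by case: sO => o1 _ oM oa; elim: i => [|i IH]; rewrite ?expr0 // exprS; apply: oM. Qed.
Lemma subring_set_sum (I : Type) (r : seq I) (P : pred I) (G : I -> F) :
  (forall i, P i -> O (G i)) -> O (\sum_(i <- r | P i) G i).
Proof.
move=> oG; elim/big_rec: _ => [|i a Pi oa]; first exact: subring_set0.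
by apply: subring_setD => //; apply: oG.
Qed.
Lemma subring_set_ev t p : (forall r, O (c r)) -> O t -> O (ev t p).
Proof.
move=> oc ot; rewrite (@ev_sum_coef _ _ (size p)) //; apply: subring_set_sum => i _.
by case: sO => _ _ oM; apply: oM => //; apply: subring_setX.
Qed.

(** Digits incongruent modulo [t] give distinct expansions: the lowest digit is determined modulo
    [t], and the others by induction after division by [t]. This bounds the index of the ideal [t O]
    in [O]. *)
Lemma incongruent_bound t n (J : finType) (W : J -> F) : spans_over t n ->
  t != 0 -> O t -> (forall j, O (W j)) ->
  (forall j j', O ((W j - W j') / t) -> j = j') -> (#|J| <= #|k| ^ n)%N.
Proof.
move=> sp t0 ot oW inj; apply: (expansions_bound (W := W) sp).
have [_ oB oM] := sO.
elim=> [|r IH] f f'; first by move=> _ [].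
rewrite !big_ord_recl !expr0 !mulr1.
have E (u : 'I_r.+1 -> J) : \sum_(i < r) W (u (lift ord0 i)) * t ^+ (lift ord0 i) =
   t * \sum_(i < r) W ((u \o lift ord0) i) * t ^+ i.
  by rewrite mulr_sumr; apply: eq_bigr => i _; rewrite /= exprS mulrCA.
rewrite !E => e.
have f0 : f ord0 = f' ord0.
  apply: inj.
  have -> : (W (f ord0) - W (f' ord0)) / t =
     \sum_(i < r) W ((f' \o lift ord0) i) * t ^+ i - \sum_(i < r) W ((f \o lift ord0) i) * t ^+ i.
    apply: (mulfI t0); rewrite [LHS]mulrC divfK //.
    rewrite mulrBr; apply/eqP; rewrite -subr_eq0; apply/eqP; move/eqP: e.
    by rewrite -subr_eq0 => /eqP e0; rewrite -[RHS]e0; ring.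
  by apply: oB; apply: subring_set_sum => i _; apply: oM => //; apply: subring_setX.
move: e; rewrite f0 => /addrI/(mulfI t0)/IH ff' i.
by have [j ->|->//] := unliftP ord0 i; apply: ff'.
Qed.

End Subring.

(** There are q^(n+1) polynomial expressions of degree at most [n] in [h] over k, more than
    [expansions_bound] allows for digits with unique expansions. Two coinciding expansions in [t]
    differ by the required relation. *)
Lemma algebraic_relation t n h : transcendental t -> spans_over t n ->
  exists A : 'I_n.+1 -> {poly k}, (exists j, A j != 0) /\
    \sum_j ev t (A j) * h ^+ j = 0.
Proof.
move=> tr sp; apply: contrapT => nex.
pose W (a : {ffun 'I_n.+1 -> k}) := \sum_j c (a j) * h ^+ j.
have := expansions_bound (W := W) sp; rewrite card_ffun card_ord.
rewrite leq_exp2l ?finRing_gt1 // ltnn => H; apply: notF; apply: H => r f f' e i.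
apply: contrapT => /eqP; rewrite -subr_eq0 => /eqP ne; apply: nex.
exists (fun j => \poly_(i < r) (if insub i is Some i' then f i' j - f' i' j else 0)).
have coefE j (l : 'I_r) : (\poly_(i < r) (if insub i is Some i' then f i' j - f' i' j else 0))`_l
    = f l j - f' l j.
  by rewrite coef_poly ltn_ord insubT // => lt; congr (f _ _ - f' _ _); apply: val_inj.
split.
  apply: contrapT => nj; apply: ne; apply/eqP; rewrite subr_eq0; apply/eqP/ffunP => j.
  apply: contrapT => /eqP; rewrite -subr_eq0 => fj; apply: nj; exists j.
  by apply: contraNneq fj => p0; rewrite -coefE p0 coef0.
move/eqP: e; rewrite -subr_eq0 -sumrB => /eqP e; rewrite -{}[RHS]e.
under eq_bigr => j _.
  rewrite (@ev_sum_coef _ _ r) ?size_poly // mulr_suml.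
  under eq_bigr do rewrite coefE rmorphB mulrAC. over.
rewrite exchange_big; apply: eq_bigr => l _.
rewrite -mulrBl /W -sumrB mulr_suml; apply: eq_bigr => j _; ring.
Qed.

(** Cancelling the lowest power of [h] in a relation makes the constant term nonzero. Thus [h]
    divides a polynomial in [t], which transfers finiteness statements from such polynomials to any
    [h]. *)
Lemma algebraic_relation0 t n h : transcendental t -> spans_over t n -> h != 0 ->
  exists r (A : nat -> {poly k}), A 0%N != 0 /\
    ev t (A 0%N) = h * \sum_(j < r) ev t (A j.+1) * h ^+ j.
Proof.
move=> tr sp h0; have [A [ex0 rel]] := algebraic_relation h tr sp.
pose A' j := if insub j is Some j' then A j' else 0.
have A'E (j : 'I_n.+1) : A' j = A j by rewrite /A' valK.
have ex : exists j, A' j != 0 by have [j] := ex0; rewrite -A'E; exists j.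
pose j0 := ex_minn ex.
have [nz min] : A' j0 != 0 /\ forall i, A' i != 0 -> (j0 <= i)%N.
  by rewrite /j0; case: ex_minnP.
have jn : (j0 <= n)%N.
  by apply: contraNT nz; rewrite -ltnNge /A' => lt; rewrite insubF // ltnS leqNgt lt.
exists (n - j0)%N, (fun j => if j == 0%N then A' j0 else - A' (j0 + j)%N); split=> //=.
have: \sum_(0 <= j < n.+1) ev t (A' j) * h ^+ j = 0.
  by rewrite big_mkord -[RHS]rel; apply: eq_bigr => j _; rewrite A'E.
rewrite (@big_cat_nat _ _ _ j0) //= ?leqW // big_nat big1 ?add0r => [|j /andP[_ lt]]; last first.
  have -> : A' j = 0 by apply/eqP; apply: contraTT lt => /min; rewrite -leqNgt.
  by rewrite ev0 mul0r.
rewrite -{1}[j0]add0n big_addn big_mkord subSn // big_ord_recl /= add0n => e.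
have hj0 : h ^+ j0 != 0 by rewrite expf_neq0.
apply: (mulIf hj0); rewrite mulr_sumr mulr_suml.
move/eqP: e; rewrite addr_eq0 => /eqP->; rewrite -sumrN.
apply: eq_bigr => j _; rewrite /bump /= addnC add1n -[- A' _]sub0r evB ev0 sub0r addnS.
by rewrite -addnS exprD !exprS; ring.
Qed.

Lemma ev_reverse t p N : t != 0 -> (size p <= N)%N ->
  ev t p = t ^+ N * ev t^-1 (\sum_(i < N) p`_i *: 'X^(N - i)).
Proof.
move=> t0 sN; rewrite (ev_sum_coef _ sN) ev_sum mulr_sumr; apply: eq_bigr => i _.
rewrite -mul_polyC evM evC evXn mulrCA; congr (_ * _).
by rewrite exprVn -[in X in _ = X * _](subnK (ltnW (ltn_ord i))) exprD mulrAC divff ?mul1r // expf_neq0.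
Qed.

Lemma reverse_neq0 p N : p != 0 -> (size p <= N)%N ->
  \sum_(i < N) p`_i *: 'X^(N - i) != 0 :> {poly k}.
Proof.
move=> p0 sN; have lt : ((size p).-1 < N)%N.
  by rewrite prednK // ?(leq_trans _ sN) // size_poly_gt0.
apply: contra_neq p0 => /(congr1 (coefp (N - (size p).-1))) /=.
rewrite coef0 coef_sum (bigD1 (Ordinal lt)) //= big1 ?addr0.
  by rewrite coefZ coefXn eqxx mulr1 => /eqP; rewrite -lead_coefE lead_coef_eq0 => /eqP.
move=> i /negPf ne; rewrite coefZ coefXn; case: eqP => [e|]; last by rewrite mulr0.
by move/eqP: ne; case; apply: val_inj => /=; have := ltn_ord i; lia.
Qed.

Lemma spans_overV t n : t != 0 -> spans_over t n -> spans_over t^-1 n.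
Proof.
move=> t0 [I [b [In sp]]]; exists I, b; split=> // h.
have [a [d [d0 dh]]] := sp h.
pose N := maxn (size d) (\max_i size (a i)).
have dN : (size d <= N)%N by rewrite leq_maxl.
have aN i : (size (a i) <= N)%N.
  apply: leq_trans (leq_maxr _ _).
  exact: (@leq_bigmax _ (fun i => size (a i))).
pose rv p := \sum_(i < N) p`_i *: 'X^(N - i) : {poly k}.
exists (fun i => rv (a i)), (rv d).
have tN : t ^+ N != 0 by rewrite expf_neq0.
move: d0 dh; rewrite (ev_reverse t0 dN) mulf_eq0 negb_or => /andP[_ ->].
move=> dh; split=> //; apply: (mulfI tN); rewrite mulrA dh mulr_sumr.
by apply: eq_bigr => i _; rewrite (ev_reverse t0 (aN i)) mulrA.
Qed.

Lemma transcendentalV t : transcendental t -> transcendental t^-1.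
Proof.
move=> tr p p0.
have t0 : t != 0 by have := tr 'X; rewrite evX polyX_eq0; apply.
rewrite (@ev_reverse _ p (size p)) ?invr_neq0 // invrK mulf_neq0 ?expf_neq0 ?invr_neq0 //.
by apply: tr; apply: reverse_neq0.
Qed.

Lemma comp_expansion p (a : {poly k}) : (1 < size p)%N ->
  exists A : 'I_(size p).-1 -> {poly k}, a = \sum_j (A j \Po p) * 'X^j.
Proof.
move=> p1; have p0 : p != 0 by rewrite -size_poly_gt0 (ltn_trans _ p1).
have [n] := ubnP (size a); elim: n a => // n IH a; rewrite ltnS => an.
have [->|a0] := eqVneq a 0.
  by exists (fun=> 0); rewrite big1 // => j _; rewrite comp_poly0 mul0r.
have [|A AP] := IH (a %/ p).
  by rewrite size_divp // (leq_trans _ an) // ltn_subrL size_poly_gt0 a0 -subn1 subn_gt0 p1.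
exists (fun j => A j * 'X + ((a %% p)`_j)%:P).
have modE : a %% p = \sum_(j < (size p).-1) ((a %% p)`_j)%:P * 'X^j.
  have sb : (size (a %% p)%R <= (size p).-1)%N by rewrite -ltnS (prednK (ltnW p1)) ltn_modp.
  apply/polyP => i; rewrite coef_sum; under eq_bigr do rewrite coefCM coefXn.
  have [lt|ge] := ltnP i (size p).-1.
    rewrite (bigD1 (Ordinal lt)) //= eqxx mulr1 big1 ?addr0 // => j /negPf ne.
    by case: eqP => [e|]; rewrite ?mulr0 //; case/eqP: ne; apply: val_inj.
  rewrite nth_default ?(leq_trans sb) // big1 // => j _.
  by case: eqP => [e|]; rewrite ?mulr0 //; have := ltn_ord j; rewrite -e ltnNge ge.
rewrite {1}(divp_eq a p) {1}AP {1}modE mulr_suml -big_split /=.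
apply: eq_bigr => j _.
by rewrite comp_polyD comp_polyM comp_polyX comp_polyC mulrDl mulrAC.
Qed.

(** Two powers of [p] are congruent modulo [d] by the pigeonhole principle; their difference is a
    polynomial in [p]. *)
Lemma multiple_in_subring p d : (1 < size p)%N -> d != 0 ->
  exists e D, D != 0 /\ d * e = D \Po p :> {poly k}.
Proof.
move=> p1 d0.
pose G (i : 'I_(#|{: 'rV[k]_(size d)}|).+1) : 'rV[k]_(size d) := poly_rV (p ^+ i %% d).
have /injectivePn[i [j ij]] : ~~ injectiveb G.
  by apply/negP => /injectiveP/leq_card; rewrite card_ord ltnn.
have sm q : (size (q %% d)%R <= size d)%N by apply: ltnW; rewrite ltn_modp.
move=> /(congr1 rVpoly); rewrite (poly_rV_K (sm _)) (poly_rV_K (sm _)) => e.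
have /dvdpP[r er] : d %| p ^+ i - p ^+ j by rewrite /dvdp modpD modpN e subrr.
exists r, ('X^i - 'X^j); split; last first.
  by rewrite mulrC -er comp_polyB !comp_Xn_poly.
apply: contra_neq ij => /(congr1 (coefp i)) /eqP.
rewrite /= coefB !coefXn coef0 eqxx; case: (eqVneq (i : nat) j) => [/val_inj -> //|_].
by rewrite subr0 oner_eq0.
Qed.

Lemma spans_over_ev t n p : transcendental t -> spans_over t n -> (1 < size p)%N ->
  spans_over (ev t p) (n * (size p).-1).
Proof.
move=> tr [I [b [<- sp]]] p1.
exists (I * 'I_(size p).-1)%type, (fun ij : I * 'I_(size p).-1 => b ij.1 * t ^+ ij.2); split.
  by rewrite card_prod card_ord.
move=> h; have [a [d [d0 dh]]] := sp h.
have d0' : d != 0 by apply: contra_neq d0 => ->; rewrite ev0.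
have [e [D [D0 De]]] := multiple_in_subring p1 d0'.
have /choice[A AP] i := comp_expansion (a i * e) p1.
exists (fun ij => A ij.1 ij.2), D; rewrite -ev_comp -De; split.
  by rewrite De; apply: tr; rewrite comp_poly_eq0.
rewrite evM mulrAC dh mulr_suml.
rewrite (eq_bigr (fun i => \sum_j ev (ev t p) (A i j) * (b i * t ^+ j))).
  by rewrite pair_bigA.
move=> i _; rewrite mulrAC -evM AP ev_sum mulr_suml; apply: eq_bigr => j _.
by rewrite evM evXn ev_comp mulrAC mulrA.
Qed.

End SpanningOverPolynomials.

(** * Chevalley's extension theorem for valuation rings *)

Section Chevalley.
Variables (F : fieldType) (R0 : set F) (s : F).
Hypotheses (sR0 : subring_set R0) (R0s : R0 s) (R0sV : ~ R0 s^-1).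

Definition dominating (A : set F) := [/\ subring_set A, R0 `<=` A & ~ A s^-1].

Lemma dominating_maximal : exists A, dominating A /\
  forall B, dominating B -> A `<=` B -> B `<=` A.
Proof.
pose P (A : set F) := A = set0 \/ dominating A.
have [G GP Gtot|A [PA maxA]] := @Zorn_bigcup _ P.
  have [[X GX [x Xx]]|nX] := pselect (exists2 X, G X & exists x, X x); last first.
    by left; rewrite -subset0 => x [X GX Xx]; apply: nX; exists X => //; exists x.
  have good Y y : G Y -> Y y -> dominating Y.
    by move=> GY Yy; have [Y0|//] := GP _ GY; move: Yy; rewrite Y0.
  right; have [[X1 _ _] RX _] := good _ _ GX Xx; split.
  - have two a b : (\bigcup_(X in G) X) a -> (\bigcup_(X in G) X) b ->
        exists2 Y, G Y & dominating Y /\ Y a /\ Y b.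
      move=> [Y GY Ya] [Z GZ Zb]; have [YZ|ZY] := Gtot _ _ GY GZ.
        by exists Z => //; split; [exact: good Zb|split=> //; apply: YZ].
      by exists Y => //; split; [exact: good Ya|split=> //; apply: ZY].
    split; first by exists X.
      move=> a b Ga Gb; have [Y GY [[[_ YB _] _ _] [Ya Yb]]] := two _ _ Ga Gb.
      by exists Y => //; apply: YB.
    move=> a b Ga Gb; have [Y GY [[[_ _ YM] _ _] [Ya Yb]]] := two _ _ Ga Gb.
    by exists Y => //; apply: YM.
  - by move=> r /RX Xr; exists X.
  - by move=> [Y GY Ys]; have [_ _] := good _ _ GY Ys.
have gA : dominating A.
  case: PA => // A0; have [] := maxA R0; last by right; split.
  by rewrite A0; split => // h; have [/h] := sR0.
exists A; split=> // B gB AB; apply: contrapT => nBA.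
by apply: (maxA B); [split|right].
Qed.

Variable A : set F.
Hypotheses (gA : dominating A) (maxA : forall B, dominating B -> A `<=` B -> B `<=` A).

(** The fractions with denominators in 1 - sA form a ring that still avoids the inverse of [s], so
    maximality puts them in [A]. *)
Lemma dominating_unit b : A b -> A (1 - s * b)^-1.
Proof.
case: gA => sA RA nAs Ab; have [A1 AB AM] := sA.
have As : A s by apply: RA.
have nz a : A a -> 1 - s * a != 0.
  move=> Aa; apply/eqP => /eqP; rewrite subr_eq0 => /eqP e; apply: nAs.
  have s0 : s != 0 by apply: contra_eq_neq e => ->; rewrite mul0r oner_neq0.
  by have -> : s^-1 = a by apply: (mulfI s0); rewrite -e divff.
pose B : set F := [set x | exists a b, [/\ A a, A b & (1 - s * b) * x = a]].
have AsubB : A `<=` B.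
  move=> a Aa; exists a, 0; split=> //; first exact: subring_set0.
  by rewrite mulr0 subr0 mul1r.
have prodE u w : (1 - s * u) * (1 - s * w) = 1 - s * (u + w - s * (u * w)) by ring.
have Aprod u w : A u -> A w -> A (u + w - s * (u * w)).
  by move=> Au Aw; apply: AB; [apply: subring_setD|apply: (AM) => //; apply: AM].
have A1s u : A u -> A (1 - s * u) by move=> Au; apply: AB => //; apply: AM.
have sB : subring_set B.
  split; first exact: AsubB.
  - move=> x y [a [u [Aa Au xE]]] [b' [w [Ab' Aw yE]]].
    exists ((1 - s * w) * a - (1 - s * u) * b'), (u + w - s * (u * w)); split.
    + by apply: AB; apply: AM => //; apply: A1s.
    + exact: Aprod.
    + by rewrite -prodE -xE -yE; ring.
  - move=> x y [a [u [Aa Au xE]]] [b' [w [Ab' Aw yE]]].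
    exists (a * b'), (u + w - s * (u * w)); split; [exact: AM|exact: Aprod|].
    by rewrite -prodE -xE -yE; ring.
apply: (maxA (B := B)) => //; last first.
  by exists 1, b; split=> //; rewrite divff ?nz.
split=> //; first by move=> r /RA/AsubB.
move=> [a [u [Aa Au e]]]; apply: nAs.
have s0 : s != 0 by apply/eqP => s0; move: R0sV; rewrite s0 invr0 -s0.
have -> : s^-1 = a + u by rewrite -e; field.
exact: subring_setD.
Qed.

Lemma dominating_adjoin z : ~ A z -> exists p : {poly F}, (forall i, A p`_i) /\ p.[z] = s^-1.
Proof.
case: gA => sA RA nAs Az; have [A1 AB AM] := sA.
apply: contrapT => np.
pose B : set F := [set x | exists p : {poly F}, (forall i, A p`_i) /\ x = p.[z]].
have AsubB : A `<=` B.
  move=> a Aa; exists a%:P; split; last by rewrite hornerC.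
  by move=> i; rewrite coefC; case: ifP => // _; apply: subring_set0.
apply: Az; apply: (maxA (B := B)) => //; last first.
  exists 'X; rewrite hornerX; split=> // i; rewrite coefX.
  by case: (i == 1%N) => //; apply: subring_set0.
split; last by move=> [p [Ap e]]; apply: np; exists p.
  split; first exact: AsubB.
    move=> x y [p [Ap ->]] [q [Aq ->]]; exists (p - q); rewrite hornerD hornerN.
    by split=> // i; rewrite coefB; apply: AB.
  move=> x y [p [Ap ->]] [q [Aq ->]]; exists (p * q); rewrite hornerM.
  split=> // i; rewrite coefM; apply: subring_set_sum => // j _; exact: AM.
by move=> r /RA/AsubB.
Qed.

(** The descent in Chevalley's theorem. By the symmetry between [z] and its inverse, [q] may be
    taken of the smaller size. Since 1 - s q_0 is a unit of [A], the second relation expresses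
    [z ^+ n] through lower powers, and this shortens [p]. *)
Lemma dominating_no_two_relations z (p q : {poly F}) : z != 0 ->
  (forall i, A p`_i) -> (forall i, A q`_i) -> p.[z] = s^-1 -> q.[z^-1] = s^-1 -> False.
Proof.
case: gA => sA RA nAs; have [A1 AB AM] := sA.
have s0 : s != 0 by apply/eqP => s0; move: R0sV; rewrite s0 invr0 -s0.
have [N] := ubnP (size p + size q)%N; elim: N z p q => // N IH z p q.
wlog le : z p q / (size q <= size p)%N.
  move=> th sN z0 Ap Aq pz qz; have [le|/ltnW le] := leqP (size q) (size p).
    exact: (th z p q).
  by apply: (th z^-1 q p) => //; rewrite ?invr_eq0 ?invrK // addnC.
rewrite ltnS => sN z0 Ap Aq pz qz.
have [q1|q1] := leqP (size q) 1.
  by move: qz; rewrite (size1_polyC q1) hornerC => e; apply: nAs; rewrite -e.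
pose n := (size p).-1; pose m := (size q).-1.
have mn : (m <= n)%N by rewrite /m /n; lia.
have m0 : (0 < m)%N by rewrite /m; lia.
have qE : q.[z^-1] = q`_0 + \sum_(j < m) q`_j.+1 * z^-1 ^+ j.+1.
  rewrite horner_coef; have -> : size q = m.+1 by rewrite /m prednK ?(ltnW q1).
  by rewrite big_ord_recl expr0 mulr1.
have pE : p.[z] = \sum_(i < n) p`_i * z ^+ i + p`_n * z ^+ n.
  rewrite horner_coef; have -> : size p = n.+1 by rewrite /n prednK // (leq_trans (ltnW q1) le).
  by rewrite big_ord_recr.
pose u := (1 - s * q`_0)^-1; have Au : A u by apply: dominating_unit.
have u0 : 1 - s * q`_0 != 0.
  apply/eqP => /eqP; rewrite subr_eq0 => /eqP e; apply: nAs.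
  by have -> : s^-1 = q`_0 by apply: (mulfI s0); rewrite -e divff.
have zn : z ^+ n = u * s * \sum_(j < m) q`_j.+1 * z ^+ (n - j.+1).
  have -> : \sum_(j < m) q`_j.+1 * z ^+ (n - j.+1) = z ^+ n * (s^-1 - q`_0).
    rewrite -qz qE addrC addKr mulr_sumr; apply: eq_bigr => j _.
    have jn : (j.+1 <= n)%N by apply: leq_trans mn; apply: ltn_ord.
    by rewrite mulrCA -{2}(subnK jn) exprD exprVn mulfK // expf_neq0.
  by rewrite /u; field; rewrite s0.
pose p' : {poly F} := \poly_(i < n) p`_i + \sum_(j < m) (p`_n * u * s * q`_j.+1) *: 'X^(n - j.+1).
have sp' : (size p' <= n)%N.
  apply: (leq_trans (size_polyD _ _)); rewrite geq_max size_poly /=.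
  apply: (leq_trans (size_sum _ _ _)); apply/bigmax_leqP => j _.
  by apply: (leq_trans (size_scale_leq _ _)); rewrite size_polyXn; have := ltn_ord j; lia.
apply: (IH z p' q) => //.
- by apply: leq_trans sN; rewrite -addSn leq_add2r; move: sp' mn m0; rewrite /n; lia.
- have As : A s by apply: RA.
  have Ac j : A (p`_n * u * s * q`_j.+1) by apply: (AM) => //; apply: (AM) => //; apply: AM.
  move=> i; rewrite coefD coef_poly coef_sum; apply: subring_setD => //.
    by case: ifP => // _; apply: subring_set0.
  apply: subring_set_sum => // j _; rewrite coefZ coefXn.
  by case: eqP; rewrite ?mulr1 // mulr0 => _; apply: subring_set0.
- rewrite -pz pE hornerD horner_poly zn mulr_sumr mulr_sumr horner_sum; congr (_ + _).
  by apply: eq_bigr => j _; rewrite hornerZ hornerXn; ring.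
Qed.

Lemma dominating_valuation z : A z \/ A z^-1.
Proof.
have [Az|Az] := pselect (A z); first by left.
right; apply: contrapT => AzV.
have z0 : z != 0.
  by apply/eqP => z0; apply: Az; rewrite z0; case: gA => sA _ _; apply: subring_set0.
have [p [Ap pz]] := dominating_adjoin Az; have [q [Aq qz]] := dominating_adjoin AzV.
exact: (dominating_no_two_relations z0 Ap Aq).
Qed.

End Chevalley.

Lemma chevalley (F : fieldType) (R0 : set F) (s : F) :
  subring_set R0 -> R0 s -> ~ R0 s^-1 ->
  exists O, [/\ subring_set O, R0 `<=` O, ~ O s^-1 & forall z, O z \/ O z^-1].
Proof.
move=> sR R0s nR; have [A [gA maxA]] := dominating_maximal sR nR.
exists A; have [? ? ?] := gA; split=> //.
exact: (dominating_valuation R0s nR gA maxA).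
Qed.

(** * Discreteness of the valuation rings of a function field *)

Section PlaceOfValuationRing.
Variables (k : finFieldType) (F : fieldType) (c : {rmorphism k -> F}).
Variables (t : F) (n : nat).
Hypotheses (t_tr : transcendental c t) (t_sp : spans_over c t n).
Variable O : set F.
Hypotheses (sO : subring_set O) (vO : forall z, O z \/ O z^-1).
Hypotheses (Oc : forall r, O (c r)) (On : exists z, ~ O z).

Let O1 : O 1. Proof. by case: sO. Qed.
Let OB a b : O a -> O b -> O (a - b). Proof. by case: sO => _ + _; apply. Qed.
Let OM a b : O a -> O b -> O (a * b). Proof. by case: sO => _ _; apply. Qed.
Let O0 : O 0. Proof. exact: subring_set0. Qed.
Lemma valring_generator : exists s m, [/\ O s, transcendental c s & spans_over c s m].
Proof.
have t0 : t != 0 by have := @t_tr 'X; rewrite evX polyX_eq0; apply.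
have [Ot|Ot] := vO t; first by exists t, n.
by exists t^-1, n; split=> //; [apply: transcendentalV|apply: spans_overV].
Qed.

(** [a] divides in [O] a polynomial in an integral generator, to which [incongruent_bound] applies.
    If that polynomial is constant, [a] is a unit and there is a single class. *)
Lemma valring_finite_index a : a != 0 -> O a -> exists N, forall (J : finType) (W : J -> F),
  (forall j, O (W j)) -> (forall j j', O ((W j - W j') / a) -> j = j') -> (#|J| <= N)%N.
Proof.
move=> a0 Oa; have [s [m [Os s_tr s_sp]]] := valring_generator.
have [r [A [A0 e]]] := algebraic_relation0 s_tr s_sp a0.
set y := \sum_(_ < _) _ in e.
have Oy : O y.
  apply: subring_set_sum => // j _; apply: OM; last exact: subring_setX.
  exact: subring_set_ev.
have [A1|A1] := leqP (size (A 0%N)) 1.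
  move: A0 e; rewrite (size1_polyC A1) evC polyC_eq0; set d := (A 0%N)`_0 => d0 e.
  exists 1%N => J W OW inj; rewrite -card_unit; apply: (@leq_card _ _ (fun=> tt)).
  move=> j j' _; apply: inj; apply: OM; first exact: OB.
  have cd0 : c d != 0 by rewrite fmorph_eq0.
  have -> : a^-1 = y * c d^-1.
    by apply: (mulfI a0); rewrite mulrA -e fmorphV !divff.
  exact: OM.
have s0 := s_tr _ A0.
exists (#|k| ^ (m * (size (A 0%N)).-1))%N => J W OW inj.
apply: (incongruent_bound sO (spans_over_ev s_tr s_sp A1) s0 _ OW).
  exact: subring_set_ev.
move=> j j' h; apply: inj.
have -> : (W j - W j') / a = (W j - W j') / ev c s (A 0%N) * y.
  rewrite -mulrA; congr (_ * _); apply: (mulfI s0).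
  by rewrite mulrA divff // mul1r {1}e mulrAC divff // mul1r.
exact: OM.
Qed.

Let nonunit b := O b /\ ~ O b^-1.

Let nonunit_neq0 b : nonunit b -> b != 0.
Proof. by case=> _ nb; apply/eqP => b0; apply: nb; rewrite b0 invr0. Qed.

Let nonunit_1B b : nonunit b -> O (1 - b)^-1.
Proof.
move=> nb; have [Ob nbV] := nb; have b0 := nonunit_neq0 nb.
apply: contrapT => n1.
have b1 : 1 - b != 0 by apply/eqP => e; apply: n1; rewrite e invr0.
have [h|h] := vO (b / (1 - b)).
  apply: n1; have -> : (1 - b)^-1 = 1 + b / (1 - b) by field.
  exact: subring_setD.
apply: nbV; have -> : b^-1 = 1 + (b / (1 - b))^-1 by field; rewrite ?b0 ?b1.
exact: subring_setD.
Qed.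

Let nonunitX b i : nonunit b -> nonunit (b ^+ i.+1).
Proof.
move=> nb; have b0 := nonunit_neq0 nb; case: nb => Ob nbV.
split; first exact: subring_setX.
move=> h; apply: nbV; have -> : b^-1 = b ^+ i * (b ^+ i.+1)^-1.
  by rewrite exprS; field; rewrite b0 expf_neq0.
by apply: OM => //; apply: subring_setX.
Qed.

(** Otherwise there would be nonunits [s i] generating a strictly increasing chain of ideals. The
    members after [s 0] are pairwise incongruent modulo [s 0], because 1 - b is a unit for every
    nonunit b; this contradicts [valring_finite_index]. *)
Lemma valring_uniformizer : exists p, nonunit p /\ forall b, nonunit b -> O (b / p).
Proof.
have [z nz] := On.
have nz1 : nonunit z^-1.
  by split; [have [] := vO z|rewrite invrK].
apply: contrapT => np.
have next a : exists b, nonunit a -> nonunit b /\ ~ O (b / a).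
  have [na|na] := pselect (nonunit a); last by exists 0.
  apply: contrapT => nb; apply: np; exists a; split=> // b nb'.
  by apply: contrapT => h; apply: nb; exists b.
have [g gP] := choice next.
pose s i := iter i g z^-1.
have ns i : nonunit (s i) by elim: i => [//|i IH]; have [] := gP _ IH.
have s0 i := nonunit_neq0 (ns i).
have dec i j : (i < j)%N -> O (s i / s j) /\ ~ O (s j / s i).
  move=> /subnK <-; elim: (j - i.+1)%N => [|d [IH1 IH2]].
    have [_ h] := gP _ (ns i); rewrite add0n; split=> //.
    by have [|] := vO (s i / s i.+1) => //; rewrite invf_div.
  set l := (d + i.+1)%N in IH1 IH2 *; rewrite addSn -/l.
  have [_ h] := gP _ (ns l).
  have h' : O (s l / s l.+1) by have [|] := vO (s l / s l.+1) => //; rewrite invf_div.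
  split.
    have -> : s i / s l.+1 = s i / s l * (s l / s l.+1) by rewrite mulrA divfK.
    exact: OM.
  move=> h2; apply: h; have -> : s l.+1 / s l = s l.+1 / s i * (s i / s l) by rewrite mulrA divfK.
  exact: OM.
have [N NP] := valring_finite_index (s0 0%N) (proj1 nz1).
have := NP 'I_N.+1 (fun i => s i.+1); rewrite card_ord ltnn => H; apply: notF; apply: H.
  by move=> j; case: (ns j.+1).
suff H (i j : nat) : (i < j)%N -> ~ O ((s i.+1 - s j.+1) / s 0%N).
  move=> i j h; apply: val_inj => /=; case: (ltngtP i j) => // lt; first by case: (H _ _ lt).
  by case: (H _ _ lt); rewrite -opprB mulNr; apply: subring_setN.
move=> lt h; have [d1 d2] := dec i.+1 j.+1 lt; have [_ d3] := dec 0%N j.+1 isT.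
apply: d3; have nq : O (1 - s i.+1 / s j.+1)^-1.
  by apply: nonunit_1B; split=> //; rewrite invf_div.
have -> : s j.+1 / s 0%N = - ((s i.+1 - s j.+1) / s 0%N * (1 - s i.+1 / s j.+1)^-1).
  have ne : s j.+1 - s i.+1 != 0.
    by apply/eqP => e; apply: d2; move/eqP: e; rewrite subr_eq0 => /eqP->; rewrite divff.
  by field; rewrite !s0 ne.
by apply: (subring_setN sO); apply: OM h nq.
Qed.

Lemma place_of_valring : exists v : dvaluation F, forall h, O h <-> vge v h 0.
Proof.
have [p [np pP]] := valring_uniformizer.
have p0 := nonunit_neq0 np; have [Op npV] := np.
have OpX (i j : int) : i <= j -> O (p ^ j / p ^ i).
  move=> ij; rewrite invr_expz -expfzDr // -[_ - _]gez0_abs ?subr_ge0 //; exact: subring_setX.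
have pX_le (i j : int) : O (p ^ j / p ^ i) -> i <= j.
  rewrite invr_expz -expfzDr // => h; rewrite leNgt; apply/negP => ji.
  apply: npV; have -> : p^-1 = p ^ (j - i) * p ^ (i - j - 1).
    by rewrite -expfzDr // (_ : _ + _ = -1) //; lia.
  apply: OM => //; rewrite -[i - j - 1]gez0_abs; last by lia.
  exact: (subring_setX sO).
(* If no power of [p] were associated to [a], all of them would divide [a] and be pairwise
   incongruent modulo [a]. *)
have ex1 a : a != 0 -> O a -> exists j : int, O (a / p ^ j) /\ O (p ^ j / a).
  move=> a0 Oa; apply: contrapT => nj.
  have div (j : nat) : O (a / p ^+ j).
    elim: j => [|j IH]; first by rewrite expr0 divr1.
    rewrite exprS invfM mulrCA mulrC; apply: pP; split=> // h.
    by apply: nj; exists j; rewrite invf_div in h.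
  have [N NP] := valring_finite_index a0 Oa.
  have := NP 'I_N.+1 (fun i => p ^+ i); rewrite card_ord ltnn => H; apply: notF; apply: H.
    by move=> j; apply: subring_setX.
  suff H (i j : nat) : (i < j)%N -> ~ O ((p ^+ i - p ^+ j) / a).
    move=> i j h; apply: val_inj => /=; case: (ltngtP i j) => // lt; first by case: (H _ _ lt).
    by case: (H _ _ lt); rewrite -opprB mulNr; apply: subring_setN.
  move=> ij h; apply: npV.
  have nq : O (1 - p ^+ (j - i))^-1 by rewrite -[(j - i)%N]prednK ?subn_gt0 //; apply/nonunit_1B/nonunitX.
  have ne : 1 - p ^+ (j - i) != 0.
    have [_ h'] := nonunitX (j - i).-1 np; rewrite prednK ?subn_gt0 // in h'.
    by apply/eqP => /eqP; rewrite subr_eq0 => /eqP e; apply: h'; rewrite -e invr1.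
  have -> : p^-1 = (p ^+ i - p ^+ j) / a * (1 - p ^+ (j - i))^-1 * (a / p ^+ i.+1).
    rewrite -{1}(subnK (ltnW ij)) exprD exprS; field.
    by rewrite p0 a0 ne expf_neq0.
  by apply: (OM) => //; apply: OM.
have ex a : exists j : int, a != 0 -> O (a / p ^ j) /\ O (p ^ j / a).
  have [->|a0] := eqVneq a 0; first by exists 0.
  have [Oa|Oa] := vO a; first by have [j] := ex1 _ a0 Oa; exists j.
  have [||j [h1 h2]] := ex1 a^-1; rewrite ?invr_eq0 //.
  exists (- j) => _; rewrite -invr_expz invrK.
  by split; [move: h2|move: h1]; rewrite ?invrK // mulrC // -invfM mulrC.
have [v vP] := choice ex.
have vO_le a (i : int) : a != 0 -> O (a / p ^ i) <-> i <= v a.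
  move=> a0; have [h1 h2] := vP a a0; split.
    move=> h; apply: pX_le; have -> : p ^ v a / p ^ i = p ^ v a / a * (a / p ^ i).
      by rewrite mulrA divfK.
    exact: OM.
  move=> /OpX h; have -> : a / p ^ i = a / p ^ v a * (p ^ v a / p ^ i).
    by rewrite mulrA divfK // expfz_neq0.
  exact: OM.
pose w a := if a == 0 then 0 else v a.
have w0 : w 0 = 0 by rewrite /w eqxx.
have wE a : a != 0 -> w a = v a by rewrite /w => /negPf->.
have wM a b : a != 0 -> b != 0 -> w (a * b) = w a + w b.
  move=> a0 b0; rewrite !wE ?mulf_neq0 //.
  have [a1 a2] := vP a a0; have [b1 b2] := vP b b0.
  have [ab1 ab2] := vP (a * b) (mulf_neq0 a0 b0).
  apply/eqP; rewrite eq_le; apply/andP; split; last first.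
    apply/vO_le; first exact: mulf_neq0.
    have -> : a * b / p ^ (v a + v b) = (a / p ^ v a) * (b / p ^ v b).
      by rewrite expfzDr // invfM; ring.
    exact: OM.
  apply: pX_le.
  have -> : p ^ (v a + v b) / p ^ v (a * b) = (p ^ v a / a) * (p ^ v b / b) * (a * b / p ^ v (a * b)).
    by rewrite expfzDr //; field; rewrite a0 b0 expfz_neq0.
  by apply: (OM) => //; apply: OM.
have wD a b : a != 0 -> b != 0 -> a + b != 0 -> Num.min (w a) (w b) <= w (a + b).
  move=> a0 b0 ab0; rewrite !wE //; apply/vO_le => //.
  rewrite mulrDl; apply: subring_setD => //; apply/vO_le => //; rewrite ge_min lexx ?orbT //.
have ws : exists2 a, a != 0 & w a = 1.
  exists p => //; rewrite wE //; apply/eqP; rewrite eq_le; apply/andP; split; last first.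
    by apply/vO_le => //; rewrite expr1z divff.
  by apply: pX_le; rewrite expr1z; have [] := vP p p0.
exists (DValuation w0 wM wD ws) => h; have [->|h0] := eqVneq h 0.
  by split=> // _; apply: vge0.
rewrite vgeE //= wE //; split=> [Oh|/vO_le]; last by rewrite expr0z divr1; apply.
by apply/vO_le => //; rewrite expr0z divr1.
Qed.

End PlaceOfValuationRing.

(** * Bases of quotients and counting by fibres *)

Section QuotientBasis.
Variables (k : fieldType) (V : zmodType) (sc : k -> V -> V).
Hypotheses (scDr : forall a v w, sc a (v + w) = sc a v + sc a w)
  (scDl : forall a b v, sc (a + b) v = sc a v + sc b v)
  (scA : forall a b v, sc (a * b) v = sc a (sc b v))
  (sc1 : forall v, sc 1 v = v).
Variables (U W : set V).
Hypotheses (WB : forall v w, W v -> W w -> W (v - w)) (Wsc : forall a v, W v -> W (sc a v)).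

Definition quot_span n (b : 'I_n -> V) := (forall i, U (b i)) /\
  forall v, U v -> exists a : {ffun 'I_n -> k}, W (v - \sum_i sc (a i) (b i)).

(** A spanning family of minimal length is independent modulo [W], since a relation would eliminate
    one of its members. This gives [quot_dim], chosen by [xget], its intended meaning as soon as
    some finite family spans. *)
Lemma quot_dim_basis : (exists n (b : 'I_n -> V), quot_span b) ->
  exists b : 'I_(quot_dim sc U W) -> V, (forall i, U (b i)) /\
    forall v, U v -> exists! a : {ffun 'I_(quot_dim sc U W) -> k},
      W (v - \sum_i sc (a i) (b i)).
Proof.
move=> ex; suff : exists n (b : 'I_n -> V), (forall i, U (b i)) /\
    forall v, U v -> exists! a : {ffun 'I_n -> k}, W (v - \sum_i sc (a i) (b i)).
  by move=> exb; apply: (@xgetPex _ 0%N [set n | exists b : 'I_n -> V, (forall i, U (b i)) /\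
    forall v, U v -> exists! a : {ffun 'I_n -> k}, W (v - \sum_i sc (a i) (b i))]).
have sc0r a : sc a 0 = 0 by apply: (addIr (sc a 0)); rewrite -scDr !add0r.
have scNr a v : sc a (- v) = - sc a v.
  by apply: (addIr (sc a v)); rewrite -scDr !addNr sc0r.
have scBl a b v : sc (a - b) v = sc a v - sc b v.
  by apply: (addIr (sc b v)); rewrite -scDl !subrK.
have scS a (I : Type) (r : seq I) (P : pred I) (G : I -> V) :
    sc a (\sum_(i <- r | P i) G i) = \sum_(i <- r | P i) sc a (G i).
  by apply: (big_morph (sc a)); [move=> x y; rewrite scDr|rewrite sc0r].
have ex' : exists n, `[< exists b : 'I_n -> V, quot_span b >].
  by have [n h] := ex; exists n; apply/asboolP.
case: (ex_minnP ex') => n /asboolP[b [Ub sp]] min.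
exists n, b; split=> // v Uv; have [a Wa] := sp v Uv.
exists a; split=> // a' Wa'; apply: contrapT => ne.
have [e [We [i0 ei0]]] : exists e : 'I_n -> k, W (\sum_i sc (e i) (b i)) /\ exists i, e i != 0.
  exists (fun i => a' i - a i); split.
    under eq_bigr do rewrite scBl; rewrite sumrB.
    by have := WB Wa Wa'; rewrite opprB addrC addrA subrK.
  apply: contrapT => h; apply: ne; apply/ffunP => i; apply: contrapT => hi.
  by apply: h; exists i; rewrite subr_eq0; apply/eqP => e; apply: hi.
have /= We' : W (b i0 + \sum_(i | i != i0) sc (e i / e i0) (b i)).
  have := Wsc (e i0)^-1 We; rewrite scS (bigD1 i0) //= -scA mulVf // sc1.
  by congr (W (_ + _)); apply: eq_bigr => i _; rewrite -scA mulrC.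
clear ne a Wa a' Wa' We ex' ex.
case: n b Ub sp min e i0 ei0 We' => [|n] b Ub sp min e i0 ei0 We'; first by case: (i0).
have := min n; rewrite ltnn => H; apply: notF; apply: H; apply/asboolP.
exists (b \o lift i0); split; first by move=> i; apply: Ub.
move=> w Uw; have [a Wa] := sp w Uw.
exists [ffun j => a (lift i0 j) - a i0 * (e (lift i0 j) / e i0)].
have -> : w - \sum_i sc ([ffun j => a (lift i0 j) - a i0 * (e (lift i0 j) / e i0)] i) ((b \o lift i0) i)
   = w - \sum_i sc (a i) (b i) - sc (- a i0) (b i0 + \sum_(i | i != i0) sc (e i / e i0) (b i)).
  have liftE (G : 'I_n.+1 -> V) : \sum_(i | i != i0) G i = \sum_j G (lift i0 j).
    by apply: (addrI (G i0)); rewrite -(bigD1 i0 (P := xpredT)) // (bigD1_ord i0).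
  rewrite (bigD1 i0) //= !liftE scDr scS -[sc (- a i0) (b i0)]opprK.
  have -> : - sc (- a i0) (b i0) = sc (a i0) (b i0).
    by apply: (addIr (sc (- a i0) (b i0))); rewrite addNr -scDl subrr -(subrr 1) scBl sc1 subrr.
  under eq_bigr do rewrite ffunE scBl.
  under [X in _ = _ - (_ + X)]eq_bigr do rewrite -scA mulNr -[- (_ * _)]sub0r scBl -(subrr 1) scBl sc1 subrr sub0r.
  rewrite sumrB sumrN; set X := \sum_j _; set Y := \sum_j _; set Z := sc (a i0) _.
  by rewrite !opprD !opprK !addrA; congr (_ + _); rewrite addrAC subrK.
by apply: WB => //; apply: Wsc.
Qed.

End QuotientBasis.

Section Fibers.
Variables (V : zmodType) (R : finType) (A B : set V) (phi : V -> R).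
Hypotheses (finB : finite_set B).
Hypothesis (phiE : forall v w, A v -> A w -> phi v = phi w -> B (v - w)).

(** [A] is covered by translates of [B], one for each value of [phi]. This section plays the part of
    the rank formula. *)
Lemma finite_set_fibers : finite_set A.
Proof.
pose g r := xget 0 [set v | A v /\ phi v = r].
apply: (@sub_finite_set _ _ (\bigcup_(r in [set: R]) [set b + g r | b in B])).
  move=> v Av; exists (phi v) => //.
  have [Ag eg] : A (g (phi v)) /\ phi (g (phi v)) = phi v.
    by apply: (@xgetPex _ 0 [set w | A w /\ phi w = phi v]); exists v.
  by exists (v - g (phi v)); [apply: phiE|rewrite subrK].
apply: bigcup_finite; first exact: finite_finset.
by move=> r _; apply: finite_image.
Qed.

Lemma count_fiber r : (count (fun v => phi v == r) (fset_set A) <= #|` fset_set B|)%N.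
Proof.
have finA := finite_set_fibers.
rewrite -size_filter; set s := filter _ _.
case E : s => [//|v0 s']; rewrite -E.
have mem v : v \in s -> A v /\ phi v = r.
  by rewrite mem_filter in_fset_set // => /andP[/eqP-> /set_mem].
have [Av0 e0] : A v0 /\ phi v0 = r by apply: mem; rewrite E mem_head.
rewrite -(size_map (fun v => v - v0)); apply: uniq_leq_size.
  by rewrite map_inj_uniq ?filter_uniq ?fset_uniq // => v w /addIr.
move=> _ /mapP[v /mem[Av ev] ->]; rewrite in_fset_set //; apply: mem_set.
by apply: phiE => //; rewrite ev.
Qed.

Lemma card_fibers_le : (#|` fset_set A| <= #|` fset_set B| * #|R|)%N.
Proof.
rewrite -sum1_size (partition_big phi xpredT) //= mulnC -sum_nat_const.
by apply: leq_sum => r _; rewrite sum1_count count_fiber.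
Qed.

Hypothesis (phiV : forall v w, A v -> B w -> A (v + w) /\ phi (v + w) = phi v).

Lemma count_fiber_eq v : A v -> count (fun w => phi w == phi v) (fset_set A) = #|` fset_set B|.
Proof.
move=> Av; have finA := finite_set_fibers.
apply/eqP; rewrite eqn_leq count_fiber /= -size_filter.
rewrite -(size_map (fun w => v + w)); apply: uniq_leq_size.
  by rewrite map_inj_uniq ?fset_uniq // => w w' /addrI.
move=> _ /mapP[w + ->]; rewrite in_fset_set // => /set_mem Bw.
by have [h1 h2] := phiV Av Bw; rewrite mem_filter h2 eqxx in_fset_set //; apply: mem_set.
Qed.

(** Every nonempty fibre is a translate of [B]. The operation is left abstract so that one count
    serves both sums of characters and products over orbits. *)
Lemma big_fibers (T : Type) (idx : T) (op : Monoid.com_law idx) (Q : pred R) (G : R -> T) :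
  (forall r, Q r <-> exists2 v, A v & phi v = r) ->
  \big[op/idx]_(v <- fset_set A) G (phi v) =
  \big[op/idx]_(r | Q r) iter #|` fset_set B| (op (G r)) idx.
Proof.
move=> QP; have finA := finite_set_fibers.
rewrite big_seq (partition_big phi Q) /=; last first.
  by move=> v; rewrite in_fset_set // => /set_mem Av; apply/QP; exists v.
apply: eq_bigr => r /QP[v Av <-].
rewrite -(count_fiber_eq Av) -big_const_seq -big_seq_cond.
by apply: eq_bigr => w /eqP->.
Qed.

End Fibers.

Lemma finite_dval_const (k : finFieldType) (F : fieldType) (c : {rmorphism k -> F})
  (v : dvaluation F) a : v (c a) = 0.
Proof.
have [->|a0] := eqVneq a 0; first by rewrite rmorph0 dval0.
(* A nonzero constant is a (q-1)-th root of unity; [dval_unity] takes the predecessor of the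
   exponent. *)
apply: (@dval_unity _ v (c a) #|k|.-2); apply: (mulfI (x := c a)); first by rewrite fmorph_eq0.
have q2 : #|k|.-2.+2 = #|k| by case: #|k| (finRing_gt1 k) => [|[]].
by rewrite -exprS mulr1 -rmorphXn q2 expf_card.
Qed.

Lemma vge_const (k : finFieldType) (F : fieldType) (c : {rmorphism k -> F})
  (v : dvaluation F) a : vge v (c a) 0.
Proof. by right; rewrite finite_dval_const. Qed.

Lemma function_field_spanned (k : finFieldType) (S : fieldType) (c : {rmorphism k -> S}) :
  function_field c -> exists t n, transcendental c t /\ spans_over c t n.
Proof.
case=> [[t nalg [n [b sp]]] _]; exists t, n.
have tr : transcendental c t.
  by move=> p p0; apply/negP => /eqP e; apply: nalg; exists p => //; apply/rootP.
split=> //; exists 'I_n, b; rewrite card_ord; split=> // h.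
by have [a [d [d0 e]]] := sp h; exists a, d; split=> //; apply: tr.
Qed.

(** * Residues, divisors and Riemann's inequality *)

Section Residue.
Variables (k : finFieldType) (S : fieldType) (c : {rmorphism k -> S}).
Hypothesis S_ff : function_field c.
Variable x : place S.

Lemma integers_subring (F : fieldType) (v : dvaluation F) : subring_set [set h | vge v h 0].
Proof.
split=> [|a b|a b]; first exact: vge1; first exact: vgeB.
by move=> ha hb; rewrite -[0]addr0; apply: vgeM.
Qed.

Lemma integers_valring (F : fieldType) (v : dvaluation F) z : vge v z 0 \/ vge v z^-1 0.
Proof.
have [->|z0] := eqVneq z 0; first by left; apply: vge0.
rewrite !vgeE ?invr_eq0 // dvalV; have [h|h] := leP 0 (v z); first by left.
by right; lia.
Qed.

(** A family of maximal length that is incongruent at [x] meets every residue class; lengths are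
    bounded by [valring_finite_index] at a uniformizer. *)
Let residue_span : exists n (b : 'I_n -> S),
  quot_span (fun (a : k) h => c a * h) [set h | vge x h 0] [set h | vge x h 1] b.
Proof.
have [t [n [t_tr t_sp]]] := function_field_spanned S_ff.
have [p p0 xp] := dval_surj x.
have [|N NP] := valring_finite_index t_tr t_sp (integers_subring x) (integers_valring x) (vge_const c x) p0.
  by right; rewrite xp.
pose P m := `[< exists W : 'I_m -> S, (forall j, vge x (W j) 0) /\
  forall j j', vge x (W j - W j') 1 -> j = j' >].
have exP : exists m, P m.
  by exists 0%N; apply/asboolP; exists (fun=> 0); split=> [_|[]//]; apply: vge0.
have bP m : P m -> (m <= N)%N.
  move=> /asboolP[W [W0 inj]]; rewrite -[m]card_ord; apply: (NP _ W) => // j j' h.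
  by apply: inj; rewrite -[_ - _](divfK p0) -[1]add0r; apply: vgeM => //; right; rewrite xp.
case: (ex_maxnP exP bP) => m /asboolP[W [W0 inj]] max.
exists m, W; split=> // h hh; apply: contrapT => nh.
have {}nh j : ~ vge x (h - W j) 1.
  move=> hj; apply: nh; exists [ffun i => (i == j)%:R].
  rewrite (bigD1 j) //= big1 ?addr0 => [|i /negPf ne].
    by rewrite ffunE eqxx rmorph1 mul1r.
  by rewrite ffunE ne rmorph0 mul0r.
have := max m.+1; rewrite ltnn => H; apply: notF; apply: H; apply/asboolP.
exists (fun j => if unlift ord0 j is Some i then W i else h); split.
  by move=> j; case: unliftP => [i _|_].
move=> j j'; case: unliftP => [i ->|->]; case: unliftP => [i' ->|->] //.
- by move/inj=> ->.
- by move/vgeBC/nh.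
- by move/nh.
Qed.

Let residue_basis : {b : 'I_(place_deg c x) -> S | (forall i, vge x (b i) 0) /\
  forall v, vge x v 0 -> exists! a : {ffun 'I_(place_deg c x) -> k},
      vge x (v - \sum_i c (a i) * (b i)) 1}.
Proof.
apply: cid; apply: (@quot_dim_basis _ _ (fun (a : k) h => c a * h)
    _ _ _ _ [set h | vge x h 0] [set h | vge x h 1]).
- by move=> a v w; rewrite mulrDr.
- by move=> a b v; rewrite rmorphD mulrDl.
- by move=> a b v; rewrite rmorphM mulrA.
- by move=> v; rewrite rmorph1 mul1r.
- by move=> v w hv hw; apply: vgeB.
- by move=> a v hv; apply: vgeMl => //; apply: vge_const.
- exact: residue_span.
Qed.

(** The residue field at [x] appears only as a finite vector space in coordinates; products of
    residues are formed on the lifts [rep]. On a nonintegral element [res] is the default [res0]. *)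
Definition residues : finType := {ffun 'I_(place_deg c x) -> k}.
Definition res0 : residues := [ffun=> 0].
Definition rscale (r : k) (a : residues) : residues := [ffun i => r * a i].
Definition rep (a : residues) : S := \sum_i c (a i) * sval residue_basis i.
Definition res (h : S) : residues := xget res0 [set a | vge x (h - rep a) 1].

Lemma card_residues : #|residues| = (#|k| ^ place_deg c x)%N.
Proof. by rewrite card_ffun card_ord. Qed.

Lemma rep_int a : vge x (rep a) 0.
Proof.
apply: vge_sum => i _; apply: vgeMl; first exact: vge_const.
by case: (svalP residue_basis) => /(_ i).
Qed.

Lemma res_rep_near h : vge x h 0 -> vge x (h - rep (res h)) 1.
Proof.
move=> hh; have [_ /(_ h hh)[a [ha _]]] := svalP residue_basis.
by apply: (@xgetPex _ _ [set a | vge x (h - rep a) 1]); exists a.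
Qed.

Lemma res_unique h a : vge x h 0 -> vge x (h - rep a) 1 -> res h = a.
Proof.
move=> hh ha; have [_ /(_ h hh)[b [hb ub]]] := svalP residue_basis.
by rewrite -(ub _ ha) -(ub _ (res_rep_near hh)).
Qed.

Lemma res_eqP h h' : vge x h 0 -> vge x h' 0 -> res h = res h' <-> vge x (h - h') 1.
Proof.
move=> hh hh'; split=> [e|e].
  by apply: vge_trans (res_rep_near hh) _; rewrite e; apply: vgeBC; apply: res_rep_near.
by apply: res_unique => //; apply: vge_trans e (res_rep_near _).
Qed.

Lemma repK a : res (rep a) = a.
Proof. by apply: res_unique; [apply: rep_int|rewrite subrr; apply: vge0]. Qed.

Lemma rep_scale (r : k) (a : residues) : rep (rscale r a) = c r * rep a.
Proof.
by rewrite /rep mulr_sumr; apply: eq_bigr => i _; rewrite ffunE rmorphM mulrA.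
Qed.

Lemma rep0 : rep res0 = 0.
Proof. by rewrite /rep big1 // => i _; rewrite ffunE rmorph0 mul0r. Qed.

Lemma rep_eq0 a : (rep a == 0) = (a == res0).
Proof.
apply/eqP/eqP => [e|->]; last exact: rep0.
by rewrite -(repK a) e -rep0 repK.
Qed.

Lemma dval_rep a : a != res0 -> x (rep a) = 0.
Proof.
move=> a0; have ra0 : rep a != 0 by rewrite rep_eq0.
have := rep_int a; rewrite vgeE // le0r => /orP[/eqP//|h].
case/eqP: a0; rewrite -(repK a) -[RHS]repK rep0.
apply/res_eqP; rewrite ?subr0; [exact: rep_int|exact: vge0|].
by right; lia.
Qed.

Lemma res_scale r h : vge x h 0 -> res (c r * h) = rscale r (res h).
Proof.
move=> hh; apply: res_unique; first by apply: vgeMl => //; apply: vge_const.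
by rewrite rep_scale -mulrBr; apply: vgeMl; [apply: vge_const|apply: res_rep_near].
Qed.

Lemma res_eq0 h : vge x h 0 -> res h = res0 <-> vge x h 1.
Proof.
move=> hh; rewrite -(repK res0) rep0.
by rewrite (res_eqP hh (vge0 _ _)) subr0.
Qed.

Lemma res_neq0 h : h != 0 -> x h = 0 -> res h != res0.
Proof.
move=> h0 xh; apply/eqP => /res_eq0; rewrite !vgeE // xh => /(_ (lexx _)); lia.
Qed.

Lemma place_deg_gt0 : (0 < place_deg c x)%N.
Proof.
have := res_neq0 (oner_neq0 S) (dval1 x).
case: posnP => // d0; rewrite -[X in X != _](_ : res0 = _) ?eqxx //.
by apply/ffunP => i; have := ltn_ord i; rewrite [X in (_ < X)%N]d0.
Qed.

End Residue.

(** * Divisors as lists of places *)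

Section DivisorLists.
Variables (k : finFieldType) (S : fieldType) (c : {rmorphism k -> S}).
Implicit Types (D N : divisor S) (s : seq (place S)).

(** Writing effective divisors as lists allows places to be added one at a time by induction. *)
Definition seq_div s : divisor S := \sum_(x <- s) << x >>.

Lemma seq_div_cons x s : seq_div (x :: s) = << x >> + seq_div s.
Proof. by rewrite /seq_div big_cons. Qed.
Lemma seq_div_cat s s' : seq_div (s ++ s') = seq_div s + seq_div s'.
Proof. by rewrite /seq_div big_cat. Qed.
Lemma seq_div_nil : seq_div [::] = 0. Proof. by rewrite /seq_div big_nil. Qed.

Lemma coeff_seq_div x s : coeff x (seq_div s) = (count_mem x s)%:Z.
Proof.
elim: s => [|y s IH]; first by rewrite seq_div_nil coeff0.
by rewrite seq_div_cons coeffD coeffU IH /= mul1r PoszD natz.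
Qed.

Lemma freeg_coeffP D N : (forall x, coeff x D = coeff x N) -> D = N.
Proof. by move=> h; apply/eqP/freeg_eqP. Qed.

Lemma div_degE D s : uniq s -> {subset dom D <= s} ->
  div_deg c D = \sum_(x <- s) coeff x D * (place_deg c x)%:Z.
Proof.
move=> us sub; rewrite /div_deg [RHS](bigID (fun x => x \in dom D)) /=.
rewrite [X in _ = _ + X]big1 ?addr0 => [|x xD]; last by rewrite coeff_outdom // mul0r.
rewrite -[RHS]big_filter; apply: perm_big; apply: uniq_perm; rewrite ?uniq_dom ?filter_uniq //.
move=> x; rewrite mem_filter; case: (boolP (x \in dom D)) => //= /sub -> //.
Qed.

Lemma div_degD D N : div_deg c (D + N) = div_deg c D + div_deg c N.
Proof.
pose s := undup (dom D ++ dom N).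
have us : uniq s by apply: undup_uniq.
rewrite !(@div_degE _ s) //.
- by rewrite -big_split; apply: eq_bigr => x _; rewrite coeffD mulrDl.
- by move=> x; rewrite mem_undup mem_cat orbC => ->.
- by move=> x; rewrite mem_undup mem_cat => ->.
- by move=> x /domD_subset; rewrite mem_undup.
Qed.

Lemma div_deg0 : div_deg c 0 = 0.
Proof. by rewrite /div_deg dom0 big_nil. Qed.
Lemma div_degN D : div_deg c (- D) = - div_deg c D.
Proof. by apply: (addIr (div_deg c D)); rewrite -div_degD !addNr div_deg0. Qed.
Lemma div_degB D N : div_deg c (D - N) = div_deg c D - div_deg c N.
Proof. by rewrite div_degD div_degN. Qed.
Lemma div_degMn D n : div_deg c (D *+ n) = div_deg c D *+ n.
Proof. by elim: n => [|n IH]; rewrite ?mulr0n ?div_deg0 // !mulrS div_degD IH. Qed.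
Lemma div_deg_sum (I : Type) (r : seq I) (P : pred I) (G : I -> divisor S) :
  div_deg c (\sum_(i <- r | P i) G i) = \sum_(i <- r | P i) div_deg c (G i).
Proof. by apply: (big_morph (div_deg c)); [exact: div_degD|exact: div_deg0]. Qed.
Lemma div_degU x : div_deg c << x >> = (place_deg c x)%:Z.
Proof. by rewrite /div_deg domU1 big_seq1 coeffU eqxx !mul1r. Qed.
Lemma div_deg_seq_div s : div_deg c (seq_div s) = (\sum_(x <- s) place_deg c x)%:Z.
Proof.
elim: s => [|x s IH]; first by rewrite seq_div_nil div_deg0 big_nil.
by rewrite seq_div_cons div_degD div_degU IH big_cons PoszD.
Qed.

Lemma div_of_fun s (G : place S -> int) : (forall x, G x != 0 -> x \in s) ->
  exists D, forall x, coeff x D = G x.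
Proof.
move=> Gs; exists (\sum_(y <- undup s) << G y *g y >>) => x.
rewrite raddf_sum /=; have [xs|xs] := boolP (x \in undup s).
  rewrite (bigD1_seq x) ?undup_uniq //= big1 ?addr0 => [|y ne].
    by rewrite coeffU eqxx mulr1.
  by rewrite coeffU (negPf ne) mulr0.
rewrite big1_seq => [|y /andP[_ ys]].
  by apply/esym/eqP; apply: contraNT xs => /Gs; rewrite mem_undup.
by rewrite coeffU; case: eqP ys => [->|_]; [rewrite (negPf xs)|rewrite mulr0].
Qed.

Lemma effective_seq_div D : effective D -> exists s, D = seq_div s.
Proof.
move=> eD; exists (flatten [seq nseq `|coeff x D| x | x <- dom D]).
have eq (r : seq (place S)) : seq_div (flatten [seq nseq `|coeff x D| x | x <- r]) =
    \sum_(x <- r) << coeff x D *g x >>.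
  elim: r => [|x r IH]; first by rewrite /= seq_div_nil big_nil.
  rewrite /= seq_div_cat IH big_cons; congr (_ + _).
  rewrite /seq_div big_nseq -Monoid.iteropE.
  have -> : iterop `|coeff x D| +%R << x >> 0 = << x >> *+ `|coeff x D| by [].
  rewrite freegU_muln natz gez0_abs //; have := eD x; by rewrite coeff0.
by rewrite eq freeg_sumE.
Qed.

Lemma seq_div_diff D : exists s s', D = seq_div s - seq_div s'.
Proof.
have [|s es] := @effective_seq_div (fgpos D).
  by move=> x; rewrite coeff0 coeff_fgposE le_max lexx.
have [|s' es'] := @effective_seq_div (fgneg D).
  by move=> x; rewrite coeff0 coeff_fgnegE oppr_ge0 ge_min lexx.
by exists s, s'; rewrite -es -es' -fg_decomp.
Qed.

Lemma div_le_seq_div D N : div_le D N -> exists s, N = D + seq_div s.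
Proof.
move=> DN; have [|s es] := @effective_seq_div (N - D).
  by move=> x; rewrite coeff0 coeffB subr_ge0.
by exists s; rewrite -es addrC subrK.
Qed.

Lemma div_le_deg D N : div_le D N -> div_deg c D <= div_deg c N.
Proof. by move=> /div_le_seq_div[s ->]; rewrite div_degD div_deg_seq_div; lia. Qed.

End DivisorLists.

Section CardFsetSet.
Variables (T : choiceType) (J : finType) (A : set T).
Hypothesis finA : finite_set A.

Lemma card_le_fset_set (G : J -> T) : injective G -> (forall j, A (G j)) ->
  (#|J| <= #|` fset_set A|)%N.
Proof.
move=> injG AG; rewrite cardE -(size_map G); apply: uniq_leq_size.
  by rewrite map_inj_uniq ?enum_uniq.
by move=> _ /mapP[j _ ->]; rewrite in_fset_set //; apply: mem_set.
Qed.

Lemma fset_set_le_card (G : T -> J) : (forall v w, A v -> A w -> G v = G w -> v = w) ->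
  (#|` fset_set A| <= #|J|)%N.
Proof.
move=> injG; rewrite -(size_map G) -(card_uniqP _) ?max_card //.
rewrite map_inj_in_uniq ?fset_uniq // => v w.
by rewrite !in_fset_set // => /set_mem Av /set_mem Aw; apply: injG.
Qed.

End CardFsetSet.

Lemma fset_set_le_fset_set (T U : choiceType) (A : set T) (B : set U) (G : T -> U) :
  finite_set A -> finite_set B -> (forall v, A v -> B (G v)) ->
  (forall v w, A v -> A w -> G v = G w -> v = w) ->
  (#|` fset_set A| <= #|` fset_set B|)%N.
Proof.
move=> finA finB AB injG; rewrite -(size_map G); apply: uniq_leq_size.
  rewrite map_inj_in_uniq ?fset_uniq // => v w.
  by rewrite !in_fset_set // => /set_mem Av /set_mem Aw; apply: injG.
by move=> _ /mapP[v + ->]; rewrite !in_fset_set // => /set_mem/AB/mem_set.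
Qed.

Section Multiset.
Variables (T : eqType) (G : T -> nat).
Definition mults (s : seq T) := flatten [seq nseq (G x) x | x <- s].

Lemma count_mults s y : uniq s -> count_mem y (mults s) = if y \in s then G y else 0%N.
Proof.
elim: s => [//|x s IH] /= /andP[xs us]; rewrite /mults /= count_cat IH // count_nseq /= inE.
rewrite [y == x]eq_sym; case: eqP => [<-|_]; last by rewrite mul0n.
by rewrite (negPf xs) addn0 mul1n.
Qed.

Lemma sum_mults s (H : T -> nat) : (\sum_(x <- mults s) H x = \sum_(x <- s) G x * H x)%N.
Proof.
elim: s => [|x s IH]; first by rewrite !big_nil.
by rewrite /mults /= big_cat IH big_cons /= big_nseq iter_addn_0 mulnC.
Qed.

Lemma mem_mults s y : y \in mults s -> y \in s.
Proof. by case/flattenP => _ /mapP[x xs ->] /nseqP[->]. Qed.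
End Multiset.

Section Independence.
Variables (k : finFieldType) (F : fieldType) (c : {rmorphism k -> F}) (t : F).
Hypothesis t_tr : transcendental c t.

(** A basis of [F] over the fractions of k[t], stated without denominators: in a shortest spanning
    family, a relation with [p i0] nonzero would eliminate [b i0] after multiplication by [p i0]. *)
Lemma minimal_span : (exists n, spans_over c t n) -> exists n (b : 'I_n -> F),
  (forall h, exists (a : 'I_n -> {poly k}) d,
    ev c t d != 0 /\ ev c t d * h = \sum_i ev c t (a i) * b i) /\
  (forall p : 'I_n -> {poly k}, \sum_i ev c t (p i) * b i = 0 -> forall i, p i = 0).
Proof.
move=> ex; pose P n := `[< spans_over c t n >].
have exP : exists n, P n by have [n h] := ex; exists n; apply/asboolP.
case: (ex_minnP exP) => n /asboolP[I [b0 [In sp0]]] min.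
case: _ / In min => min.
pose b i := b0 (@enum_val I I i).
have sumE (G : I -> F) : \sum_i G i = \sum_(i < #|I|) G (enum_val i) by rewrite (reindex (@enum_val I I)) //; apply: onW_bij; apply: enum_val_bij.
have sp h : exists (a : 'I_#|I| -> {poly k}) d,
    ev c t d != 0 /\ ev c t d * h = \sum_i ev c t (a i) * b i.
  have [a [d [d0 e]]] := sp0 h; exists (fun i => a (enum_val i)), d; split=> //.
  by rewrite e sumE.
exists #|I|, b; split=> // p rel i0; apply: contrapT => /eqP pi0.
clearbody b; move: #|I| b sp min p i0 pi0 rel; case=> [|r] b sp min p i0 pi0 rel; first by case: (i0).
have := min r; rewrite ltnn => H; apply: notF; apply: H; apply/asboolP.
exists 'I_r, (fun j => b (lift i0 j)); rewrite card_ord; split=> // h.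
have [a [d [d0 e]]] := sp h.
exists (fun j => p i0 * a (lift i0 j) - a i0 * p (lift i0 j)), (p i0 * d).
have pi0' : ev c t (p i0) != 0 by apply: t_tr.
rewrite evM mulf_neq0 //; split=> //.
rewrite -mulrA e (bigD1_ord i0) //= mulrDr mulr_sumr.
move: rel; rewrite (bigD1_ord i0) //= => /eqP; rewrite addr_eq0 => /eqP rel.
rewrite [_ * (ev c t (a i0) * _)]mulrCA rel mulrN mulr_sumr -sumrN -big_split /=.
by apply: eq_bigr => j _; rewrite evB !evM; ring.
Qed.
End Independence.

(** * Zeros and poles of a function *)

Section Riemann.
Variables (k : finFieldType) (S : fieldType) (c : {rmorphism k -> S}).
Hypothesis S_ff : function_field c.
Implicit Types (D N : divisor S) (x y : place S) (h s : S).
Local Notation deg := (place_deg c).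
Local Notation q := #|k|.

(** Weak approximation realizes all residues to the orders prescribed by [l]. Each occurrence of [x]
    in [l] contributes one digit [rep r * p ^+ m], where [m] counts the occurrences already
    treated. *)
Lemma incongruent_family (zs l : seq (place S)) : uniq zs -> {subset l <= zs} ->
  exists (J : finType) (W : J -> S), [/\ #|J| = (q ^ \sum_(x <- l) deg x)%N,
    forall j y, y \in zs -> vge y (W j) 0 &
    forall j j', (forall y, y \in zs -> vge y (W j - W j') (count_mem y l)%:Z) -> j = j'].
Proof.
move=> uz; elim: l => [_|x l IH sub].
  exists unit, (fun=> 0); split=> [|j y _|[] [] //]; first by rewrite big_nil card_unit.
  exact: vge0.
have [|J [W [JE W0 inj]]] := IH; first by move=> y yl; apply: sub; rewrite inE yl orbT.
have xz : x \in zs by apply: sub; rewrite mem_head.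
have [p p0 xp] := dval_surj x.
pose m := count_mem x l.
have cs y : (count_mem y l <= size l)%N := count_size _ _.
have ms : (m <= size l)%N := cs x.
have /choice[e eP] (r : residues c x) : exists h, forall y, y \in zs ->
    vge y (h - (if y == x then rep S_ff r * p ^+ m else 0)) (size l).+1%:Z.
  exact: weak_approximation.
have ex (r : residues c x) : vge x (e r - rep S_ff r * p ^+ m) (m%:Z + 1).
  by have := eP r x xz; rewrite eqxx; apply: vgeW; lia.
have xrp (r : residues c x) : vge x (rep S_ff r * p ^+ m) m%:Z.
  by apply: vgeMl; [apply: (rep_int S_ff)|right; rewrite dvalX // xp; lia].
have el r y : y \in zs -> vge y (e r) (count_mem y l)%:Z.
  move=> yz; have := eP r y yz; case: eqP => [->|_] h.
    by rewrite -(subrK (rep S_ff r * p ^+ m) (e r)); apply: vgeD => //; apply: vgeW (ex r); lia.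
  by move: h; rewrite subr0; apply: vgeW; have := cs y; lia.
exists (J * residues c x)%type, (fun jr => W jr.1 + e jr.2); split.
- by rewrite card_prod JE card_residues big_cons expnD mulnC.
- move=> [j r] y yz /=; apply: vgeD; first exact: W0.
  by apply: vgeW (el r y yz); lia.
- move=> [j r] [j' r'] /= H.
  have jj : j = j'.
    apply: inj => y yz; have /= := H y yz; rewrite PoszD => h.
    have -> : W j - W j' = W j + e r - (W j' + e r') - (e r - e r') by ring.
    apply: vgeB; last by apply: vgeB; apply: el.
    by apply: vgeW h; lia.
  congr (_, _) => //.
  have := H x xz; rewrite /= eqxx -jj addnC addn1 -addn1 PoszD => h.
  rewrite -(repK S_ff r) -(repK S_ff r'); apply/res_eqP; try exact: (rep_int S_ff).
  have pm0 : p ^+ m != 0 by rewrite expf_neq0.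
  have -> : rep S_ff r - rep S_ff r' = (rep S_ff r * p ^+ m - rep S_ff r' * p ^+ m) * (p ^+ m)^-1.
    by rewrite -mulrBl mulfK.
  apply: (@vgeW _ _ _ (m%:Z + 1 + - m%:Z)); first by lia.
  apply: vgeM; last by right; rewrite dvalV dvalX // xp mul1r.
  have -> : rep S_ff r * p ^+ m - rep S_ff r' * p ^+ m = (W j + e r - (W j + e r')) -
    (e r - rep S_ff r * p ^+ m) + (e r' - rep S_ff r' * p ^+ m) by ring.
  by apply: vgeD => //; apply: vgeB.
Qed.

(** Elements integral on [zs] and incongruent modulo the zeros of [s] are incongruent modulo [s] in
    the semilocal ring [O], so [incongruent_bound] limits their number. This is the bound of the
    degree of zeros by [S : k(s)]. *)
Lemma zeros_bound s m (zs : seq (place S)) : s != 0 -> spans_over c s m -> uniq zs ->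
  (forall x, x \in zs -> 1 <= x s) -> (\sum_(x <- zs) `|x s| * deg x <= m)%N.
Proof.
move=> s0 sp uz zP; pose l := mults (fun x : place S => `|x s|%N) zs.
have [|J [W [JE W0 inj]]] := @incongruent_family zs l uz; first exact: mem_mults.
rewrite -sum_mults -(leq_exp2l _ _ (finRing_gt1 k)) -JE.
pose O : set S := [set h | forall y, y \in zs -> vge y h 0].
have sO : subring_set O.
  split=> [y _|a b Oa Ob y yz|a b Oa Ob y yz]; first exact: vge1.
    by apply: vgeB; [apply: Oa|apply: Ob].
  by rewrite -[0]addr0; apply: vgeM; [apply: Oa|apply: Ob].
apply: (incongruent_bound sO sp s0 (W := W)) => //.
- by move=> y yz; right; have := zP y yz; lia.
- move=> j j' OJ; apply: inj => y yz; rewrite count_mults // yz.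
  rewrite -[_ - _](divfK s0) -[Posz _]add0r; apply: vgeM; first exact: OJ.
  by right; have := zP y yz; lia.
Qed.

Lemma finite_zeros_spanning s m : s != 0 -> spans_over c s m ->
  finite_set [set x : place S | 1 <= x s].
Proof.
move=> s0 sp; apply: contrapT => /(infinite_set_fset m.+1)[B BZ]; apply/negP.
suff : (#|` B| <= m)%N by move=> h; rewrite leqNgt ltnS h.
apply: leq_trans (zeros_bound s0 sp (fset_uniq B) _); last by move=> x /BZ.
rewrite -sum1_size [X in (X <= _)%N]big_seq [X in (_ <= X)%N]big_seq.
apply: leq_sum => x /BZ /= xs; rewrite muln_gt0 place_deg_gt0 // andbT; lia.
Qed.

(** By [algebraic_relation0], a zero of [h] that is not a pole of [t] is a zero of one fixed nonzero
    polynomial in [t]. Poles are zeros of the inverse. *)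
Lemma finite_dval_support h : h != 0 -> finite_set [set x : place S | x h != 0].
Proof.
have [t [n [t_tr t_sp]]] := function_field_spanned S_ff.
have t0 : t != 0 by have := t_tr 'X; rewrite evX polyX_eq0; apply.
have zeros h' : h' != 0 -> finite_set [set x : place S | 1 <= x h'].
  move=> h0; have [r [A [A0 e]]] := algebraic_relation0 t_tr t_sp h0.
  have fin1 : finite_set [set x : place S | 1 <= x (ev c t (A 0%N))].
    have [A1|A1] := leqP (size (A 0%N)) 1.
      apply: (@sub_finite_set _ _ set0) => // x /=.
      by rewrite (size1_polyC A1) evC finite_dval_const.
    exact: (finite_zeros_spanning (t_tr _ A0) (spans_over_ev t_tr t_sp A1)).
  have fin2 : finite_set [set x : place S | 1 <= x t^-1].
    by apply: finite_zeros_spanning (spans_overV t0 t_sp); rewrite invr_eq0.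
  apply: sub_finite_set (_ : finite_set (_ `|` _)); last by rewrite finite_setU; split; [exact: fin1|exact: fin2].
  move=> x /= xh; have [xt|xt] := leP 0 (x t); last by right; rewrite /= dvalV; lia.
  have evi p : vge x (ev c t p) 0.
    by apply: (subring_set_ev (integers_subring x)); [apply: vge_const|right].
  left; have : vge x (ev c t (A 0%N)) 1.
    rewrite e -[1]addr0; apply: vgeM; first by right.
    by apply: vge_sum => j _; apply: vgeMl => //; apply: vgeX; right; lia.
  by rewrite vgeE //; apply: t_tr.
move=> h0; apply: sub_finite_set (_ : finite_set (_ `|` _)); last first.
  by rewrite finite_setU; split; [exact: (zeros h)|apply: (zeros h^-1); rewrite invr_eq0].
by move=> x /= xh; rewrite dvalV; have [?|?] := leP 0 (x h); [left|right]; lia.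
Qed.

Lemma is_div_exists h : h != 0 -> exists D, is_div h D.
Proof.
move=> h0; have /finite_seqP[s es] := finite_dval_support h0.
have [|D DE] := @div_of_fun _ s (fun x => x h); last by exists D.
by move=> x xh; have : [set x : place S | x h != 0] x by []; rewrite es.
Qed.

Definition divf h : divisor S := xget 0 [set D | is_div h D].

Lemma is_div_divf h : h != 0 -> is_div h (divf h).
Proof. by move=> h0; apply: xgetPex; apply: is_div_exists. Qed.

Lemma coeff_divf h x : h != 0 -> coeff x (divf h) = x h.
Proof. by move=> /is_div_divf[_ ->]. Qed.

Lemma is_div_unique h D : is_div h D -> D = divf h.
Proof. by case=> h0 DE; apply: freeg_coeffP => x; rewrite DE coeff_divf. Qed.

Lemma divfM h h' : h != 0 -> h' != 0 -> divf (h * h') = divf h + divf h'.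
Proof.
move=> h0 h'0; apply: freeg_coeffP => x.
by rewrite coeffD !coeff_divf ?mulf_neq0 // dvalM.
Qed.

Lemma divfV h : h != 0 -> divf h^-1 = - divf h.
Proof.
move=> h0; apply: freeg_coeffP => x.
by rewrite coeffN !coeff_divf ?invr_eq0 // dvalV.
Qed.

Lemma divf_const a : a != 0 -> divf (c a) = 0.
Proof.
move=> a0; apply: freeg_coeffP => x.
by rewrite coeff_divf ?fmorph_eq0 // finite_dval_const coeff0.
Qed.

(** Chevalley's theorem for k[1/h], where 1/h is not invertible, gives a place at which 1/h
    vanishes. *)
Lemma pole_of_transcendental h : transcendental c h -> exists x : place S, x h < 0.
Proof.
move=> h_tr; have [t [n [t_tr t_sp]]] := function_field_spanned S_ff.
have h0 : h != 0 by have := h_tr 'X; rewrite evX polyX_eq0; apply.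
pose R0 : set S := [set a | exists p, a = ev c h^-1 p].
have sR : subring_set R0.
  split; first by exists 1; rewrite ev1.
    by move=> a b [p ->] [r ->]; exists (p - r); rewrite evB.
  by move=> a b [p ->] [r ->]; exists (p * r); rewrite evM.
have [||O [sO RO nO vO]] := chevalley sR (s := h^-1).
- by exists 'X; rewrite evX.
- rewrite invrK => -[p e].
  have := transcendentalV h_tr (p := 'X * p - 1); rewrite evB evM evX ev1 -e mulVf // subrr eqxx.
  suff -> : 'X * p - 1 != 0 by move/(_ isT).
  apply/eqP => /(congr1 (fun r => r.[0])); rewrite hornerD hornerN hornerM hornerX mul0r hornerC horner0 sub0r.
  by move/eqP; rewrite oppr_eq0 oner_eq0.
have [||v vP] := place_of_valring t_tr t_sp sO vO.
- by move=> r; apply: RO; exists r%:P; rewrite evC.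
- by exists (h^-1)^-1.
exists v; rewrite ltNge; apply/negP => vh; apply: nO; rewrite invrK; apply/vP; by right.
Qed.

Lemma regular_const h : (forall x : place S, vge x h 0) -> exists a, h = c a.
Proof.
move=> hi; have [_] := S_ff; apply.
apply: contrapT => nalg.
have tr : transcendental c h.
  by move=> p p0; apply/negP => /eqP e; apply: nalg; exists p => //; apply/rootP.
have [x xh] := pole_of_transcendental tr.
by case: (hi x) => [h0|]; [move: xh; rewrite h0 dval0|lia].
Qed.

Lemma divf_eq h h' : h != 0 -> h' != 0 -> divf h = divf h' -> exists2 a, a != 0 & h = c a * h'.
Proof.
move=> h0 h'0 e; have [|a ha] := @regular_const (h / h').
  by move=> x; right; rewrite dvalM ?invr_eq0 // dvalV -!coeff_divf // e subrr.
exists a; last by rewrite -ha divfK.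
by apply: contra_neq h0 => a0; rewrite -(divfK h'0 h) ha a0 rmorph0 mul0r.
Qed.

Lemma exists_place : exists x : place S, True.
Proof.
have [t [n [t_tr t_sp]]] := function_field_spanned S_ff.
by have [x _] := pole_of_transcendental t_tr; exists x.
Qed.

End Riemann.

(** * The spaces L(D) *)

Section Sections.
Variables (k : finFieldType) (S : fieldType) (c : {rmorphism k -> S}).
Hypothesis S_ff : function_field c.
Implicit Types (D N : divisor S) (x y : place S) (h s : S).
Local Notation deg := (place_deg c).
Local Notation Deg := (div_deg c).
Local Notation q := #|k|.

Definition unif x : S := xget 0 [set p | p != 0 /\ x p = 1].

Lemma unifP x : unif x != 0 /\ x (unif x) = 1.
Proof.
by apply: (@xgetPex _ _ [set p | p != 0 /\ x p = 1]); have [p p0 xp] := dval_surj x; exists p.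
Qed.

Lemma unif_neq0 x : unif x != 0. Proof. by have [] := unifP x. Qed.

Lemma dval_unifX x (i : int) : x (unif x ^ i) = i.
Proof. by have [p0 xp] := unifP x; rewrite dvalXz // xp mul1r. Qed.

Lemma sectionsB D v w : sections D v -> sections D w -> sections D (v - w).
Proof. by move=> hv hw x; apply: vgeB; [apply: hv|apply: hw]. Qed.

Lemma sectionsD D v w : sections D v -> sections D w -> sections D (v + w).
Proof. by move=> hv hw x; apply: vgeD; [apply: hv|apply: hw]. Qed.

Lemma sections0 D : sections D 0. Proof. by move=> x; apply: vge0. Qed.

Lemma sections_scale D r v : sections D v -> sections D (c r * v).
Proof. by move=> hv x; apply: vgeMl; [apply: vge_const|apply: hv]. Qed.

Lemma sections_le D D' v : div_le D D' -> sections D v -> sections D' v.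
Proof. by move=> le hv x; apply: vgeW (hv x); rewrite lerN2. Qed.

Lemma sectionsP D h : h != 0 -> sections D h <-> forall x, 0 <= x h + coeff x D.
Proof.
move=> h0; split=> hD x; first by have := hD x; rewrite /stalk /= vgeE //; lia.
by rewrite /stalk /= vgeE //; have := hD x; lia.
Qed.

Lemma sectionsM D h v : h != 0 -> sections D v <-> sections (D - divf h) (h * v).
Proof.
move=> h0; have [->|v0] := eqVneq v 0; first by rewrite mulr0; split=> _; apply: sections0.
rewrite !sectionsP ?mulf_neq0 //; split=> H x; have := H x;
  rewrite coeffB (coeff_divf S_ff) // dvalM //; lia.
Qed.

Lemma dU_subE D x y : coeff y (D - << x >>) = coeff y D - (x == y)%:Z.
Proof. by rewrite coeffB coeffU mul1r natz. Qed.

(* The component at [x] of the leading term of a section of [O(D)]. *)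
Definition lead_part D x h := res S_ff x (h * unif x ^ coeff x D).

Lemma lead_part_int D x h : sections D h -> vge x (h * unif x ^ coeff x D) 0.
Proof.
move=> hD; apply: (@vgeW _ _ _ (- coeff x D + coeff x D)); first by lia.
by apply: vgeM; [apply: hD|right; rewrite dval_unifX].
Qed.

Lemma vge_unifX x h (i : int) n : vge x (h * unif x ^ i) n <-> vge x h (n - i).
Proof.
have [->|h0] := eqVneq h 0; first by rewrite mul0r; split=> _; apply: vge0.
by rewrite !vgeE ?mulf_neq0 ?expfz_neq0 ?unif_neq0 // dvalM ?expfz_neq0 ?unif_neq0 // dval_unifX; lia.
Qed.

Lemma lead_part_eq D x v w : sections D v -> sections D w ->
  lead_part D x v = lead_part D x w <-> sections (D - << x >>) (v - w).
Proof.
move=> hv hw; rewrite /lead_part.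
rewrite (res_eqP S_ff (lead_part_int x hv) (lead_part_int x hw)) -mulrBl vge_unifX.
split=> [h y|/(_ x)]; rewrite /stalk /= dU_subE; last by rewrite eqxx; apply: vgeW; lia.
case: eqP => [<-|_]; first by apply: vgeW h; lia.
by apply: (vgeW _ (sectionsB hv hw y)); lia.
Qed.

Lemma sections_sub1 D x v : sections (D - << x >>) v -> sections D v.
Proof. by apply: sections_le => y; rewrite dU_subE; case: (x == y); lia. Qed.

Lemma sections_neg x h : sections (- << x >>) h -> h = 0.
Proof.
move=> hx; apply: contrapT => /eqP h0.
have [y|a ha] := @regular_const _ _ _ S_ff h.
  by apply: vgeW (hx y); rewrite coeffN coeffU; case: (x == y).
have := hx x; rewrite /stalk /= vgeE // ha finite_dval_const coeffN coeffU eqxx; lia.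
Qed.

Lemma finite_sections_step D x : finite_set (sections (D - << x >>)) -> finite_set (sections D).
Proof.
move=> fin; apply: (finite_set_fibers (phi := lead_part D x) fin) => v w hv hw.
by move/(lead_part_eq _ hv hw).
Qed.

(** From L(-x0) = 0, each added place enlarges the space by finitely many leading parts. The place
    [x0] is put in front of [s] so that the divisor reached dominates the given one. *)
Lemma finite_sections D : finite_set (sections D).
Proof.
have [x0 _] := exists_place S_ff.
have [s [s' ->]] := seq_div_diff D.
suff : finite_set (sections (- << x0 >> + seq_div (x0 :: s))).
  apply: sub_finite_set => h; apply: sections_le => y.
  by rewrite seq_div_cons addKr coeffB gerBl coeff_seq_div.
elim: (x0 :: s) => [|x l IH].
  rewrite seq_div_nil addr0; apply: (@sub_finite_set _ _ [set 0]) => // h /sections_neg //.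
by apply: (@finite_sections_step _ x); rewrite seq_div_cons addrCA [_ + (_ + _)]addrC addrK.
Qed.

Local Notation cardL D := (#|` fset_set (sections D)|).

Definition ell D := quot_dim (fun (a : k) h => c a * h) (sections D) [set 0].

(** The finite set of all sections is itself a spanning family, so [ell] is a true dimension and
    sections correspond to coordinate vectors. *)
Lemma cardL_ell D : cardL D = (q ^ ell D)%N.
Proof.
have fin := finite_sections D.
have [|||||||b [bD bU]] := @quot_dim_basis _ _ (fun (a : k) h => c a * h)
    _ _ _ _ (sections D) [set 0].
- by move=> a v w; rewrite mulrDr.
- by move=> a b v; rewrite rmorphD mulrDl.
- by move=> a b v; rewrite rmorphM mulrA.
- by move=> v; rewrite rmorph1 mul1r.
- by move=> v w /= -> ->; rewrite subrr.
- by move=> a v /= ->; rewrite mulr0.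
- pose s : seq S := fset_set (sections D).
  have sP v : v \in s -> sections D v by rewrite in_fset_set // => /set_mem.
  exists (size s), (fun i => nth 0 s i); split; first by move=> i; apply: sP; apply: mem_nth.
  move=> v hv; have vs : v \in s by rewrite in_fset_set //; apply: mem_set.
  have lt : (index v s < size s)%N by rewrite index_mem.
  exists [ffun i => (i == Ordinal lt)%:R] => /=.
  rewrite (bigD1 (Ordinal lt)) //= big1 => [|i /negPf ne].
    by rewrite ffunE eqxx rmorph1 mul1r addr0 nth_index // subrr.
  by rewrite ffunE ne rmorph0 mul0r.
rewrite -/(ell D) in b bD bU *; rewrite -[ell D]card_ord -card_ffun.
have comb (a : {ffun 'I_(ell D) -> k}) : sections D (\sum_i c (a i) * b i).
  elim/big_rec: _ => [|i v _ hv]; first exact: sections0.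
  by apply: sectionsD => //; apply: sections_scale.
apply/eqP; rewrite eqn_leq; apply/andP; split.
  have /choice[G GP] v : exists a : {ffun 'I_(ell D) -> k}, sections D v -> v - \sum_i c (a i) * b i = 0.
    have [hv|hv] := pselect (sections D v); last by exists [ffun=> 0].
    by have [a [ha _]] := bU v hv; exists a.
  apply: (fset_set_le_card fin (G := G)) => v w hv hw e.
  by apply/eqP; rewrite -(subr_eq0 v) -[v](subrK (\sum_i c (G v i) * b i)) (GP v hv) add0r e -[in X in _ - X](subrK (\sum_i c (G w i) * b i) w) (GP w hw) add0r subrr.
apply: (card_le_fset_set fin (G := fun a : {ffun 'I_(ell D) -> k} => \sum_i c (a i) * b i)) => // a a' e.
have [a0 [h0 u0]] := bU _ (comb a).
by rewrite -(u0 a) ?(u0 a') //= ?e ?subrr.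
Qed.

Lemma ell_step D x : (ell D <= ell (D - << x >>)%R + deg x)%N.
Proof.
rewrite -(leq_exp2l _ _ (finRing_gt1 k)) expnD -!cardL_ell -card_residues.
apply: card_fibers_le (lead_part D x) _ _; first exact: finite_sections.
by move=> v w hv hw /(lead_part_eq _ hv hw).
Qed.

Lemma ell_deg_mono D D' : div_le D D' -> (ell D')%:Z - Deg D' <= (ell D)%:Z - Deg D.
Proof.
move=> /div_le_seq_div[s ->]; elim: s => [|x s IH]; first by rewrite seq_div_nil addr0.
rewrite seq_div_cons [_ + seq_div s]addrC addrA; set D1 := D + seq_div s in IH *.
have := ell_step (D1 + << x >>) x; rewrite addrK div_degD div_degU => h.
by apply: le_trans IH; rewrite lerBlDr addrA subrK -PoszD.
Qed.

Lemma ell_divf h D : h != 0 -> ell (D - divf h) = ell D.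
Proof.
move=> h0; apply/eqP; rewrite eqn_leq; apply/andP.
split; rewrite -(leq_exp2l _ _ (finRing_gt1 k)) -!cardL_ell.
  apply: (fset_set_le_fset_set (G := fun v => h^-1 * v)); try exact: finite_sections.
    by move=> v hv; apply/(sectionsM _ _ h0); rewrite mulVKf.
  by move=> v w _ _; apply: mulfI; rewrite invr_eq0.
apply: (fset_set_le_fset_set (G := fun v => h * v)); try exact: finite_sections.
  by move=> v /(sectionsM _ _ h0).
by move=> v w _ _; apply: mulfI.
Qed.

Lemma ell_deg_bound x D : div_le (- << x >>) D -> (ell D)%:Z <= Deg D + (deg x)%:Z.
Proof.
move/ell_deg_mono; rewrite div_degN div_degU.
suff -> : ell (- << x >>) = 0%N by lia.
apply/eqP; rewrite -leqn0 -(leq_exp2l _ _ (finRing_gt1 k)) -cardL_ell expn0.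
rewrite -card_unit; apply: (fset_set_le_card (finite_sections _) (G := fun=> tt)).
by move=> v w /sections_neg-> /sections_neg->.
Qed.

End Sections.

Lemma mulz_neg_lt (a : int) (i m : nat) : a < 0 -> (i < m)%N -> a * m%:Z + 1 <= a * i%:Z.
Proof.
move=> a0 im; rewrite -(subnK im) !PoszD; set j := Posz (m - _); have j0 : 0 <= j by [].
nia.
Qed.

Lemma coeff_sum (S : fieldType) (x : place S) (I : Type) (r : seq I) (P : pred I) (G : I -> divisor S) :
  coeff x (\sum_(i <- r | P i) G i) = \sum_(i <- r | P i) coeff x (G i).
Proof. by apply: (big_morph (coeff x)); [exact: coeffD|exact: coeff0]. Qed.

(** * Riemann's inequality *)

Section RiemannInequality.
Variables (k : finFieldType) (S : fieldType) (c : {rmorphism k -> S}).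
Hypothesis S_ff : function_field c.
Implicit Types (D N : divisor S) (x y : place S) (h s : S).
Local Notation deg := (place_deg c).
Local Notation Deg := (div_deg c).
Local Notation q := #|k|.

Lemma zero_degree_le s m : s != 0 -> spans_over c s m -> Deg (fgpos (divf s)) <= m%:Z.
Proof.
move=> s0 sp.
have cE x : coeff x (fgpos (divf s)) = Num.max 0 (x s) by rewrite coeff_fgposE (coeff_divf S_ff).
have pos x : x \in dom (fgpos (divf s)) -> 1 <= x s.
  by rewrite mem_dom cE /Order.max; case: ifP => [|_]; rewrite ?eqxx //; lia.
have := zeros_bound S_ff s0 sp (uniq_dom (fgpos (divf s))) pos.
rewrite -lez_nat => h; apply: le_trans h.
rewrite /div_deg (big_morph _ PoszD (erefl (Posz 0))) big_seq [X in _ <= X]big_seq.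
apply: ler_sum => x /pos xs; rewrite PoszM cE ler_pM2r; last first.
  by have := place_deg_gt0 S_ff x; lia.
by rewrite ge_max; lia.
Qed.

Lemma vge_ev x t r (p : {poly k}) : (size p <= r.+1)%N ->
  vge x (ev c t p) (- coeff x (fgneg (divf t)) * r%:Z).
Proof.
move=> sp; rewrite (ev_sum_coef _ _ sp); apply: vge_sum => j _.
apply: vgeMl; first exact: vge_const.
have [t0|t0] := eqVneq t 0.
  rewrite t0; case: (j : nat) => [|i]; last by rewrite exprS mul0r; apply: vge0.
  by right; rewrite expr0 dval1 mulNr oppr_le0 mulr_ge0 // coeff_fgnegE oppr_ge0 ge_min lexx.
right; rewrite dvalX // coeff_fgnegE opprK (coeff_divf S_ff) //.
have := ltn_ord j; rewrite /Order.min; case: ifP => h lt; last by move: h; nia.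
by rewrite mul0r mulr_ge0 // ltW.
Qed.

Lemma dval_ev_neg x t (p : {poly k}) : x t < 0 -> p != 0 ->
  x (ev c t p) = x t * (size p).-1%:Z.
Proof.
move=> xt p0; have t0 : t != 0 by apply: contraTneq xt => ->; rewrite dval0.
have sp : (size p).-1.+1 = size p by rewrite prednK // size_poly_gt0.
have sp' : (size p <= (size p).-1.+1)%N by rewrite sp.
rewrite (ev_sum_coef _ _ sp') big_ord_recr /= addrC.
have l0 : p`_(size p).-1 != 0 by rewrite -lead_coefE lead_coef_eq0.
have tl0 : c p`_(size p).-1 * t ^+ (size p).-1 != 0.
  by rewrite mulf_neq0 ?expf_neq0 // fmorph_eq0.
have xl : x (c p`_(size p).-1 * t ^+ (size p).-1) = x t * (size p).-1%:Z.
  by rewrite dvalM ?expf_neq0 ?fmorph_eq0 // finite_dval_const add0r dvalX.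
rewrite -xl; apply: (proj2 (dvalD_dom tl0 _)); rewrite xl.
apply: vge_sum => i _; apply: vgeMl; first exact: vge_const.
by right; rewrite dvalX // mulz_neg_lt.
Qed.

(** Two powers of [t] have the same residue at [x], residues being finite in number. At a pole of
    [t] the polynomial 1 is a placeholder. *)
Lemma place_kills_polynomial x t : exists p : {poly k}, p != 0 /\
  (0 <= x t -> vge x (ev c t p) 1).
Proof.
have [xt|xt] := leP 0 (x t); last by exists 1; rewrite oner_neq0.
pose G (i : 'I_(#|residues c x|).+1) := res S_ff x (t ^+ i).
have /injectivePn[i [j ij e]] : ~~ injectiveb G.
  by apply/negP => /injectiveP/leq_card; rewrite card_ord ltnn.
exists ('X^i - 'X^j); split.
  apply: contra_neq ij => /(congr1 (coefp i)) /eqP.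
  rewrite /= coefB !coefXn coef0 eqxx; case: (eqVneq (i : nat) j) => [/val_inj//|_].
  by rewrite subr0 oner_eq0.
move=> _; rewrite evB !evXn; apply/(res_eqP S_ff) => //.
  by apply: vgeX; right.
by apply: vgeX; right.
Qed.

(** Let [B] be the polar divisor of [t] and let [C] bound the poles of a basis. Coefficients of
    degree at most [r] in [t] give n(r + 1) independent sections of L(rB + C). Comparison with the
    upper bound for [ell] yields deg B = n, and every [D] is at most rB + C + div(p(t)) for suitable
    [p] and [r]. *)
Lemma riemann_inequality : exists gam : int, forall D, Deg D <= (ell c D)%:Z + gam.
Proof.
have [t [n' [t_tr t_sp']]] := function_field_spanned S_ff.
have t0 : t != 0 by have := t_tr 'X; rewrite evX polyX_eq0; apply.
have [n [b [bsp bind]]] : exists n (b : 'I_n -> S),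
  (forall h, exists (a : 'I_n -> {poly k}) d,
    ev c t d != 0 /\ ev c t d * h = \sum_i ev c t (a i) * b i) /\
  (forall p : 'I_n -> {poly k}, \sum_i ev c t (p i) * b i = 0 -> forall i, p i = 0).
  by apply: minimal_span => //; exists n'.
have t_sp : spans_over c t n by exists 'I_n, b; rewrite card_ord.
pose B := fgneg (divf t); pose C := \sum_i fgneg (divf (b i)).
have fgneg_ge0 N x : 0 <= coeff x (fgneg N) by rewrite coeff_fgnegE oppr_ge0 ge_min lexx.
have C0 x : 0 <= coeff x C by rewrite coeff_sum; apply: sumr_ge0 => i _; apply: fgneg_ge0.
have bC i x : vge x (b i) (- coeff x C).
  have [->|b0] := eqVneq (b i) 0; first exact: vge0.
  right; rewrite coeff_sum (bigD1 i) //=.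
  have : 0 <= \sum_(j < n | j != i) coeff x (fgneg (divf (b j))) by apply: sumr_ge0 => j _; apply: fgneg_ge0.
  rewrite coeff_fgnegE (coeff_divf S_ff) //.
  have : Num.min 0 (x (b i)) <= x (b i) by rewrite ge_min lexx orbT.
  by rewrite opprD opprK => h1 h2; apply: le_trans h1; rewrite gerBl.
have low r : (n * r.+1 <= ell c (B *+ r + C)%R)%N.
  rewrite -(leq_exp2l _ _ (finRing_gt1 k)) -(cardL_ell S_ff).
  have -> : (#|k| ^ (n * r.+1) = #|{: {ffun 'I_n -> 'rV[k]_r.+1}}|)%N.
    by rewrite card_ffun card_ord card_mx mul1n -expnM mulnC.
  pose G (a : {ffun 'I_n -> 'rV[k]_r.+1}) := \sum_i ev c t (rVpoly (a i)) * b i.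
  apply: (card_le_fset_set (finite_sections S_ff _) (G := G)).
    move=> a a' e; apply/ffunP => i.
    have : \sum_i ev c t (rVpoly (a i) - rVpoly (a' i)) * b i = 0.
      by under eq_bigr do rewrite evB mulrBl; rewrite sumrB; apply/eqP; rewrite subr_eq0; apply/eqP.
    move/bind => /(_ i)/eqP; rewrite subr_eq0 => /eqP e'.
    by rewrite -(rVpolyK (a i)) e' rVpolyK.
  move=> a x; apply: vge_sum => i _; rewrite coeffD coeffMn.
  apply: (@vgeW _ _ _ (- coeff x B * r%:Z + - coeff x C)); first by rewrite -mulr_natr natz mulNr opprD lexx.
  by apply: vgeM; [apply: vge_ev; rewrite size_poly|apply: bC].
have [x0 _] := exists_place S_ff.
have up r : (ell c (B *+ r + C))%:Z <= Deg (B *+ r + C) + (deg x0)%:Z.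
  apply: (ell_deg_bound S_ff) => x; rewrite coeffN coeffU coeffD coeffMn.
  apply: (@le_trans _ _ 0); first by case: (x0 == x).
  by rewrite addr_ge0 // mulrn_wge0 // fgneg_ge0.
have DegE r : Deg (B *+ r + C) = Deg B * r%:Z + Deg C.
  by rewrite div_degD div_degMn -mulr_natr natz.
have B_ge : n%:Z <= Deg B.
  rewrite leNgt; apply/negP => lt.
  pose r := (absz (Deg C + (deg x0)%:Z)).+1.
  have h1 : Deg B * r%:Z <= (n%:Z - 1) * r%:Z by rewrite ler_wpM2r //; lia.
  have := up r; rewrite DegE; have := low r; set e := ell _ _.
  rewrite -lez_nat PoszM => h2 h3.
  have h4 : r%:Z > Deg C + (deg x0)%:Z by rewrite /r; lia.
  have h5 : n%:Z * r%:Z + n%:Z <= e%:Z by move: h2; lia.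
  by move: h1; rewrite mulrBl mul1r => h1; lia.
have B_le : Deg B <= n%:Z.
  have -> : B = fgpos (divf t^-1) by rewrite (divfV S_ff) // fgposN.
  by apply: zero_degree_le; rewrite ?invr_eq0 //; apply: spans_overV.
have poly_deg (p : {poly k}) : (1 < size p)%N -> Deg (divf (ev c t p)) <= 0.
  move=> p1; have p0 : p != 0 by rewrite -size_poly_gt0 (ltn_trans _ p1).
  rewrite [divf _]fg_decomp div_degB subr_le0.
  apply: (@le_trans _ _ (n * (size p).-1)%N%:Z).
    by apply: zero_degree_le; [apply: t_tr|apply: spans_over_ev].
  apply: (@le_trans _ _ (Deg (B *+ (size p).-1))).
    by rewrite div_degMn -mulr_natr natz PoszM ler_wpM2r.
  apply: div_le_deg => x; rewrite coeffMn !coeff_fgnegE !(coeff_divf S_ff) ?t_tr //.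
  have [xt|xt] := leP 0 (x t).
    by rewrite oppr0 mul0rn oppr_ge0 ge_min lexx.
  rewrite dval_ev_neg // min_r; last by rewrite nmulr_rle0.
  by rewrite -mulr_natr natz mulNr.
exists (Deg C) => D; have [s [s' Ds]] := seq_div_diff D.
have /choice[P PP] := place_kills_polynomial^~ t.
(* [p(t)] vanishes at the places of [s] where [t] is regular; the factor ['X] makes [p] nonconstant,
   as [poly_deg] requires. *)
pose p := 'X * \prod_(x <- s) P x.
have pr0 : \prod_(x <- s) P x != 0.
  by rewrite prodf_seq_neq0; apply/allP => x _; have [-> _] := PP x.
have p1 : (1 < size p)%N.
  by rewrite /p mulrC size_mulX // ltnS size_poly_gt0.
have p0 : p != 0 by rewrite -size_poly_gt0 (ltn_trans _ p1).
(* At the poles of [t], the summand [m] of [r] compensates the poles of [p(t)], and [size s] covers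
   the multiplicities of [s]. *)
pose m := (size p).-1; pose r := (size s + m)%N.
pose E := B *+ r + C + divf (ev c t p).
have DE : div_le D E.
  move=> x; rewrite Ds /E !coeffD coeffN !coeff_seq_div coeffMn -mulr_natr natz (coeff_divf S_ff) ?t_tr //.
  have cs : (count_mem x s <= size s)%N by apply: count_size.
  have := C0 x; have Bx : coeff x B = - Num.min 0 (x t) by rewrite coeff_fgnegE (coeff_divf S_ff).
  have [xt|xt] := leP 0 (x t).
    suff : vge x (ev c t p) (count_mem x s)%:Z.
      rewrite vgeE ?t_tr // => h Cx; have Br : 0 <= coeff x B * r%:Z by rewrite mulr_ge0 // fgneg_ge0.
      apply: (@le_trans _ _ (count_mem x s)%:Z); first by rewrite gerBl.
      by apply: (le_trans h); rewrite lerDr addr_ge0.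
    rewrite /p evM evX; apply: vgeMl; first by right.
    rewrite ev_prod; elim: (s) => [|y l IH]; first by rewrite big_nil; apply: vge1.
    rewrite big_cons /= PoszD; apply: vgeM IH.
    case: eqP => [->|_]; first by have [_] := PP x; apply.
    by apply: (subring_set_ev (integers_subring x)); [apply: vge_const|right].
  rewrite dval_ev_neg // -/m Bx (min_r (ltW xt)) /r => Cx.
  have h : x t * (size s)%:Z <= - (size s)%:Z by rewrite -mulN1r ler_wpM2r //; lia.
  apply: (@le_trans _ _ (count_mem x s)%:Z); first by rewrite gerBl.
  apply: (@le_trans _ _ (size s)%:Z); first by rewrite lez_nat.
  apply: (@le_trans _ _ (coeff x C + - (x t * (size s)%:Z))); first by rewrite ler_wpDl // lerNr.
  by rewrite le_eqVlt; apply/orP; left; apply/eqP; rewrite PoszD; ring.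
have ellE : ell c E = ell c (B *+ r + C).
  by rewrite /E -[RHS](ell_divf S_ff _ (h := (ev c t p)^-1)) ?invr_eq0 ?t_tr // (divfV S_ff) ?t_tr // opprK.
have := ell_deg_mono S_ff DE; rewrite ellE /E div_degD DegE.
have := low r; have := poly_deg p p1; set e := ell c (_ + _); nia.
Qed.

(** All multiples of a principal divisor have the [ell] of 0, so a positive degree would contradict
    [riemann_inequality]; a negative one is excluded through the inverse. *)
Lemma div_deg_divf h : h != 0 -> Deg (divf h) = 0.
Proof.
have [gam gamP] := riemann_inequality.
have le0 h' : h' != 0 -> Deg (divf h') <= 0.
  move=> h0; rewrite leNgt; apply/negP => lt.
  have e r : ell c (divf h' *+ r) = ell c 0.
    elim: r => [|r IH]; first by rewrite mulr0n.
    by rewrite -(ell_divf S_ff _ h0) mulrS addrAC subrr add0r.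
  have := gamP (divf h' *+ (absz ((ell c 0)%:Z + gam)).+1).
  rewrite e div_degMn -mulr_natr natz; nia.
move=> h0; apply/eqP; rewrite eq_le le0 //=.
by have := le0 h^-1; rewrite invr_eq0 (divfV S_ff) // div_degN oppr_le0; apply.
Qed.

Lemma is_div_deg h D : is_div h D -> Deg D = 0.
Proof. by move=> hD; have [h0 _] := hD; rewrite (is_div_unique S_ff hD) div_deg_divf. Qed.

End RiemannInequality.

Lemma fset_set_param (T : choiceType) (J : finType) (A : set T) : finite_set A ->
  #|J| = #|` fset_set A| -> exists G : J -> T, injective G /\ forall j, A (G j).
Proof.
move=> fin JA; pose s : seq T := fset_set A.
have lt (j : J) : (enum_rank j < size s)%N by rewrite -JA.
case E : s => [|x0 s'].
  have no (j : J) : False by have := lt j; rewrite E.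
  by exists (fun j => False_rect T (no j)); split=> j; case: (no j).
exists (fun j => nth x0 s (enum_rank j)); split.
  move=> j j' /eqP; rewrite nth_uniq ?fset_uniq ?lt // => /eqP e.
  by apply: enum_rank_inj; apply: val_inj.
by move=> j; have := mem_nth x0 (lt j); rewrite in_fset_set // => /set_mem.
Qed.

(** * Adeles and Weil differentials *)

Section Adeles.
Variables (k : finFieldType) (S : fieldType) (c : {rmorphism k -> S}).
Hypothesis S_ff : function_field c.
Implicit Types (D N : divisor S) (x y : place S) (h s : S) (al be : place S -> S).
Local Notation deg := (place_deg c).
Local Notation Deg := (div_deg c).
Local Notation q := #|k|.

Lemma adeleE al : adele al = finite_set [set x | ~ vge x (al x) 0].
Proof. by []. Qed.

Lemma adele_le_adele D al : adele_le D al -> adele al.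
Proof.
move=> aD; rewrite adeleE; apply: (@sub_finite_set _ _ [set` dom D]); last exact: finite_seq.
move=> x /= nx; rewrite /= mem_dom; apply: contra_notN nx => /eqP D0.
by have := aD x; rewrite D0 oppr0.
Qed.

Lemma adele_const h : adele (fun=> h).
Proof.
have [->|h0] := eqVneq h 0.
  by rewrite adeleE; apply: (@sub_finite_set _ _ set0) => // x /= []; apply: vge0.
rewrite adeleE; refine (@sub_finite_set _ _ [set x : place S | x h != 0] _ (finite_dval_support S_ff h0)) => x /= nx.
by apply/eqP => xh; apply: nx; right; rewrite xh.
Qed.

Lemma adeleM al be : adele al -> adele be -> adele (fun x => al x * be x).
Proof.
rewrite !adeleE => ha hb; apply: (@sub_finite_set _ _ ([set x | ~ vge x (al x) 0] `|` [set x | ~ vge x (be x) 0])); last by rewrite finite_setU.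
move=> x /= nx; apply: contrapT => /not_orP[/contrapT h1 /contrapT h2].
by apply: nx; apply: vgeMl.
Qed.

Lemma adeleD al be : adele al -> adele be -> adele (fun x => al x + be x).
Proof.
rewrite !adeleE => ha hb; apply: (@sub_finite_set _ _ ([set x | ~ vge x (al x) 0] `|` [set x | ~ vge x (be x) 0])); last by rewrite finite_setU.
move=> x /= nx; apply: contrapT => /not_orP[/contrapT h1 /contrapT h2].
by apply: nx; apply: vgeD.
Qed.

Lemma adele_scale r al : adele al -> adele (fun x => c r * al x).
Proof. by apply: adeleM; apply: adele_const. Qed.

Lemma adeleMl h al : adele al -> adele (fun x => h * al x).
Proof. by apply: adeleM; apply: adele_const. Qed.

Lemma adele_sum (I : Type) (r : seq I) (P : pred I) (G : I -> place S -> S) :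
  (forall i, adele (G i)) -> adele (fun x => \sum_(i <- r | P i) G i x).
Proof.
move=> hG; elim: r => [|i r IH].
  have -> : (fun x => \sum_(i <- [::] | P i) G i x) = fun=> 0 by apply: funext => x; rewrite big_nil.
  exact: adele_const.
have -> : (fun x => \sum_(j <- i :: r | P j) G j x) =
    if P i then (fun x => G i x + \sum_(j <- r | P j) G j x) else fun x => \sum_(j <- r | P j) G j x.
  by apply: funext => x; rewrite big_cons; case: (P i).
by case: (P i) => //; apply: adeleD.
Qed.

Lemma adele_leW D D' al : div_le D D' -> adele_le D al -> adele_le D' al.
Proof. by move=> le ha x; apply: vgeW (ha x); rewrite lerN2. Qed.

Lemma adele_leM D h al : h != 0 -> adele_le D al -> adele_le (D - divf h) (fun x => h * al x).
Proof.
move=> h0 ha x; rewrite coeffB (coeff_divf S_ff) // opprB.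
by apply: vgeM; [right|apply: ha].
Qed.

Lemma adele_bound D0 al : adele al -> exists2 D, div_le D0 D & adele_le D al.
Proof.
rewrite adeleE => /finite_seqP[s es].
have [|D DE] := @div_of_fun _ (dom D0 ++ s) (fun x => Num.max (coeff x D0) (- x (al x))).
  move=> x mx; rewrite mem_cat; case: (boolP (x \in dom D0)) => //=; rewrite mem_dom negbK => /eqP D0x.
  have : [set x : place S | ~ vge x (al x) 0] x; last by rewrite es.
  move=> /= [a0|ax]; move: mx; first by rewrite a0 dval0 D0x oppr0 maxxx eqxx.
  by rewrite D0x max_l ?eqxx // oppr_le0.
exists D => x; rewrite DE; first by rewrite le_max lexx.
by right; rewrite lerNl le_max lexx orbT.
Qed.

(** If [ell - Deg] no longer drops above [D], the dimension grows by the full degree of [x]; a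
    missing leading part would leave too few fibres for that. *)
Lemma lead_part_surj D : (forall D', div_le D D' -> (ell c D')%:Z - Deg D' = (ell c D)%:Z - Deg D) ->
  forall D', div_le D D' -> forall x (r : residues c x),
  exists2 h, sections (D' + << x >>) h & lead_part S_ff (D' + << x >>) x h = r.
Proof.
move=> max D' DD' x r; apply: contrapT => nr.
have DD'' : div_le D (D' + << x >>).
  move=> y; rewrite coeffD; apply: le_trans (DD' y) _; rewrite lerDl.
  by rewrite coeffU mul1r; case: (x == y).
have := max _ DD''; rewrite -(max _ DD') div_degD div_degU => e.
have {}e : ell c (D' + << x >>) = (ell c D' + deg x)%N by lia.
have := cardL_ell S_ff (D' + << x >>); rewrite e expnD -(cardL_ell S_ff) -card_residues => cE.
have phiE v w : sections (D' + << x >>) v -> sections (D' + << x >>) w ->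
    lead_part S_ff (D' + << x >>) x v = lead_part S_ff (D' + << x >>) x w -> sections D' (v - w).
  by move=> hv hw /(lead_part_eq S_ff x hv hw); rewrite addrK.
have cf := count_fiber (finite_sections S_ff D') phiE.
have : (#|` fset_set (sections (D' + << x >>)%R)| <= #|` fset_set (sections D')| * #|residues c x|.-1)%N.
  rewrite -sum1_size (partition_big (lead_part S_ff (D' + << x >>) x) xpredT) //= (bigD1 r) //=.
  rewrite [X in (X + _ <= _)%N]big1_seq ?add0n; last first.
    move=> h /andP[/eqP hr]; rewrite in_fset_set; last exact: (finite_sections S_ff).
    by move=> /set_mem hD; case: nr; exists h.
  rewrite mulnC -(cardC1 r) -sum_nat_const; apply: leq_sum => r' _.
  by rewrite sum1_count.
rewrite cE leqNgt => /negP; apply; rewrite ltn_pmul2l; last by rewrite (cardL_ell S_ff) expn_gt0 (ltnW (finRing_gt1 k)).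
by rewrite prednK //; apply/card_gt0P; exists r.
Qed.

(** [D0] minimizes [ell - Deg], which Riemann's inequality bounds below. Above [D0] every leading
    part is attained by a function, so the excess poles of a repartition are removed one place at a
    time. *)
Lemma adele_exhaust : exists D0, forall al, adele al ->
  exists h, adele_le D0 (fun x => al x - h).
Proof.
have [gam gamP] := riemann_inequality S_ff.
pose P n := `[< exists D, (ell c D)%:Z - Deg D + gam = n%:Z >].
have exP : exists n, P n.
  exists (absz ((ell c 0)%:Z - Deg 0 + gam)); apply/asboolP; exists 0.
  by have := gamP 0; lia.
case: (ex_minnP exP) => n /asboolP[D0 D0n] min.
exists D0 => al /(@adele_bound D0)[D /div_le_seq_div[s ->]].
have max D' : div_le D0 D' -> (ell c D')%:Z - Deg D' = (ell c D0)%:Z - Deg D0.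
  move=> le; have h1 := ell_deg_mono S_ff le.
  have h2 : (n <= absz ((ell c D')%:Z - Deg D' + gam)%R)%N.
    by apply: min; apply/asboolP; exists D'; have := gamP D'; lia.
  by have := gamP D'; lia.
elim: s al => [|x s IH] al; first by rewrite seq_div_nil addr0 => ha; exists 0; under eq_fun do rewrite subr0.
rewrite seq_div_cons [<< x >> + _]addrC addrA; set D1 := D0 + seq_div s in IH * => ha.
have le : div_le D0 D1 by move=> y; rewrite coeffD lerDl coeff_seq_div.
have aint : vge x (al x * unif x ^ coeff x (D1 + << x >>)) 0.
  by apply/vge_unifX; rewrite sub0r; apply: ha.
have [h hD hr] := lead_part_surj max le (res S_ff x (al x * unif x ^ coeff x (D1 + << x >>))).
have [|h' hh'] := IH (fun x => al x - h).
  move=> y; have ehD : coeff y (D1 + << x >>) = coeff y D1 + (x == y)%:Z.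
    by rewrite coeffD coeffU mul1r natz.
  have [xy|xy] := eqVneq x y; last first.
    have := vgeB (ha y) (hD y); rewrite ehD (negPf xy) addr0; exact.
  rewrite -xy in ehD *; move/(res_eqP S_ff (lead_part_int x hD) aint): hr => /vgeBC.
  by rewrite -mulrBl vge_unifX ehD eqxx; apply: vgeW; lia.
by exists (h + h') => y; rewrite opprD addrA; apply: hh'.
Qed.

(** In large degree L(D - D0) contains a nonzero [z]: divide the repartition by [z], apply
    [adele_exhaust], and multiply back. *)
Lemma vanishing : exists n0 : int, forall D, n0 <= Deg D -> forall al, adele al ->
  exists h, adele_le D (fun x => al x - h).
Proof.
have [D0 D0P] := adele_exhaust; have [gam gamP] := riemann_inequality S_ff.
exists (Deg D0 + gam + 1) => D hD al ha.
have e1 : (0 < ell c (D - D0)%R)%N by have := gamP (D - D0); rewrite div_degB; lia.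
have [z hz z0] : exists2 z, sections (D - D0) z & z != 0.
  apply: contrapT => nz; have := cardL_ell S_ff (D - D0).
  have : (#|` fset_set (sections (D - D0)%R)| <= #|{: unit}|)%N.
    apply: (fset_set_le_card (finite_sections S_ff _) (G := fun=> tt)) => v w hv hw _.
    have zero u : sections (D - D0) u -> u = 0.
      by move=> hu; apply: contrapT => /eqP u0; apply: nz; exists u.
    by rewrite (zero _ hv) (zero _ hw).
  rewrite card_unit => h1 h2; move: h1; rewrite h2 leqNgt => /negP; apply.
  by rewrite -(expn0 #|k|) ltn_exp2l ?finRing_gt1.
have [h hh] := D0P _ (adeleMl z^-1 ha).
exists (z * h) => x; have -> : al x - z * h = z * (z^-1 * al x - h) by rewrite mulrBr mulVKf.
apply: (@vgeW _ _ _ (- coeff x (D - D0) + - coeff x D0)); first by rewrite coeffB; lia.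
by apply: vgeM; [apply: hz|apply: hh].
Qed.

Lemma rep_delta x (r : residues c x) :
  rep S_ff r = \sum_i c (r i) * rep S_ff ([ffun j => (j == i)%:R] : residues c x).
Proof.
rewrite {1}/rep; apply: eq_bigr => i _; rewrite /rep (bigD1 i) //= big1 ?addr0 => [|j /negPf ne].
  by rewrite ffunE eqxx rmorph1 mul1r.
by rewrite ffunE ne rmorph0 mul0r.
Qed.

Lemma adele_span D (s : seq (place S)) : exists (I : finType) (b : I -> place S -> S),
  [/\ #|I|%:Z = Deg (seq_div s), forall i, adele_le (D + seq_div s) (b i) &
   forall al, adele_le (D + seq_div s) al -> exists a : I -> k,
     adele_le D (fun x => al x - \sum_i c (a i) * b i x)].
Proof.
elim: s => [|x s [I [b [In bD bsp]]]].
  exists void, (fun=> fun=> 0); rewrite seq_div_nil addr0 div_deg0; split=> // [|al ha].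
    by rewrite card_void.
  by exists (fun=> 0) => x; rewrite big1 => [|[]//]; rewrite subr0.
have leD y : coeff y (D + seq_div s) <= coeff y (D + seq_div (x :: s)).
  by rewrite seq_div_cons !coeffD lerD2l lerDr coeffU mul1r; case: (x == y).
have cx : coeff x (D + seq_div (x :: s)) = coeff x (D + seq_div s) + 1.
  by rewrite seq_div_cons !coeffD coeffU mul1r eqxx addrCA addrC.
have cy y : x != y -> coeff y (D + seq_div (x :: s)) = coeff y (D + seq_div s).
  by move=> /negPf xy; rewrite seq_div_cons !coeffD coeffU xy mulr0 add0r.
set m := coeff x (D + seq_div (x :: s)) in cx *.
pose e (i : 'I_(deg x)) y := if y == x then rep S_ff ([ffun j => (j == i)%:R] : residues c x) * unif x ^ (- m) else 0.
exists (I + 'I_(deg x))%type, (fun i => match i with inl i => b i | inr i => e i end); split.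
- by rewrite card_sum card_ord seq_div_cons div_degD div_degU PoszD In addrC.
- move=> [i|i] y; first by apply: vgeW (bD i y); rewrite lerN2.
  rewrite /e; case: eqP => [->|_]; last exact: vge0.
  by apply/vge_unifX; rewrite -/m; apply: (@vgeW _ _ _ 0); [lia|apply: rep_int].
move=> al ha.
have aint : vge x (al x * unif x ^ m) 0 by apply/vge_unifX; rewrite sub0r; apply: ha.
pose r := res S_ff x (al x * unif x ^ m).
have sumE y : \sum_i c (r i) * e i y = if y == x then rep S_ff r * unif x ^ (- m) else 0.
  rewrite /e; case: eqP => _; last by rewrite big1 // => i _; rewrite mulr0.
  by rewrite rep_delta mulr_suml; apply: eq_bigr => i _; rewrite mulrA.
have [|a aP] := bsp (fun y => al y - \sum_i c (r i) * e i y).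
  move=> y; rewrite sumE; case: eqP => [->|/eqP yx]; last first.
    by rewrite subr0; have := ha y; rewrite cy // eq_sym.
  have p0 := unif_neq0 x.
  have -> : al x - rep S_ff r * unif x ^ (- m) = (al x * unif x ^ m - rep S_ff r) * unif x ^ (- m).
    by rewrite mulrBl -mulrA -expfzDr // subrr mulr1.
  by apply/vge_unifX; apply: vgeW (res_rep_near S_ff aint); rewrite cx; lia.
exists (fun i => match i with inl i => a i | inr i => r i end) => y.
by rewrite big_sumType /= opprD addrA [al y - _ - _]addrAC; apply: aP.
Qed.

(** The repartitions with trivial class in H^1(X, O(D)). *)
Definition H1_zero D : set (place S -> S) := [set al | exists h, adele_le D (fun x => al x - h)].

Lemma H1_basis D : let n := quot_dim (fun (a : k) al => fun x => c a * al x) (@adele S) (H1_zero D) in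
  exists b : 'I_n -> place S -> S, (forall i, adele (b i)) /\
  forall al, adele al -> exists! a : {ffun 'I_n -> k},
    H1_zero D (fun x => al x - \sum_i c (a i) * b i x).
Proof.
pose sc (a : k) (al : place S -> S) := fun x => c a * al x.
have sumE (n : nat) (a : 'I_n -> k) (b : 'I_n -> place S -> S) :
    \sum_i sc (a i) (b i) = (fun x => \sum_i c (a i) * b i x).
  by apply: funext => x; rewrite fct_sumE.
have [|||||||b [bD bU]] := @quot_dim_basis _ _ sc _ _ _ _ (@adele S) (H1_zero D).
- by move=> a v w; apply: funext => x; rewrite /sc mulrDr.
- by move=> a b v; apply: funext => x; rewrite /sc rmorphD mulrDl.
- by move=> a b v; apply: funext => x; rewrite /sc rmorphM mulrA.
- by move=> v; apply: funext => x; rewrite /sc rmorph1 mul1r.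
- move=> v w [h hv] [h' hw]; exists (h - h') => x.
  have -> : (v - w) x - (h - h') = (v x - h) - (w x - h').
    by rewrite [(v - w) x]/(v x - w x) !opprD addrACA.
  by apply: vgeB; [apply: hv|apply: hw].
- move=> a v [h hv]; exists (c a * h) => x; rewrite /sc -mulrBr.
  by apply: vgeMl; [apply: vge_const|apply: hv].
- have [D0 D0P] := adele_exhaust.
  have [l le] : exists l : seq (place S), div_le D0 (D + seq_div l).
    have [l [l' e]] := seq_div_diff (D0 - D); exists l => y.
    by rewrite -(subrK D D0) e addrC !coeffD lerD2l coeffN gerBl coeff_seq_div.
  have [I [b [_ bD bsp]]] := adele_span D l.
  exists #|I|, (fun i => b (enum_val i)); split=> [i|al ha]; first exact: adele_le_adele (bD _).
  have [h hh] := D0P _ ha; have [a aP] := bsp _ (adele_leW le hh).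
  exists [ffun i => a (enum_val i)]; exists h => x; rewrite sumE.
  change (vge x (al x - \sum_(i < #|I|) c ([ffun i => a (enum_val i)] i) * b (enum_val i) x - h) (- coeff x D)).
  under eq_bigr do rewrite ffunE.
  have -> : \sum_(i < #|I|) c (a (enum_val i)) * b (enum_val i) x = \sum_i c (a i) * b i x.
    by rewrite [RHS](reindex (@enum_val I I)) //; apply: onW_bij; apply: enum_val_bij.
  by rewrite addrAC; apply: aP.
exists b; split=> // al ha; have [a [h u]] := bU al ha.
exists a; split=> [|a' ha']; first by move: h; rewrite sumE.
by apply: u; rewrite sumE.
Qed.

End Adeles.

(** * Weil differentials and duality *)

Section WeilDifferentials.
Variables (k : finFieldType) (S : fieldType) (c : {rmorphism k -> S}).
Hypothesis S_ff : function_field c.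
Implicit Types (D N : divisor S) (x y : place S) (h z : S) (al be : place S -> S).
Implicit Types (om : (place S -> S) -> k).
Local Notation deg := (place_deg c).
Local Notation Deg := (div_deg c).
Local Notation q := #|k|.

Section OneDifferential.
Variable om : (place S -> S) -> k.
Hypothesis omW : weil_differential c om.

Lemma differentialD al be : adele al -> adele be -> om (fun x => al x + be x) = om al + om be.
Proof.
case: omW => lin _ _ ha hb; rewrite -[om al]mul1r -lin //; congr om.
by apply: funext => x; rewrite rmorph1 mul1r.
Qed.

Lemma differential0 : om (fun=> 0) = 0. Proof. by case: omW => _ + _; apply. Qed.

Lemma differentialZ a al : adele al -> om (fun x => c a * al x) = a * om al.
Proof.
case: (omW) => lin _ _ ha; rewrite -[RHS]addr0 -differential0 -lin //; last exact: adele_const S_ff 0.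
by congr om; apply: funext => x; rewrite addr0.
Qed.

Lemma differential_sum n (a : 'I_n -> k) (b : 'I_n -> place S -> S) : (forall i, adele (b i)) ->
  om (fun x => \sum_i c (a i) * b i x) = \sum_i a i * om (b i).
Proof.
move=> hb; elim: n a b hb => [|n IH] a b hb.
  rewrite big_ord0 -[RHS]differential0; congr om; apply: funext => x; exact: big_ord0.
rewrite big_ord_recl -IH // -differentialZ // -differentialD.
- by congr om; apply: funext => x; rewrite big_ord_recl.
- exact: (adele_scale S_ff).
- by apply: (adele_sum S_ff) => // i; apply: (adele_scale S_ff).
Qed.

Lemma differential_shift h al : adele al -> om (fun x => al x + h) = om al.
Proof.
move=> ha; rewrite (differentialD ha (adele_const S_ff h)).
by case: (omW) => _ -> _; rewrite addr0.
Qed.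

(* [om] is determined by its values on representatives of a spanning family modulo
   an adelic subspace on which it vanishes. *)
Lemma differential_eq0 D n (b : 'I_n -> place S -> S) :
  (forall i, adele (b i)) -> (forall i, om (b i) = 0) ->
  (forall al, adele_le D al -> om al = 0) ->
  (forall al, adele al -> exists a : 'I_n -> k, H1_zero D (fun x => al x - \sum_i c (a i) * b i x)) ->
  forall al, adele al -> om al = 0.
Proof.
move=> hb b0 D0 sp al ha; have [a [h hh]] := sp al ha.
pose be x := \sum_i c (a i) * b i x.
have hbe : adele be by apply: (adele_sum S_ff) => // i; apply: (adele_scale S_ff).
pose ga x := al x - be x - h.
have -> : al = (fun x => (ga x + be x) + h).
  by apply: funext => x; rewrite /ga addrAC !subrK.
have hga : adele ga by apply: adele_le_adele hh.
rewrite differential_shift; last exact: adeleD.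
rewrite differentialD // D0 // add0r differential_sum // big1 // => i _.
by rewrite b0 mulr0.
Qed.

End OneDifferential.

Lemma differential_combine om om' z z' : weil_differential c om -> weil_differential c om' ->
  weil_differential c (fun al => om (fun x => z * al x) + om' (fun x => z' * al x)).
Proof.
move=> omW omW'; have [lin cst [D omD]] := omW; have [lin' cst' [D' omD']] := omW'.
split.
- move=> a al be ha hb.
  have E (w : S) : (fun x => w * (c a * al x + be x)) = fun x => c a * (w * al x) + w * be x.
    by apply: funext => x; ring.
  rewrite !E lin ?lin' ?mulrDr; try exact: (adeleMl S_ff).
  by ring.
- by move=> h; rewrite cst cst' addr0.
have mul_le N w al : adele_le (N + divf w) al -> adele_le N (fun x => w * al x).
  have [-> _ x|w0 /(adele_leM S_ff w0)] := eqVneq w 0; first by rewrite mul0r; apply: vge0.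
  by rewrite addrK.
have [l [l' e]] := seq_div_diff (D + divf z); have [r [r' e']] := seq_div_diff (D' + divf z').
exists (- seq_div l' - seq_div r') => al ha; rewrite omD; last first.
  by apply: mul_le; apply: adele_leW ha => x; rewrite e !coeffB coeffN !coeff_seq_div; lia.
rewrite omD' ?addr0 //.
by apply: mul_le; apply: adele_leW ha => x; rewrite e' !coeffB coeffN !coeff_seq_div; lia.
Qed.

Lemma div_le_eq D D' : div_le D D' -> Deg D = Deg D' -> D = D'.
Proof.
move=> /div_le_seq_div[[|x l] ->]; first by rewrite seq_div_nil addr0.
rewrite div_degD seq_div_cons div_degD div_degU => /eqP.
rewrite -subr_eq0 opprD addrA subrr add0r oppr_eq0 div_deg_seq_div.
by have := place_deg_gt0 S_ff x; move=> h /eqP; lia.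
Qed.

Lemma sections_injection D : exists G : {ffun 'I_(ell c D) -> k} -> S,
  injective G /\ forall a, sections D (G a).
Proof.
apply: fset_set_param; first exact: (finite_sections S_ff).
by rewrite (cardL_ell S_ff) card_ffun card_ord.
Qed.

(** The coordinates [co] with respect to a basis of H^1(X, O(D)) vanish on [adele_le D] and on
    constant repartitions, so their combinations are Weil differentials: linear forms on H^1 are
    realized as differentials. *)
Lemma dual_basis D : let n := quot_dim (fun (a : k) al => fun x => c a * al x) (@adele S) (H1_zero D) in
  exists (b : 'I_n -> place S -> S) (co : (place S -> S) -> {ffun 'I_n -> k}),
  [/\ forall i, adele (b i),
      forall al, adele al -> H1_zero D (fun x => al x - \sum_i c (co al i) * b i x),
      forall al (a : {ffun 'I_n -> k}), adele al -> H1_zero D (fun x => al x - \sum_i c (a i) * b i x) -> co al = a,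
      forall al, adele al -> H1_zero D al -> co al = [ffun=> 0] &
      forall r : 'I_n -> k, weil_differential c (fun al => \sum_i r i * co al i)].
Proof.
move=> n; have [b [hb bU]] := H1_basis S_ff D; rewrite -/n in b hb bU.
pose co al : {ffun 'I_n -> k} := xget [ffun=> 0] [set a : {ffun 'I_n -> k} | H1_zero D (fun x => al x - \sum_i c (a i) * b i x)].
have coP al : adele al -> H1_zero D (fun x => al x - \sum_i c (co al i) * b i x).
  by move=> /bU[a [ha _]]; apply: (@xgetPex _ _ [set a : {ffun 'I_n -> k} | H1_zero D (fun x => al x - \sum_i c (a i) * b i x)]); exists a.
have coU al (a : {ffun 'I_n -> k}) : adele al -> H1_zero D (fun x => al x - \sum_i c (a i) * b i x) -> co al = a.
  by move=> ha h; have [a0 [_ u]] := bU al ha; rewrite -(u _ h) -(u _ (coP _ ha)).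
have co0 al : adele al -> H1_zero D al -> co al = [ffun=> 0].
  move=> ha [h hh]; apply: coU => //; exists h => x; rewrite big1 ?subr0 // => i _.
  by rewrite ffunE rmorph0 mul0r.
exists b, co; split=> // r; split.
- move=> a al be ha hb'; rewrite (coU _ [ffun i => a * co al i + co be i]).
  + rewrite mulr_sumr -big_split; apply: eq_bigr => i _.
    by rewrite ffunE /=; ring.
  + by apply: adeleD => //; apply: (adele_scale S_ff).
  have [h hh] := coP _ ha; have [h' hh'] := coP _ hb'.
  exists (c a * h + h') => x.
  have -> : \sum_i c ([ffun i => a * co al i + co be i] i) * b i x =
      c a * \sum_i c (co al i) * b i x + \sum_i c (co be i) * b i x.
    rewrite mulr_sumr -big_split; apply: eq_bigr => i _.
    by rewrite ffunE rmorphD rmorphM /=; ring.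
  set X := \sum_i _; set Y := \sum_i _.
  have -> : c a * al x + be x - (c a * X + Y) - (c a * h + h') =
    c a * (al x - X - h) + (be x - Y - h') by ring.
  by apply: vgeD; [apply: vgeMl; [apply: vge_const|apply: hh]|apply: hh'].
- move=> h; rewrite co0; first by rewrite big1 // => i _; rewrite ffunE mulr0.
    exact: (adele_const S_ff).
  by exists h => x; rewrite subrr; apply: vge0.
- exists D => al ha; rewrite co0; first by rewrite big1 // => i _; rewrite ffunE mulr0.
    exact: adele_le_adele ha.
  by exists 0 => x; rewrite subr0; apply: ha.
Qed.

Section Line.
Variable om : (place S -> S) -> k.
Hypotheses (omW : weil_differential c om) (om_neq0 : exists2 al, adele al & om al != 0).

(** Pairs (z, z') in L(D1 + B) and L(D2 + B) have dimension about 2 deg B, while the forms z om + z'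
    om' all live on H^1 of -B, of dimension about deg B. For large [B] the pigeonhole principle
    gives a nonzero pair whose form is 0. *)
Lemma differentials_line om' : weil_differential c om' ->
  exists z, forall al, adele al -> om' al = om (fun x => z * al x).
Proof.
move=> omW'; have [_ cst [D1 omD1]] := omW; have [_ cst' [D2 omD2]] := omW'.
have [D0 D0P] := adele_exhaust S_ff; have [gam gamP] := riemann_inequality S_ff.
have [x0 _] := exists_place S_ff.
have [l [l' D0E]] := seq_div_diff D0.
pose N := (absz (Deg (seq_div l) - Deg D1 - Deg D2 + gam + gam)%R).+1.
pose B := seq_div (nseq N x0).
have degB : Deg B = N%:Z * (deg x0)%:Z.
  by rewrite div_deg_seq_div big_nseq iter_addn_0 PoszM mulrC.
have [I [b [In bD bsp]]] := adele_span S_ff (- B) (nseq N x0 ++ l).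
have {}In : #|I|%:Z = Deg B + Deg (seq_div l) by rewrite In seq_div_cat div_degD.
have [G [Ginj GP]] := sections_injection (D1 + B).
have [G' [G'inj G'P]] := sections_injection (D2 + B).
pose H (aa : {ffun 'I_(ell c (D1 + B)) -> k} * {ffun 'I_(ell c (D2 + B)) -> k}) : {ffun I -> k} :=
  [ffun i => om (fun x => G aa.1 * b i x) + om' (fun x => G' aa.2 * b i x)].
have /injectivePn[[a a'] [[d d'] ne]] : ~~ injectiveb H.
  apply/negP => /injectiveP/leq_card; rewrite card_prod !card_ffun !card_ord -expnD.
  rewrite leq_exp2l ?finRing_gt1 // -lez_nat In degB PoszD.
  have h1 := gamP (D1 + B); have h2 := gamP (D2 + B).
  rewrite !div_degD degB in h1 h2.
  have dx := place_deg_gt0 S_ff x0.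
  have h3 : N%:Z <= N%:Z * (deg x0)%:Z by nia.
  have h4 : Deg (seq_div l) - Deg D1 - Deg D2 + gam + gam < N%:Z by rewrite /N; lia.
  move: h1 h2 h3 h4; set X := N%:Z * _; set e1 := (ell c _)%:Z; set e2 := (ell c _)%:Z; lia.
move=> /ffunP HH.
pose z := G a - G d; pose z' := G' a' - G' d'.
have zD : sections (D1 + B) z by apply: sectionsB.
have z'D : sections (D2 + B) z' by apply: sectionsB.
have zz0 : z != 0 \/ z' != 0.
  have [z0|] := eqVneq z 0; last by left.
  right; apply: contra_neq ne => z'0.
  by congr (_, _); [apply: Ginj|apply: G'inj]; apply/eqP; rewrite -subr_eq0; apply/eqP.
pose om2 al := om (fun x => z * al x) + om' (fun x => z' * al x).
have om2W : weil_differential c om2 by apply: differential_combine.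
have D0B : - B + seq_div (nseq N x0 ++ l) = seq_div l by rewrite seq_div_cat addrA addNr add0r.
have bA i : adele (b i) by apply: adele_le_adele (bD i).
have split_om (omg : (place S -> S) -> k) (v w : S) al : weil_differential c omg -> adele al ->
    omg (fun x => (v - w) * al x) = omg (fun x => v * al x) - omg (fun x => w * al x).
  move=> gW ha; apply/eqP; rewrite eq_sym subr_eq; apply/eqP.
  rewrite -(differentialD gW); try exact: (adeleMl S_ff).
  by congr omg; apply: funext => x; ring.
have om20 : forall al, adele al -> om2 al = 0.
  apply: (differential_eq0 om2W (D := - B) (b := fun i : 'I_#|I| => b (enum_val i))) => //.
  - move=> i; have := HH (enum_val i); rewrite !ffunE /= /om2 /z /z' !split_om // => /eqP.
    rewrite -subr_eq0 => /eqP e; rewrite -[RHS]e; ring.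
  - move=> al ha; rewrite /om2 omD1 ?omD2 ?addr0 //.
      move=> x; apply: (@vgeW _ _ _ (- coeff x (D2 + B) + - coeff x (- B))).
        by rewrite coeffD coeffN; lia.
      by apply: vgeM; [apply: z'D|apply: ha].
    move=> x; apply: (@vgeW _ _ _ (- coeff x (D1 + B) + - coeff x (- B))).
      by rewrite coeffD coeffN; lia.
    by apply: vgeM; [apply: zD|apply: ha].
  - move=> al /D0P[h hh]; have [|f fP] := bsp (fun x => al x - h).
      by rewrite D0B; apply: adele_leW hh => x; rewrite D0E coeffB !coeff_seq_div; lia.
    exists (fun i => f (enum_val i)), h => x.
    have -> : \sum_(i < #|I|) c (f (enum_val i)) * b (enum_val i) x = \sum_i c (f i) * b i x.
      by rewrite [RHS](reindex (@enum_val I I)) //; apply: onW_bij; apply: enum_val_bij.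
    by rewrite addrAC; apply: fP.
have [z'0|z'0] := eqVneq z' 0.
  case: zz0 => [z0|]; last by rewrite z'0 eqxx.
  case: om_neq0 => al ha; case/eqP.
  have := om20 (fun x => z^-1 * al x) (adeleMl S_ff _ ha); rewrite /om2 z'0.
  have -> : (fun x => 0 * (z^-1 * al x)) = fun=> 0 :> S by apply: funext => x; rewrite mul0r.
  rewrite cst' addr0 => <-; congr om; apply: funext => x; by rewrite mulVKf.
exists (- z / z') => al ha.
have := om20 (fun x => z'^-1 * al x) (adeleMl S_ff _ ha); rewrite /om2 => /eqP.
rewrite addr_eq0 eq_sym => /eqP e.
have -> : om' al = om' (fun x => z' * (z'^-1 * al x)).
  by congr om'; apply: funext => x; rewrite mulVKf.
apply: oppr_inj; rewrite e.
have -> : (fun x => z * (z'^-1 * al x)) = fun x => c (-1) * (- z / z' * al x).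
  by apply: funext => x; rewrite rmorphN rmorph1; ring.
by rewrite (differentialZ omW) ?mulN1r //; apply: (adeleMl S_ff).
Qed.

Variable kappa : divisor S.
Hypothesis om_kappa : forall D, (forall al, adele_le D al -> om al = 0) <-> div_le D kappa.

Lemma differential_div D z : z != 0 -> (forall al, adele_le D al -> om (fun x => z * al x) = 0) ->
  div_le (D - divf z) kappa.
Proof.
move=> z0 H; apply/om_kappa => al ha.
have -> : al = fun x => z * (z^-1 * al x) by apply: funext => x; rewrite mulVKf.
apply: H; have := adele_leM S_ff (h := z^-1) _ ha; rewrite invr_eq0 (divfV S_ff) // opprK subrK.
exact.
Qed.

(** A nonzero class has a nonzero coordinate form, vanishing on [adele_le D]. That form is z om for
    some [z], so D - div(z) is at most kappa; equal degrees force equality. *)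
Lemma nonspecial D : Deg D = Deg kappa -> ~ lin_equiv D kappa ->
  forall al, adele al -> exists h, adele_le D (fun x => al x - h).
Proof.
move=> DegD nD al0 hal0; apply: contrapT => nal0.
have [b [co [hb coP coU co0 coW]]] := dual_basis D.
have [i0 ni0] : exists i, co al0 i != 0.
  apply: contrapT => ni; apply: nal0; have [h hh] := coP _ hal0; exists h => x.
  have := hh x; rewrite big1 ?subr0 // => i _.
  have -> : co al0 i = 0 by apply: contrapT => /eqP ci; apply: ni; exists i.
  by rewrite rmorph0 mul0r.
pose om' al := \sum_i (i == i0)%:R * co al i.
have om'E al : om' al = co al i0.
  rewrite /om' (bigD1 i0) //= eqxx mul1r big1 ?addr0 // => i /negPf->.
  by rewrite mul0r.
have om'0 al : adele_le D al -> om' al = 0.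
  move=> ha; rewrite om'E co0 ?ffunE //; first exact: adele_le_adele ha.
  by exists 0 => x; rewrite subr0; apply: ha.
have [z zP] := differentials_line (coW _ : weil_differential c om').
have z0 : z != 0.
  apply: contra_neq ni0 => z0; have := zP _ hal0; rewrite om'E => ->.
  have -> : (fun x => z * al0 x) = fun=> 0 by apply: funext => x; rewrite z0 mul0r.
  exact: differential0.
have le : div_le (D - divf z) kappa.
  apply: differential_div => // al ha; rewrite -zP; last exact: adele_le_adele ha.
  exact: om'0.
apply: nD; exists z; rewrite -(div_le_eq le); last first.
  by rewrite div_degB (div_deg_divf S_ff) // subr0.
by rewrite opprB addrC subrK; apply: (is_div_divf S_ff).
Qed.

(** Pairing [z] with a basis of H^1(X, O) by om(z b_i) identifies L(kappa) with the dual space: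
    injectively because [om] is nonzero, surjectively by [differentials_line]. *)
Lemma ell_canonical : ell c kappa = genus c.
Proof.
have [b [co [hb coP coU co0 coW]]] := dual_basis 0; rewrite -/(genus c) in b co hb coP coU co0 coW.
have om_zero z al : sections kappa z -> adele_le 0 al -> om (fun x => z * al x) = 0.
  have [->|z0] := eqVneq z 0.
    have -> : (fun x => 0 * al x) = fun=> 0 by apply: funext => x; rewrite mul0r.
    by move=> _ _; apply: differential0.
  move=> hz /(adele_leM S_ff z0); rewrite sub0r; apply: ((om_kappa (- divf z)).2 _) => x.
  by have := hz x; rewrite /stalk /= vgeE // coeffN (coeff_divf S_ff) //; lia.
pose G (z : S) : {ffun 'I_(genus c) -> k} := [ffun i => om (fun x => z * b i x)].
have fin := finite_sections S_ff kappa.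
have cardE : (#|k| ^ genus c = #|{: {ffun 'I_(genus c) -> k}}|)%N by rewrite card_ffun card_ord.
apply/eqP; rewrite eqn_leq; apply/andP.
split; rewrite -(leq_exp2l _ _ (finRing_gt1 k)) -(cardL_ell S_ff) cardE.
  apply: (fset_set_le_card fin (G := G)) => v w hv hw /ffunP e.
  apply: contrapT => /eqP; rewrite -subr_eq0 => vw0.
  have hvw : sections kappa (v - w) by apply: sectionsB.
  pose om2 al := om (fun x => (v - w) * al x) + om (fun x => 0 * al x).
  have om2W : weil_differential c om2 by apply: differential_combine.
  have om2E al : om2 al = om (fun x => (v - w) * al x).
    rewrite /om2; have -> : (fun x => 0 * al x) = fun=> 0 by apply: funext => x; rewrite mul0r.
    by rewrite (differential0 omW) addr0.
  have om20 : forall al, adele al -> om2 al = 0.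
    apply: (differential_eq0 om2W (D := 0) hb).
    - move=> i; rewrite om2E; have := e i; rewrite !ffunE => /eqP; rewrite -subr_eq0 => /eqP e'.
      rewrite -[RHS]e'; apply/eqP; rewrite eq_sym subr_eq; apply/eqP.
      rewrite -(differentialD omW); try exact: (adeleMl S_ff).
      by congr om; apply: funext => x; ring.
    - by move=> al ha; rewrite om2E om_zero.
    - by move=> al ha; exists (co al); apply: coP.
  case: om_neq0 => al ha; case/eqP.
  have := om20 (fun x => (v - w)^-1 * al x) (adeleMl S_ff _ ha); rewrite om2E.
  by move=> <-; congr om; apply: funext => x; rewrite mulVKf.
suff /choice[Z ZP] (r : {ffun 'I_(genus c) -> k}) : exists z, sections kappa z /\ G z = r.
  apply: (card_le_fset_set fin (G := Z)) => [r r' e|r]; last by have [] := ZP r.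
  by have [_ <-] := ZP r; have [_ <-] := ZP r'; rewrite e.
have [z zP] := differentials_line (coW r); exists z; split.
  have [->|z0] := eqVneq z 0; first exact: sections0.
  apply/(sectionsP _ z0) => x.
  have /(_ x) : div_le (0 - divf z) kappa.
    apply: differential_div => // al ha; rewrite -zP; last exact: adele_le_adele ha.
    rewrite big1 // => i _; rewrite co0 ?ffunE ?mulr0 //; first exact: adele_le_adele ha.
    by exists 0 => y; rewrite subr0; apply: ha.
  by rewrite coeffB coeff0 (coeff_divf S_ff) //; lia.
apply/ffunP => i; rewrite ffunE -zP //.
have -> : co (b i) = [ffun j => (j == i)%:R].
  apply: coU => //; exists 0 => x; rewrite subr0 (bigD1 i) //= big1 ?addr0 => [|j /negPf ne].
    by rewrite ffunE eqxx rmorph1 mul1r subrr; apply: vge0.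
  by rewrite ffunE ne rmorph0 mul0r.
rewrite (bigD1 i) //= ffunE eqxx mulr1 big1 ?addr0 // => j /negPf ne.
by rewrite ffunE ne mulr0.
Qed.

End Line.
End WeilDifferentials.

Section FiniteEffective.
Variables (k : finFieldType) (S : fieldType) (c : {rmorphism k -> S}).
Hypothesis S_ff : function_field c.
Local Notation deg := (place_deg c).

(** The polynomials of degree at most [n] outnumber the residues at [x]. So [x] is a zero of one of
    finitely many nonzero polynomials in [t], unless it is a pole of [t]. *)
Lemma finite_places_of_degree n : finite_set [set x : place S | (deg x <= n)%N].
Proof.
have [t [m [t_tr t_sp]]] := function_field_spanned S_ff.
have t0 : t != 0 by have := t_tr 'X; rewrite evX polyX_eq0; apply.
pose Z (a : 'rV[k]_n.+1) : set (place S) :=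
  [set x | a != 0 /\ x (ev c t (rVpoly a)) != 0].
apply: (@sub_finite_set _ _ (\bigcup_(a in [set: 'rV[k]_n.+1]) Z a `|` [set x | x t != 0])); last first.
  rewrite finite_setU; split; last exact: (finite_dval_support S_ff).
  apply: bigcup_finite; first exact: finite_finset.
  move=> a _; have [->|a0] := eqVneq a 0.
    by apply: (@sub_finite_set _ _ set0) => // x [/eqP].
  apply: (sub_finite_set _ (finite_dval_support S_ff (_ : ev c t (rVpoly a) != 0))) => [x []//|].
  apply: t_tr; apply: contra_neq a0 => /(congr1 (@poly_rV k n.+1)).
  by rewrite rVpolyK linear0.
move=> x /= dx; have [xt|xt] := leP 0 (x t); last by right => /=; lia.
left; have pint (a : 'rV[k]_n.+1) : vge x (ev c t (rVpoly a)) 0.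
  by apply: (subring_set_ev (integers_subring x)); [apply: vge_const|right].
pose G (a : 'rV[k]_n.+1) := res S_ff x (ev c t (rVpoly a)).
have /injectivePn[a [b ab e]] : ~~ injectiveb G.
  apply/negP => /injectiveP/leq_card; rewrite card_residues card_mx mul1n.
  by rewrite leq_exp2l ?finRing_gt1 // ltnNge dx.
exists (a - b) => //; split; first by rewrite subr_eq0.
have : vge x (ev c t (rVpoly (a - b))) 1.
  rewrite linearB evB; exact: ((res_eqP S_ff (pint a) (pint b)).1 e).
rewrite vgeE; first by move=> h; rewrite gt_eqF // (lt_le_trans _ h).
apply: t_tr; apply: contra_neq ab => /(congr1 (@poly_rV k n.+1)).
by rewrite rVpolyK linear0 => /eqP; rewrite subr_eq0 => /eqP.
Qed.

Lemma finite_effective (n : nat) : finite_set [set D : divisor S | effective D /\ div_deg c D = n%:Z].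
Proof.
have /finite_seqP[P PE] := finite_places_of_degree n.
have PP x : (deg x <= n)%N -> x \in P by move=> dx; have : [set x : place S | (deg x <= n)%N] x by []; rewrite PE.
pose G (a : {ffun 'I_(size P) -> 'I_n.+1}) : divisor S :=
  seq_div (flatten [seq nseq (a i) (tnth (in_tuple P) i) | i <- enum 'I_(size P)]).
apply: (@sub_finite_set _ _ (range G)); last exact/finite_image/finite_finset.
move=> D [/effective_seq_div[s ->]]; rewrite div_deg_seq_div => -[ds].
have size_le : (size s <= n)%N.
  rewrite -ds -sum1_size; apply: leq_sum => x _; exact: (place_deg_gt0 S_ff).
have sP x : x \in s -> x \in undup P.
  move=> xs; rewrite mem_undup; apply: PP; rewrite -ds (big_rem x) //=; exact: leq_addr.
(* [P] may have repetitions: only the first occurrence of a place carries its multiplicity, the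
   others get 0. *)
exists [ffun i : 'I_(size P) => if (index (tnth (in_tuple P) i) P == i)%N then inord (count_mem (tnth (in_tuple P) i) s) else ord0] => //.
apply: freeg_coeffP => x; rewrite !coeff_seq_div; congr Posz.
rewrite count_flatten -map_comp sumnE big_map.
have [xP|xP] := boolP (x \in P); last first.
  rewrite big1_seq => [|i _].
    by apply/esym/eqP; rewrite -leqn0 leqNgt -has_count has_pred1; apply: contra xP => /sP; rewrite mem_undup.
  rewrite /= count_nseq /=; case: eqP => [e|]; last by rewrite mul0n.
  by case/negP: xP; rewrite -e mem_tnth.
have lt : (index x P < size P)%N by rewrite index_mem.
rewrite (bigD1_seq (Ordinal lt)) ?enum_uniq ?mem_enum //= big1 => [|i /negPf ne].
  rewrite count_nseq /= ffunE (tnth_nth x) /= nth_index // eqxx mul1n addn0 eqxx.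
  by rewrite inordK // ltnS (leq_trans (count_size _ _)).
rewrite count_nseq /= ffunE; case: eqP => [e|]; last by rewrite mul0n.
rewrite e; case: eqP => [ei|]; last by rewrite muln0.
by move/eqP: ne; case; apply: val_inj.
Qed.
End FiniteEffective.

Lemma prod_fset_set_bij (T U : choiceType) (R : comPzRingType) (A : set T) (B : set U) (P : pred T) (Q : pred U)
  (f : T -> U) (g : U -> T) (G : U -> R) : finite_set A -> finite_set B ->
  (forall v, A v -> P v -> [/\ B (f v), Q (f v) & g (f v) = v]) ->
  (forall w, B w -> Q w -> [/\ A (g w), P (g w) & f (g w) = w]) ->
  \prod_(w <- fset_set B | Q w) G w = \prod_(v <- fset_set A | P v) G (f v).
Proof.
move=> fA fB AB BA; rewrite -big_filter -[RHS]big_filter -[RHS](big_map f xpredT G).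
apply: perm_big; apply: uniq_perm; first by rewrite filter_uniq ?fset_uniq.
  rewrite map_inj_in_uniq ?filter_uniq ?fset_uniq // => v w.
  rewrite !mem_filter !in_fset_set // => /andP[Pv /set_mem Av] /andP[Pw /set_mem Aw] e.
  by have [_ _ <-] := AB v Av Pv; have [_ _ <-] := AB w Aw Pw; rewrite e.
move=> w; rewrite mem_filter in_fset_set //; apply/andP/mapP => [[Qw /set_mem Bw]|[v]].
  by have [h1 h2 h3] := BA w Bw Qw; exists (g w) => //; rewrite mem_filter h2 in_fset_set //; apply: mem_set.
rewrite mem_filter in_fset_set // => /andP[Pv /set_mem Av] ->.
by have [h1 h2 _] := AB v Av Pv; split=> //; apply: mem_set.
Qed.

Lemma prod_fset_setU (T : choiceType) (R : comPzRingType) (A B C : set T) (P : pred T) (G : T -> R) :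
  finite_set A -> (forall v, A v <-> B v \/ C v) -> (forall v, B v -> ~ C v) ->
  \prod_(v <- fset_set A | P v) G v = (\prod_(v <- fset_set B | P v) G v) * \prod_(v <- fset_set C | P v) G v.
Proof.
move=> fA ABC BC.
have fB : finite_set B by apply: (sub_finite_set _ fA) => v Bv; apply/ABC; left.
have fC : finite_set C by apply: (sub_finite_set _ fA) => v Cv; apply/ABC; right.
rewrite -big_cat; apply: perm_big; apply: uniq_perm; rewrite ?fset_uniq //.
  rewrite cat_uniq !fset_uniq /= andbT; apply/hasPn => v; rewrite !in_fset_set // => /set_mem Cv.
  by apply/negP => /set_mem /BC.
move=> v; rewrite mem_cat !in_fset_set //; apply/idP/orP => [/set_mem/ABC[?|?]|[/set_mem?|/set_mem?]].
- by left; apply: mem_set.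
- by right; apply: mem_set.
- by apply/mem_set/ABC; left.
- by apply/mem_set/ABC; right.
Qed.

(** * Weil reciprocity *)

Section ScalarOrbits.
Variables (k : finFieldType) (S : fieldType) (c : {rmorphism k -> S}).
Implicit Types (v w : S) (Z : set S) (r : S -> k).

Definition stable Z := forall a v, a != 0 -> Z v -> Z (c a * v).
(** A weight selects in each scalar orbit the one vector on which it is 1; products over orbits are
    taken along such a choice. *)
Definition weight_on Z r := forall v, Z v -> r v != 0 /\ forall a, a != 0 -> r (c a * v) = a * r v.
Definition invariant_on Z r := forall v, Z v -> forall a, a != 0 -> r (c a * v) = r v.

(* A system of representatives of the k^*-orbits of [S], in the form of its
   coordinate: [v = c (wt v) * w] with [w] the representative of the orbit of [v]. *)
Definition orbit_rep v : S := choose (fun w => [exists a : k, (a != 0) && (w == c a * v)]) v.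
Definition wt v : k := if [pick a : k | v == c a * orbit_rep v] is Some a then a else 0.

Lemma orbit_repP v : exists a : k, a != 0 /\ orbit_rep v = c a * v.
Proof.
have : [exists a : k, (a != 0) && (orbit_rep v == c a * v)].
  apply: (@chooseP _ (fun w => [exists a : k, (a != 0) && (w == c a * v)]) v).
  by apply/existsP; exists 1; rewrite oner_neq0 rmorph1 mul1r eqxx.
by move/existsP => [a /andP[a0 /eqP e]]; exists a.
Qed.

Lemma orbit_rep_scale a v : a != 0 -> orbit_rep (c a * v) = orbit_rep v.
Proof.
move=> a0; have ca0 : c a != 0 by rewrite fmorph_eq0.
rewrite /orbit_rep (eq_choose (Q := fun w => [exists a : k, (a != 0) && (w == c a * v)])); last first.
  move=> w; apply/existsP/existsP => -[b /andP[b0 /eqP e]].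
    by exists (b * a); rewrite mulf_neq0 // rmorphM -mulrA e eqxx.
  by exists (b / a); rewrite mulf_neq0 ?invr_eq0 // rmorphM fmorphV -mulrA mulKf // e eqxx.
apply: choose_id; apply/existsP.
  by exists a; rewrite a0 eqxx.
by exists 1; rewrite oner_neq0 rmorph1 mul1r eqxx.
Qed.

Lemma wtE v : v = c (wt v) * orbit_rep v.
Proof.
rewrite /wt; case: pickP => [a /eqP //|/= no].
have [a [a0 e]] := orbit_repP v; have := no a^-1.
by rewrite e fmorphV mulKf ?fmorph_eq0 // eqxx.
Qed.

Lemma wt_weight Z : ~ Z 0 -> weight_on Z wt.
Proof.
move=> Z0 v Zv; have v0 : v != 0 by apply/eqP => v0; apply: Z0; rewrite -v0.
have rv0 : orbit_rep v != 0.
  by apply: contra_neq v0 => r0; rewrite (wtE v) r0 mulr0.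
split; first by apply: contra_neq v0 => w0; rewrite (wtE v) w0 rmorph0 mul0r.
move=> a a0; apply: (fmorph_inj c); apply: (mulIf rv0).
by rewrite -{1}(orbit_rep_scale v a0) -wtE rmorphM -mulrA -wtE.
Qed.

Lemma wt_scale a v : a != 0 -> v != 0 -> wt (c a * v) = a * wt v.
Proof.
move=> a0 v0; have [_ h] : wt v != 0 /\ forall a, a != 0 -> wt (c a * v) = a * wt v.
  by apply: (@wt_weight [set v | v != 0]) => //=; rewrite eqxx.
exact: h.
Qed.

Lemma wt_neq0 v : v != 0 -> wt v != 0.
Proof.
move=> v0; have [h _] : wt v != 0 /\ forall a, a != 0 -> wt (c a * v) = a * wt v.
  by apply: (@wt_weight [set v | v != 0]) => //=; rewrite eqxx.
exact: h.
Qed.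

(** Both choices of representatives meet each orbit once, and [G] is constant on orbits. *)
Lemma orbit_prod_indep Z r r' G : finite_set Z -> stable Z -> weight_on Z r -> weight_on Z r' ->
  invariant_on Z G ->
  \prod_(v <- fset_set Z | r v == 1) G v = \prod_(v <- fset_set Z | r' v == 1) G v.
Proof.
move=> fZ sZ wr wr' iG.
rewrite (prod_fset_set_bij (f := fun v => c (r v)^-1 * v) (g := fun v => c (r' v)^-1 * v) (A := Z) (P := fun v => r' v == 1)) //.
- rewrite big_seq_cond [RHS]big_seq_cond; apply: eq_bigr => v.
  rewrite in_fset_set // => /andP[/set_mem Zv _]; apply: iG => //.
  by rewrite invr_eq0; have [] := wr v Zv.
- move=> v Zv /eqP r'v; have [rv0 rE] := wr v Zv; have [r'v0 r'E] := wr' v Zv.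
  have rV0 : (r v)^-1 != 0 by rewrite invr_eq0.
  split; [exact: sZ|by rewrite rE // mulVf|].
  by rewrite r'E // r'v mulr1 invrK fmorphV mulVKf // fmorph_eq0.
- move=> v Zv /eqP rv; have [rv0 rE] := wr v Zv; have [r'v0 r'E] := wr' v Zv.
  have rV0 : (r' v)^-1 != 0 by rewrite invr_eq0.
  split; [exact: sZ|by rewrite r'E // mulVf|].
  by rewrite rE // rv mulr1 invrK fmorphV mulVKf // fmorph_eq0.
Qed.

Definition orbit_prod Z (G : S -> k) : k := \prod_(v <- fset_set Z | wt v == 1) G v.

Lemma eq_orbit_prod Z G G' : finite_set Z -> (forall v, Z v -> G v = G' v) -> orbit_prod Z G = orbit_prod Z G'.
Proof.
move=> fZ e; rewrite /orbit_prod big_seq_cond [RHS]big_seq_cond; apply: eq_bigr => v.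
by rewrite in_fset_set // => /andP[/set_mem Zv _]; apply: e.
Qed.

Lemma orbit_prod_neq0 Z G : finite_set Z -> (forall v, Z v -> G v != 0) -> orbit_prod Z G != 0.
Proof.
move=> fZ e; rewrite /orbit_prod prodf_seq_neq0; apply/allP => v.
by rewrite in_fset_set // => /set_mem Zv; rewrite e ?implybT.
Qed.

Lemma orbit_prod_mul Z G G' : orbit_prod Z G * orbit_prod Z G' = orbit_prod Z (fun v => G v * G' v).
Proof. by rewrite /orbit_prod big_split. Qed.

Lemma orbit_prod_shift Z h G : finite_set Z -> stable Z -> ~ Z 0 -> h != 0 ->
  (forall v, Z v -> forall a, a != 0 -> G (c a * (h * v)) = G (h * v)) ->
  orbit_prod [set w | Z (h^-1 * w)] G = orbit_prod Z (fun v => G (h * v)).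
Proof.
move=> fZ sZ Z0 h0 iG; rewrite /orbit_prod.
have fZ' : finite_set [set w | Z (h^-1 * w)].
  apply: (sub_finite_set _ (finite_image (fun v => h * v) fZ)) => w Zw.
  by exists (h^-1 * w) => //; rewrite mulVKf.
rewrite (prod_fset_set_bij (f := fun v => h * v) (g := fun w => h^-1 * w) (A := Z) (P := fun v => wt (h * v) == 1)) //.
- apply: orbit_prod_indep => //; last first.
    by move=> v Zv a a0; rewrite mulrCA iG.
    exact: wt_weight.
  move=> v Zv; have v0 : v != 0 by apply/eqP => v0; apply: Z0; rewrite -v0.
  split; first by rewrite wt_neq0 // mulf_neq0.
  by move=> a a0; rewrite mulrCA wt_scale // mulf_neq0.
- by move=> v Zv w1; rewrite /= mulKf.
- by move=> w Zw w1; rewrite /= mulVKf.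
Qed.

End ScalarOrbits.

Lemma vge_prodB (F : fieldType) (v : dvaluation F) (I : Type) (r : seq I) (P : pred I) (G H : I -> F) :
  (forall i, P i -> vge v (G i) 0) -> (forall i, P i -> vge v (H i) 0) ->
  (forall i, P i -> vge v (G i - H i) 1) ->
  vge v (\prod_(i <- r | P i) G i - \prod_(i <- r | P i) H i) 1.
Proof.
move=> hG hH GH.
suff [] : vge v (\prod_(i <- r | P i) G i - \prod_(i <- r | P i) H i) 1 /\
    vge v (\prod_(i <- r | P i) H i) 0 by [].
elim/big_rec2: _ => [|i a b Pi [h1 h2]]; first by rewrite subrr; split; [apply: vge0|apply: vge1].
split; first by apply: vge_mulB => //; [apply: hG|apply: GH].
by apply: vgeMl => //; apply: hH.
Qed.

(** * Tame symbols by orbit products *)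

Section TameSymbol.
Variables (k : finFieldType) (S : fieldType) (c : {rmorphism k -> S}).
Hypothesis S_ff : function_field c.
Implicit Types (D N : divisor S) (x y : place S) (f h v w : S).
Local Notation deg := (place_deg c).
Local Notation Deg := (div_deg c).
Local Notation q := #|k|.
Local Notation rep := (rep S_ff).
Local Notation res := (res S_ff).
Local Notation wt := (wt c).
Local Notation res0 := (res0 c).

Definition unit_part x f := f * unif x ^ (- x f).

Lemma unit_partP x f : f != 0 -> unit_part x f != 0 /\ x (unit_part x f) = 0.
Proof.
move=> f0; have p0 := unif_neq0 x.
split; first by rewrite mulf_neq0 ?expfz_neq0.
by rewrite dvalM ?expfz_neq0 // dval_unifX subrr.
Qed.

Lemma unit_part_int x f : f != 0 -> vge x (unit_part x f) 0.
Proof. by move=> /(unit_partP x)[_ e]; right; rewrite e. Qed.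

Lemma unit_partM x f h : f != 0 -> h != 0 -> unit_part x (f * h) = unit_part x f * unit_part x h.
Proof.
move=> f0 h0; rewrite /unit_part dvalM // opprD expfzDr ?unif_neq0 //; ring.
Qed.

Lemma rep_neq0 x (r : residues c x) : r != res0 x -> rep r != 0.
Proof. by rewrite rep_eq0. Qed.

Lemma orbit_count x (a : k) : a != 0 ->
  #|[pred r : residues c x | (r != res0 x) && (wt (rep r) == a)]| =
  #|[pred r : residues c x | (r != res0 x) && (wt (rep r) == 1)]|.
Proof.
move=> a0; rewrite -[RHS](card_imset _ (f := rscale (x := x) a)) => [|r r' e]; last first.
  have := congr1 (fun r : residues c x => rep r) e; rewrite !rep_scale => /mulfI e'.
  by rewrite -(repK S_ff r) e' ?repK // fmorph_eq0.
apply: eq_card => r; rewrite inE; apply/andP/imsetP => [[r0 /eqP w]|[r' + ->]].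
  exists (rscale a^-1 r).
    rewrite inE rep_scale wt_scale ?invr_eq0 ?rep_neq0 // w mulVf // eqxx andbT.
    by rewrite -(rep_eq0 S_ff) rep_scale mulf_neq0 ?rep_neq0 // fmorph_eq0 invr_eq0.
  by apply/ffunP => i; rewrite !ffunE mulVKf.
rewrite inE => /andP[r0 /eqP w]; rewrite rep_scale wt_scale ?rep_neq0 // w mulr1.
by rewrite -(rep_eq0 S_ff) rep_scale mulf_neq0 ?rep_neq0 // fmorph_eq0.
Qed.

Definition norbits x := #|[pred r : residues c x | (r != res0 x) && (wt (rep r) == 1)]|.

Lemma norbitsE x : (norbits x * q.-1 = (q ^ deg x).-1)%N.
Proof.
rewrite -card_residues -(cardC1 (res0 x)) -[in RHS]sum1_card.
rewrite (partition_big (fun r : residues c x => wt (rep r)) (fun a => a != 0)) /=; last first.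
  by move=> r; rewrite !inE => r0; apply: wt_neq0; apply: rep_neq0.
rewrite mulnC -(cardC1 (0 : k)) -sum_nat_const; apply: eq_bigr => a; rewrite !inE => a0.
by rewrite /norbits -(orbit_count _ a0) -sum1_card; apply: eq_bigl => r; rewrite !inE.
Qed.

(* This is -1, but only its square matters. *)
Definition wilson : k := \prod_(a : k | a != 0) a.

Lemma wilson_sqr : wilson * wilson = 1.
Proof.
have e : wilson = \prod_(a : k | a != 0) a^-1.
  by rewrite /wilson (reindex_inj (inv_inj (@invrK k))); apply: eq_bigl => a; rewrite invr_eq0.
rewrite {2}e -big_split /=; apply: big1 => a a0; exact: divff.
Qed.

Lemma expf_card_pow (a : k) j : a ^+ (q ^ j) = a.
Proof. by elim: j => [|j IH]; rewrite ?expr1 // expnS exprM expf_card. Qed.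

(** The number of orbits is 1 + q + ... + q^(deg x - 1), and raising to a power of q is the identity
    on k. *)
Lemma wilson_norbits x : wilson ^+ norbits x = wilson ^+ deg x.
Proof.
have q1 : (0 < q.-1)%N by rewrite -ltnS (ltn_predK (finRing_gt1 k)) finRing_gt1.
have -> : norbits x = (\sum_(i < deg x) q ^ i)%N.
  by apply/eqP; rewrite -(eqn_pmul2r q1) norbitsE predn_exp mulnC.
rewrite expr_sum; under eq_bigr do rewrite expf_card_pow.
by rewrite prodr_const card_ord.
Qed.

Lemma prod_wt_rep x : \prod_(r : residues c x | r != res0 x) wt (rep r) = wilson ^+ deg x.
Proof.
rewrite (partition_big (fun r : residues c x => wt (rep r)) (fun a => a != 0)) /=; last first.
  by move=> r r0; apply: wt_neq0; apply: rep_neq0.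
rewrite -wilson_norbits /wilson -prodrXl; apply: eq_bigr => a a0.
rewrite (eq_bigr (fun=> a)) => [|r /andP[_ /eqP] //].
by rewrite prodr_const /norbits -(orbit_count _ a0); congr (_ ^+ _); apply: eq_card => r; rewrite !inE.
Qed.

(* The tame symbol up to sign: the norm to [k] of the residue of the unit part of [f], by Gauss's lemma. *)
Definition tame x f : k :=
  \prod_(r : residues c x | (r != res0 x) && (wt (rep r) == 1)) wt (rep (res x (unit_part x f * rep r))).

Lemma res_unit_mul x u (r : residues c x) : u != 0 -> x u = 0 -> r != res0 x ->
  res x (u * rep r) != res0 x.
Proof.
move=> u0 xu r0; apply: res_neq0; first by rewrite mulf_neq0 ?rep_neq0.
by rewrite dvalM ?rep_neq0 // xu dval_rep.
Qed.

Lemma tame_neq0 x f : f != 0 -> tame x f != 0.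
Proof.
move=> /(unit_partP x)[u0 xu]; apply/prodf_neq0 => r /andP[r0 _].
by apply: wt_neq0; apply: rep_neq0; apply: res_unit_mul.
Qed.

(** Multiplication by the unit part permutes the scalar orbits of nonzero residues. Comparing the
    product of the representatives with that of their images leaves the scalars collected in [tame]
    on one side, and one unit part per orbit on the other. *)
Lemma tame_residue x f : f != 0 -> vge x (c (tame x f) - unit_part x f ^+ norbits x) 1.
Proof.
move=> f0; have [u0 xu] := unit_partP x f0; set u := unit_part x f in u0 xu *.
have ui : vge x u 0 by right; rewrite xu.
pose A : {set residues c x} := finset (fun r => (r != res0 x) && (wt (rep r) == 1)).
have AE r : (r \in A) = (r != res0 x) && (wt (rep r) == 1) by rewrite finset.in_set.
pose g (r : residues c x) := res x (u * rep r).
pose e (r : residues c x) := rscale (wt (rep (g r)))^-1 (g r).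
have gE r : r \in A -> g r != res0 x by rewrite AE => /andP[r0 _]; apply: res_unit_mul.
have wg r : r \in A -> wt (rep (g r)) != 0 by move=> /gE gr; apply: wt_neq0; apply: rep_neq0.
have gnear (r : residues c x) : vge x (u * rep r - rep (g r)) 1.
  by apply: res_rep_near; apply: vgeMl => //; apply: rep_int.
have eA r : r \in A -> e r \in A.
  move=> rA; have w0 := wg r rA; rewrite AE /e.
  rewrite -(rep_eq0 S_ff) rep_scale mulf_neq0 ?rep_neq0 ?gE // ?fmorph_eq0 ?invr_eq0 //=.
  by rewrite wt_scale ?invr_eq0 ?rep_neq0 ?gE // mulVf.
have einj : {in A &, injective e}.
  move=> r r' rA r'A ee; have w0 := wg r rA; have w0' := wg r' r'A.
  pose a := wt (rep (g r)) / wt (rep (g r')).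
  have a0 : a != 0 by rewrite mulf_neq0 ?invr_eq0.
  have gg : g r = rscale a (g r').
    by apply/ffunP => i; move/ffunP/(_ i): ee; rewrite !ffunE => /(canRL (mulVKf w0)) ->; rewrite mulrA.
  have rr : r = rscale a r'.
    rewrite -(repK S_ff r) -(repK S_ff (rscale a r')); apply/res_eqP; try exact: rep_int.
    rewrite rep_scale.
    have -> : rep r - c a * rep r' = u^-1 * (u * rep r - c a * (u * rep r')).
      by field.
    apply: vgeMl; first by right; rewrite dvalV xu.
    have -> : u * rep r - c a * (u * rep r') = (u * rep r - rep (g r)) - c a * (u * rep r' - rep (g r')).
      by rewrite gg rep_scale; ring.
    by apply: vgeB => //; apply: vgeMl => //; apply: vge_const.
  move: rA r'A; rewrite !AE => /andP[r0 /eqP w1] /andP[r'0 /eqP w1'].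
  have a1 : a = 1 by move: w1; rewrite rr rep_scale wt_scale ?rep_neq0 // w1' mulr1.
  by rewrite rr a1; apply/ffunP => i; rewrite ffunE mul1r.
have eim : e @: A = A.
  apply/eqP; rewrite eqEcard card_in_imset // leqnn andbT.
  by apply/fintype.subsetP => _ /imsetP[r rA ->]; apply: eA.
pose P := \prod_(r in A) rep r.
have [P0 xP] : P != 0 /\ x P = 0.
  by apply: dval_prod => r; rewrite AE => /andP[r0 _]; rewrite rep_neq0 // dval_rep.
have tE : c (tame x f) * P = \prod_(r in A) rep (g r).
  rewrite /P -{1}eim big_imset //= /tame rmorph_prod.
  rewrite (eq_bigl (fun r => r \in A)) => [|r]; last by rewrite AE.
  rewrite -big_split /=; apply: eq_bigr => r rA.
  by rewrite rep_scale fmorphV mulVKf // fmorph_eq0 wg.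
have uE : u ^+ norbits x * P = \prod_(r in A) (u * rep r).
  rewrite big_split /= prodr_const; congr (_ ^+ _ * _).
  by apply: eq_card => r; rewrite inE AE.
have -> : c (tame x f) - u ^+ norbits x = P^-1 * (c (tame x f) * P - u ^+ norbits x * P)
  by rewrite -mulrBl mulrC mulfK.
apply: vgeMl; first by right; rewrite dvalV xP.
rewrite tE uE; apply: vge_prodB => r rA; first exact: rep_int.
  by apply: vgeMl => //; apply: rep_int.
exact: vgeBC.
Qed.

End TameSymbol.

(** * Transfer of orbit products through the layers of L(D) *)

Section Reciprocity.
Variables (k : finFieldType) (S : fieldType) (c : {rmorphism k -> S}).
Hypothesis S_ff : function_field c.
Implicit Types (D N : divisor S) (x y : place S) (f h v w : S).
Local Notation deg := (place_deg c).
Local Notation Deg := (div_deg c).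
Local Notation q := #|k|.
Local Notation rep := (rep S_ff).
Local Notation res := (res S_ff).
Local Notation wt := (wt c).
Local Notation res0 := (res0 c).
Local Notation orbit_prod := (orbit_prod c).
Local Notation lead_part := (lead_part S_ff).
Local Notation tame := (tame S_ff).

Lemma coeff_seq_div_uniq D (zs : seq (place S)) x : uniq zs ->
  coeff x (D - seq_div zs) = coeff x D - (x \in zs)%:Z.
Proof. by move=> uz; rewrite coeffB coeff_seq_div count_uniq_mem. Qed.

(** Vanishing of H^1 below [D] approximates by a function the repartition equal to [al] on [zs] and
    to 0 elsewhere. *)
Lemma local_section D (zs : seq (place S)) (al : place S -> S) : uniq zs ->
  (forall be, adele be -> exists h, adele_le (D - seq_div zs) (fun x => be x - h)) ->
  (forall x, x \in zs -> vge x (al x) (- coeff x D)) ->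
  exists v, sections D v /\ forall x, x \in zs -> vge x (v - al x) (1 - coeff x D).
Proof.
move=> uz van hal; pose be x := if x \in zs then al x else 0.
have [|h hh] := van be.
  rewrite adeleE; apply: (@sub_finite_set _ _ [set` zs]); last exact: finite_seq.
  move=> x /=; rewrite /be; case: ifP => // _ []; exact: vge0.
exists h; split=> x.
  have := hh x; rewrite (coeff_seq_div_uniq _ _ uz) /be; case: ifP => [xz hx|_]; last by rewrite sub0r subr0 => /vgeN; rewrite opprK.
  have -> : h = al x - (al x - h) by rewrite opprB addrC subrK.
  by apply: vgeB; [apply: hal|apply: vgeW hx; lia].
move=> xz; have := hh x; rewrite (coeff_seq_div_uniq _ _ uz) /be xz => /vgeBC.
by apply: vgeW; lia.
Qed.

Definition nonzero_sections D : set S := [set v | sections D v /\ v != 0].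
Definition layer D x : set S := [set v | sections D v /\ ~ sections (D - << x >>) v].

Lemma layerP D x v : layer D x v <-> [/\ sections D v, v != 0 & x v = - coeff x D].
Proof.
split=> [[hv nv]|[hv v0 xv]].
  have v0 : v != 0 by apply/eqP => v0; apply: nv; rewrite v0; apply: sections0.
  split=> //; apply/eqP; rewrite eq_le; apply/andP; split; last first.
    by have := hv x; rewrite /stalk /= vgeE.
  rewrite leNgt; apply/negP => lt; apply: nv; rewrite -[v]subr0.
  apply/(lead_part_eq S_ff x hv (sections0 D)); rewrite /lead_part mul0r.
  apply/(res_eqP S_ff); [exact: lead_part_int|exact: vge0|].
  by rewrite subr0; apply/vge_unifX; right; lia.
split=> // /(_ x); rewrite /stalk /= dU_subE eqxx vgeE // xv; lia.
Qed.

Lemma layer_neq0 D x v : layer D x v -> v != 0. Proof. by case/layerP. Qed.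

Lemma finite_nonzero D : finite_set (nonzero_sections D).
Proof. by apply: (sub_finite_set _ (finite_sections S_ff D)) => v []. Qed.

Lemma finite_layer D x : finite_set (layer D x).
Proof. by apply: (sub_finite_set _ (finite_sections S_ff D)) => v []. Qed.

Lemma sections_scaleE D a v : a != 0 -> sections D (c a * v) <-> sections D v.
Proof.
move=> a0; split; last exact: sections_scale.
by move/(sections_scale c a^-1); rewrite fmorphV mulKf // fmorph_eq0.
Qed.

Lemma stable_nonzero D : stable c (nonzero_sections D).
Proof.
move=> a v a0 [hv v0]; split; first exact: sections_scale.
by rewrite mulf_neq0 // fmorph_eq0.
Qed.

Lemma stable_layer D x : stable c (layer D x).
Proof.
by move=> a v a0 [hv nv]; split; [apply: sections_scale|move/(sections_scaleE _ _ a0)].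
Qed.

Lemma nonzero0 D : ~ nonzero_sections D 0. Proof. by case; rewrite eqxx. Qed.
Lemma layer0 D x : ~ layer D x 0. Proof. by move/layer_neq0; rewrite eqxx. Qed.

(** The trivialization by leading terms: it depends only on the leading residue of [v] at [x], so
    that multiplication by [f] acts on it through [tame]. *)
Definition lead_wt x v := wt (rep (res x (unit_part x v))).

Lemma lead_wt_neq0 x v : v != 0 -> lead_wt x v != 0.
Proof.
move=> v0; have [u0 xu] := unit_partP x v0; apply: wt_neq0; rewrite rep_eq0.
exact: res_neq0.
Qed.

Lemma lead_wt_scale x a v : a != 0 -> v != 0 -> lead_wt x (c a * v) = a * lead_wt x v.
Proof.
move=> a0 v0; have [u0 xu] := unit_partP x v0.
rewrite /lead_wt /unit_part dvalM ?fmorph_eq0 // finite_dval_const add0r -mulrA.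
rewrite res_scale ?rep_scale; last exact: unit_part_int.
by rewrite wt_scale // rep_eq0 res_neq0.
Qed.

Lemma lead_wtM x f v : f != 0 -> v != 0 ->
  lead_wt x (f * v) = wt (rep (res x (unit_part x f * rep (res x (unit_part x v))))).
Proof.
move=> f0 v0; rewrite /lead_wt unit_partM //; congr (wt (rep _)).
have fi := unit_part_int x f0; have vi := unit_part_int x v0.
apply/(res_eqP S_ff); first exact: vgeMl.
  by apply: vgeMl => //; apply: rep_int.
by rewrite -mulrBr; apply: vgeMl => //; apply: res_rep_near.
Qed.

Lemma lead_part_layer D x v : layer D x v -> lead_part D x v = res x (unit_part x v).
Proof. by case/layerP => _ _ e; rewrite /lead_part /unit_part e opprK. Qed.

Lemma layer_weight D x : weight_on c (layer D x) (lead_wt x).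
Proof.
move=> v /layer_neq0 v0; split; first exact: lead_wt_neq0.
by move=> a a0; apply: lead_wt_scale.
Qed.

Lemma layer_wt D x : weight_on c (layer D x) wt.
Proof. by apply: wt_weight; apply: layer0. Qed.

(* Stands for the determinant of multiplication by [f] from [L(D)] to [L(D - div f)]: the product over the
   k^*-orbits of [L(D)] is a substitute for the determinant line of [L(D)]. *)
Definition mul_transfer f D := orbit_prod (nonzero_sections D) (fun v => wt (f * v) / wt v).

Lemma wt_ratio_inv f v a : f != 0 -> v != 0 -> a != 0 ->
  wt (f * (c a * v)) / wt (c a * v) = wt (f * v) / wt v.
Proof.
move=> f0 v0 a0; rewrite mulrCA !wt_scale ?mulf_neq0 //.
by rewrite -mulf_div divff // mul1r.
Qed.

Lemma nonzero_shift f D : f != 0 ->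
  nonzero_sections (D - divf f) = [set w | nonzero_sections D (f^-1 * w)].
Proof.
move=> f0; apply/seteqP; split=> w [hw w0]; split.
- by apply/(sectionsM S_ff _ _ f0); rewrite mulVKf.
- by rewrite mulf_neq0 // invr_eq0.
- by move/(sectionsM S_ff _ _ f0): hw; rewrite mulVKf.
- by apply: contra_neq w0 => ->; rewrite mulr0.
Qed.

(** Multiplicativity of determinants: both sides compare [v] with its product by [f] and [h], along
    the orbits of L(D). *)
Lemma mul_transfer_comm f h D : f != 0 -> h != 0 ->
  mul_transfer f D * mul_transfer h (D - divf f) = mul_transfer h D * mul_transfer f (D - divf h).
Proof.
have half f' h' : f' != 0 -> h' != 0 -> mul_transfer f' D * mul_transfer h' (D - divf f') =
    orbit_prod (nonzero_sections D) (fun v => wt (h' * (f' * v)) / wt v).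
  move=> f0 h0; rewrite {2}/mul_transfer nonzero_shift // orbit_prod_shift //.
  - rewrite /mul_transfer orbit_prod_mul; apply: eq_orbit_prod; first exact: finite_nonzero.
    move=> v [_ v0]; have fv : wt (f' * v) != 0 by apply: wt_neq0; rewrite mulf_neq0.
    by rewrite /= [LHS]mulrC [LHS]mulrA divfK.
  - exact: finite_nonzero.
  - exact: stable_nonzero.
  - exact: nonzero0.
  - move=> v [_ v0] a a0; apply: wt_ratio_inv => //; exact: mulf_neq0.
move=> f0 h0; rewrite !half //; apply: eq_orbit_prod; first exact: finite_nonzero.
by move=> v _; rewrite mulrCA.
Qed.

Lemma mul_transfer_layer f D x : mul_transfer f D = mul_transfer f (D - << x >>) * orbit_prod (layer D x) (fun v => wt (f * v) / wt v).
Proof.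
apply: prod_fset_setU; first exact: finite_nonzero.
  move=> v; split=> [[hv v0]|[[hv v0]|hv]].
  - have [h|h] := pselect (sections (D - << x >>) v); first by left.
    by right.
  - by split=> //; apply: sections_sub1 hv.
  - by split; [case: hv|apply: layer_neq0 hv].
by move=> v [hv v0] [].
Qed.

(* Compares two trivializations of the layer of [D] at [x]: by orbit representatives and by leading terms. *)
Definition layer_cmp x D := orbit_prod (layer D x) (fun v => lead_wt x v / wt v).

Lemma layer_cmp_neq0 x D : layer_cmp x D != 0.
Proof.
apply: orbit_prod_neq0; first exact: finite_layer.
move=> v /layer_neq0 v0; rewrite mulf_neq0 ?invr_eq0 ?lead_wt_neq0 //; exact: wt_neq0.
Qed.

Lemma lead_ratio_inv x v a : v != 0 -> a != 0 ->
  lead_wt x (c a * v) / wt (c a * v) = lead_wt x v / wt v.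
Proof.
move=> v0 a0; rewrite lead_wt_scale ?wt_scale //.
by rewrite -mulf_div divff // mul1r.
Qed.

Lemma layer_shift f D x : f != 0 -> layer (D - divf f) x = [set w | layer D x (f^-1 * w)].
Proof.
move=> f0; have e N w : sections (N - divf f) w <-> sections N (f^-1 * w).
  by rewrite (sectionsM S_ff N (f^-1 * w) f0) mulVKf.
have xE : D - divf f - << x >> = D - << x >> - divf f by rewrite addrAC.
by apply/seteqP; split=> w [hw nw]; split; rewrite ?xE in nw *; try (by apply/e); move=> h; apply: nw; apply/e.
Qed.

Section LargeDegree.
Variable n0 : int.
Hypothesis n0P : forall D, n0 <= Deg D -> forall al, adele al -> exists h, adele_le D (fun x => al x - h).

Lemma lead_part_onto D x (r : residues c x) : n0 <= Deg (D - << x >>) ->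
  exists2 v, sections D v & lead_part D x v = r.
Proof.
move=> /n0P van; have dlx : seq_div [:: x] = << x >> by rewrite seq_div_cons seq_div_nil addr0.
have [|||v [hv h]] := @local_section D [:: x] (fun y => rep r * unif x ^ (- coeff x D)) => //.
- by rewrite dlx.
- by move=> y; rewrite inE => /eqP->; apply/vge_unifX; rewrite subrr; apply: rep_int.
exists v => //; rewrite -(repK S_ff r); apply/(res_eqP S_ff); [exact: lead_part_int|exact: rep_int|].
have := h x (mem_head _ _); set a := rep r; have p0 := unif_neq0 x.
have -> : v * unif x ^ coeff x D - a = (v - a * unif x ^ (- coeff x D)) * unif x ^ coeff x D.
  by rewrite mulrBl -mulrA -expfzDr // addNr expr0z mulr1.
by rewrite vge_unifX.
Qed.

Lemma lead_part_onto2 D x y (r : residues c x) (r' : residues c y) : x != y ->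
  n0 <= Deg (D - << x >> - << y >>) ->
  exists2 v, sections D v & lead_part D x v = r /\ lead_part D y v = r'.
Proof.
move=> xy /n0P van; have dlx : D - seq_div [:: x; y] = D - << x >> - << y >> by rewrite !seq_div_cons seq_div_nil addr0 opprD addrA.
pose al z := if z == x then rep r * unif x ^ (- coeff x D) else rep r' * unif y ^ (- coeff y D).
have [|||v [hv h]] := @local_section D [:: x; y] al.
- by rewrite /= inE xy.
- by rewrite dlx.
- move=> z; rewrite !inE /al; case: eqP => [->|_ /= /eqP->] //; try move=> _;
  by apply/vge_unifX; rewrite subrr; apply: rep_int.
have fin z (s : residues c z) : vge z (v - rep s * unif z ^ (- coeff z D)) (1 - coeff z D) -> lead_part D z v = s.
  move=> hz; rewrite -(repK S_ff s); apply/(res_eqP S_ff); [exact: lead_part_int|exact: rep_int|].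
  move: hz; set a := rep s; have p0 := unif_neq0 z.
  have -> : v * unif z ^ coeff z D - a = (v - a * unif z ^ (- coeff z D)) * unif z ^ coeff z D.
    by rewrite mulrBl -mulrA -expfzDr // addNr expr0z mulr1.
  by rewrite vge_unifX.
exists v => //; split; apply: fin.
  by have := h x (mem_head _ _); rewrite /al eqxx.
by have := h y; rewrite !inE eqxx orbT /al eq_sym (negPf xy); apply.
Qed.

(** Multiplication by [f] carries the layer of [D] to that of D - div(f). In leading terms it acts
    on residues by the unit part of [f], which gives [tame]; the factors [layer_cmp] convert from
    orbit representatives to leading terms. *)
Lemma layer_tame f D x : f != 0 -> n0 <= Deg (D - << x >>) ->
  orbit_prod (layer D x) (fun v => wt (f * v) / wt v) * layer_cmp x (D - divf f) =
  layer_cmp x D * tame x f.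
Proof.
move=> f0 large; rewrite /layer_cmp layer_shift // orbit_prod_shift //; first last.
- by move=> v /layer_neq0 v0 a a0; apply: lead_ratio_inv => //; apply: mulf_neq0.
- exact: layer0.
- exact: stable_layer.
- exact: finite_layer.
rewrite orbit_prod_mul (@eq_orbit_prod _ _ c _ _ (fun v => lead_wt x v / wt v * (lead_wt x (f * v) / lead_wt x v))); first last.
- move=> v /layer_neq0 v0; have h2 := wt_neq0 c (mulf_neq0 f0 v0).
  have h3 := lead_wt_neq0 x v0.
  by rewrite /= [LHS]mulrC [LHS]mulrA divfK // [RHS]mulrC [RHS]mulrA divfK.
- exact: finite_layer.
rewrite -orbit_prod_mul; congr (_ * _).
rewrite /orbit_prod (orbit_prod_indep (finite_layer D x) (stable_layer (D := D) (x := x)) (layer_wt (D := D) (x := x)) (layer_weight (D := D) (x := x))); last first.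
  move=> v /layer_neq0 v0 a a0; rewrite mulrCA !lead_wt_scale ?mulf_neq0 //.
  by rewrite -mulf_div divff // mul1r.
rewrite big_mkcond /=.
pose G (r : residues c x) := if wt (rep r) == 1 then wt (rep (res x (unit_part x f * rep r))) else 1.
rewrite big_seq (eq_bigr (fun v => G (lead_part D x v))); last first.
  move=> v; rewrite in_fset_set; last exact: finite_layer.
  move=> /set_mem hv; have v0 := layer_neq0 hv; rewrite /G lead_part_layer // -/(lead_wt x v).
  by case: eqP => // e; rewrite e divr1 lead_wtM.
have phiE v w : layer D x v -> layer D x w -> lead_part D x v = lead_part D x w ->
    sections (D - << x >>) (v - w).
  by move=> [hv _] [hw _] /(lead_part_eq S_ff x hv hw).
have phiV v w : layer D x v -> sections (D - << x >>) w ->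
    layer D x (v + w) /\ lead_part D x (v + w) = lead_part D x v.
  move=> [hv nv] hw; have hw' := sections_sub1 hw; split.
    split; first exact: sectionsD.
    by move=> h; apply: nv; rewrite -[v](addrK w); apply: sectionsB.
  by apply/(lead_part_eq S_ff x (sectionsD hv hw') hv); rewrite addrAC subrr add0r.
have QP (r : residues c x) : r != res0 x <-> exists2 v, layer D x v & lead_part D x v = r.
  split=> [r0|[v hv <-]]; last first.
    rewrite lead_part_layer //; have [u0 xu] := unit_partP x (layer_neq0 hv).
    exact: res_neq0.
  have [v hv e] := lead_part_onto r large; exists v => //; split=> // h.
  case/eqP: r0; rewrite -e -(repK S_ff (res0 x)) rep0.
  apply/(res_eqP S_ff); [exact: lead_part_int|exact: vge0|].
  by rewrite subr0 vge_unifX; have := h x; rewrite /stalk /= dU_subE eqxx; apply: vgeW; lia.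
rewrite -big_seq (big_fibers (finite_sections S_ff _) phiE phiV _ _ QP).
rewrite /tame big_mkcondr; apply: eq_bigr => r _; rewrite /G.
(* Each nonzero residue is attained by a power of q of sections, and raising to such a power is the
   identity on k. *)
rewrite iter_mulr_1; case: ifP => _; last by rewrite expr1n.
by rewrite (cardL_ell S_ff) expf_card_pow.
Qed.

End LargeDegree.
End Reciprocity.

(** * Exchange of places and the reciprocity law *)

Section ReciprocityLaw.
Variables (k : finFieldType) (S : fieldType) (c : {rmorphism k -> S}).
Hypothesis S_ff : function_field c.
Implicit Types (D N W : divisor S) (x y : place S) (f h v w : S) (l : seq (place S)).
Local Notation deg := (place_deg c).
Local Notation Deg := (div_deg c).
Local Notation q := #|k|.
Local Notation rep := (rep S_ff).
Local Notation res := (res S_ff).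
Local Notation wt := (wt c).
Local Notation res0 := (res0 c).
Local Notation orbit_prod := (orbit_prod c).
Local Notation lead_part := (lead_part S_ff).
Local Notation lead_wt := (lead_wt S_ff).
Local Notation layer_cmp := (layer_cmp S_ff).
Local Notation tame := (tame S_ff).
Local Notation wilson := (wilson k).

Definition two_layer D x y : set S :=
  [set v | [/\ sections D v, ~ sections (D - << x >>) v & ~ sections (D - << y >>) v]].

Lemma sections_inter D x y v : x != y -> sections (D - << x >>) v -> sections (D - << y >>) v ->
  sections (D - << x >> - << y >>) v.
Proof.
move=> xy hx hy z; rewrite /stalk /= !dU_subE.
have := hx z; have := hy z; rewrite /stalk /= !dU_subE.
have [<-|_] := eqVneq x z; last by rewrite subr0.
by rewrite eq_sym (negPf xy) !subr0.
Qed.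

Lemma layer_split D x y v : x != y ->
  layer D x v <-> layer (D - << y >>) x v \/ two_layer D x y v.
Proof.
move=> xy; split=> [[hv nv]|[[hv nv]|[hv nx ny]]].
- have [hy|hy] := pselect (sections (D - << y >>) v); last by right.
  by left; split=> // h; apply: nv; apply: (@sections_sub1 _ _ y); rewrite addrAC.
- split; first exact: sections_sub1 hv.
  by move=> h; apply: nv; apply: sections_inter => //; rewrite eq_sym.
- by [].
Qed.

Lemma two_layerC D x y : two_layer D x y = two_layer D y x.
Proof. by apply/seteqP; split=> v [? ? ?]; split. Qed.

Lemma finite_two_layer D x y : finite_set (two_layer D x y).
Proof. by apply: (sub_finite_set _ (finite_sections S_ff D)) => v []. Qed.

Lemma two_layer_layer D x y v : two_layer D x y v -> layer D x v /\ layer D y v.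
Proof. by case. Qed.

Lemma two_layer_neq0 D x y v : two_layer D x y v -> v != 0.
Proof. by move=> /two_layer_layer[/(layer_neq0 S_ff)]. Qed.

Lemma two_layer_split D x y : x != y ->
  layer_cmp x D = layer_cmp x (D - << y >>) * orbit_prod (two_layer D x y) (fun v => lead_wt x v / wt v).
Proof.
move=> xy; apply: prod_fset_setU; first exact: (finite_layer S_ff).
  by move=> v; apply: layer_split.
by move=> v [hv _] [].
Qed.

Section LargeDegree.
Variable n0 : int.
Hypothesis n0P : forall D, n0 <= Deg D -> forall al, adele al -> exists h, adele_le D (fun x => al x - h).

(** In large degree the leading parts at [x] and [y] are independent. With weight 1 imposed at [x],
    the product runs over [norbits] residues at [x] and all nonzero residues at [y]; the latter give
    [wilson ^+ deg y]. *)
Lemma two_layer_cmp D x y : x != y -> n0 <= Deg (D - << x >> - << y >>) ->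
  orbit_prod (two_layer D x y) (fun v => lead_wt y v / lead_wt x v) = wilson ^+ (deg x * deg y).
Proof.
move=> xy large; set W := two_layer D x y.
have fW : finite_set W by apply: finite_two_layer.
have sW : stable c W.
  by move=> a v a0 [hv nx ny]; split; [apply: sections_scale|move/(sections_scaleE _ _ _ a0)|move/(sections_scaleE _ _ _ a0)].
have wW : weight_on c W wt by apply: wt_weight => /two_layer_neq0; rewrite eqxx.
have lW : weight_on c W (lead_wt x).
  move=> v /two_layer_neq0 v0; split; first exact: lead_wt_neq0.
  by move=> a a0; apply: lead_wt_scale.
rewrite /orbit_prod (orbit_prod_indep fW sW wW lW); last first.
  move=> v /two_layer_neq0 v0 a a0; rewrite !lead_wt_scale //.
  by rewrite -mulf_div divff // mul1r.
rewrite big_mkcond /=.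
pose G (r : residues c x * residues c y) := if wt (rep r.1) == 1 then wt (rep r.2) else 1.
pose phi v := (lead_part D x v, lead_part D y v).
rewrite big_seq (eq_bigr (fun v => G (phi v))); last first.
  move=> v; rewrite in_fset_set // => /set_mem hv; have [hx hy] := two_layer_layer hv.
  rewrite /G /phi /= !lead_part_layer // -/(lead_wt x v) -/(lead_wt y v).
  by case: eqP => // e; rewrite e divr1.
have phiE v w : W v -> W w -> phi v = phi w -> sections (D - << x >> - << y >>) (v - w).
  move=> [hv _ _] [hw _ _] [/(lead_part_eq S_ff x hv hw) h1 /(lead_part_eq S_ff y hv hw) h2].
  exact: sections_inter.
have sub v : sections (D - << x >> - << y >>) v -> sections (D - << x >>) v /\ sections (D - << y >>) v.
  by split; [apply: sections_sub1|apply: (@sections_sub1 _ _ x); rewrite addrAC].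
have phiV v w : W v -> sections (D - << x >> - << y >>) w -> W (v + w) /\ phi (v + w) = phi v.
  move=> [hv nx ny] /sub[hwx hwy]; have hw := sections_sub1 hwx; split.
    split; first exact: sectionsD.
      by move=> h; apply: nx; rewrite -[v](addrK w); apply: sectionsB.
    by move=> h; apply: ny; rewrite -[v](addrK w); apply: sectionsB.
  congr (_, _); [apply/(lead_part_eq S_ff x (sectionsD hv hw) hv)|apply/(lead_part_eq S_ff y (sectionsD hv hw) hv)];
  by rewrite addrAC subrr add0r.
have QP r : (r.1 != res0 x) && (r.2 != res0 y) <-> exists2 v, W v & phi v = r.
  split=> [/andP[r0 r'0]|[v hv <-]]; last first.
    have [hx hy] := two_layer_layer hv; rewrite /phi /= !lead_part_layer //.
    have v0 := layer_neq0 S_ff hx; have [u0 xu] := unit_partP x v0; have [u0' xu'] := unit_partP y v0.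
    by rewrite !res_neq0.
  have [v hv [e1 e2]] := lead_part_onto2 S_ff n0P r.1 r.2 xy large.
  have aux z (s : residues c z) : lead_part D z v = s -> s != res0 z -> ~ sections (D - << z >>) v.
    move=> <- s0 h; case/eqP: s0; rewrite -(repK S_ff (res0 z)) rep0.
    apply/(res_eqP S_ff); [exact: lead_part_int|exact: vge0|].
    by rewrite subr0 vge_unifX; have := h z; rewrite /stalk /= dU_subE eqxx; apply: vgeW; lia.
  exists v; last by rewrite /phi e1 e2 -surjective_pairing.
  by split=> //; [apply: aux e1 r0|apply: aux e2 r'0].
rewrite -big_seq (big_fibers (finite_sections S_ff _) phiE phiV _ _ QP).
rewrite (eq_bigr (fun r => G r)) => [|r _]; last by rewrite iter_mulr_1 (cardL_ell S_ff) expf_card_pow.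
rewrite -(pair_big (fun r : residues c x => r != res0 x) (fun r' : residues c y => r' != res0 y) (fun r r' => G (r, r'))) /=.
rewrite (bigID (fun r : residues c x => wt (rep r) == 1)) /= [X in _ * X]big1 ?mulr1; last first.
  by move=> r /andP[_ /negPf e]; rewrite /G /= e big1.
rewrite (eq_bigr (fun=> wilson ^+ deg y)) => [|r /andP[_ e]]; last by rewrite /G /= e prod_wt_rep.
by rewrite prodr_const -exprM mulnC exprM -/(norbits S_ff x) wilson_norbits -exprM.
Qed.

(** The sign for exchanging the graded pieces at [x] and [y] in a determinant, (-1)^(deg x deg y);
    equal places need no exchange. *)
Definition swap_sign x y : k := if x == y then 1 else wilson ^+ (deg x * deg y).

Lemma layer_cmp_swap D x y : n0 <= Deg (D - << x >> - << y >>) ->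
  layer_cmp x D * layer_cmp y (D - << x >>) * swap_sign x y =
  layer_cmp y D * layer_cmp x (D - << y >>).
Proof.
rewrite /swap_sign; have [->|xy large] := eqVneq x y; first by rewrite mulr1.
rewrite -(two_layer_cmp xy large).
rewrite (two_layer_split D xy) (@two_layer_split D y x) 1?eq_sym // -[two_layer D y x]two_layerC.
set A := layer_cmp x _; set B := layer_cmp y _.
have -> : orbit_prod (two_layer D x y) (fun v => lead_wt y v / wt v) =
    orbit_prod (two_layer D x y) (fun v => lead_wt x v / wt v) * orbit_prod (two_layer D x y) (fun v => lead_wt y v / lead_wt x v).
  rewrite orbit_prod_mul; apply: eq_orbit_prod; first exact: finite_two_layer.
  by move=> v /two_layer_neq0 v0 /=; rewrite [RHS]mulrC [RHS]mulrA divfK // lead_wt_neq0.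
by set X := orbit_prod _ _; set Y := orbit_prod _ _; ring.
Qed.

(** Comparison of the two trivializations over the whole quotient L(D)/L(D - l), filtered in the
    order of the list. *)
Fixpoint path_cmp D l : k := if l is x :: l' then layer_cmp x D * path_cmp (D - << x >>) l' else 1.

Lemma path_cmp_neq0 D l : path_cmp D l != 0.
Proof.
elim: l D => [|x l IH] D; first exact: oner_neq0.
by rewrite /= mulf_neq0 ?layer_cmp_neq0.
Qed.

Lemma Deg_sub_seq_div_le D l : Deg (D - seq_div l) <= Deg D.
Proof. by rewrite div_degB div_deg_seq_div; lia. Qed.

Lemma path_cmp_swap1 D y l : n0 <= Deg (D - << y >> - seq_div l) ->
  layer_cmp y D * path_cmp (D - << y >>) l * \prod_(x <- l) swap_sign y x =
  path_cmp D l * layer_cmp y (D - seq_div l).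
Proof.
elim: l D => [|x l IH] D large; first by rewrite big_nil seq_div_nil subr0 /= mulr1 mulrC.
have dE N : N - seq_div (x :: l) = N - << x >> - seq_div l by rewrite seq_div_cons opprD addrA.
rewrite dE in large; rewrite /= big_cons dE.
have h1 := layer_cmp_swap (le_trans large (Deg_sub_seq_div_le _ l)).
have large' : n0 <= Deg (D - << x >> - << y >> - seq_div l) by rewrite [D - _ - _]addrAC.
rewrite -[RHS]mulrA -(IH _ large') [D - << x >> - << y >>]addrAC.
set A := path_cmp _ l; set P := \prod_(_ <- _) _.
have -> : layer_cmp y D * (layer_cmp x (D - << y >>) * A) * (swap_sign y x * P) =
  (layer_cmp y D * layer_cmp x (D - << y >>) * swap_sign y x) * (A * P) by ring.
by rewrite h1; ring.
Qed.

Lemma path_cmp_swap D l l' : n0 <= Deg (D - seq_div l' - seq_div l) ->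
  path_cmp D l' * path_cmp (D - seq_div l') l * \prod_(y <- l') \prod_(x <- l) swap_sign y x =
  path_cmp D l * path_cmp (D - seq_div l) l'.
Proof.
elim: l' D => [|y l' IH] D large; first by rewrite big_nil seq_div_nil subr0 /= mul1r !mulr1.
have dE N : N - seq_div (y :: l') = N - << y >> - seq_div l' by rewrite seq_div_cons opprD addrA.
rewrite dE in large; rewrite /= big_cons dE.
have h1 := IH _ large.
have large1 : n0 <= Deg (D - << y >> - seq_div l).
  by apply: le_trans large _; rewrite [D - _ - seq_div l' - _]addrAC Deg_sub_seq_div_le.
have h2 := path_cmp_swap1 large1.
set P1 := \prod_(_ <- l) _ in h2 *; set P2 := \prod_(_ <- l') _ in h1 *.
have -> : layer_cmp y D * path_cmp (D - << y >>) l' * path_cmp (D - << y >> - seq_div l') l * (P1 * P2) =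
  layer_cmp y D * P1 * (path_cmp (D - << y >>) l' * path_cmp (D - << y >> - seq_div l') l * P2) by ring.
rewrite h1 [D - seq_div l - << y >>]addrAC mulrA [RHS]mulrA -h2; ring.
Qed.

Lemma mul_transfer_path f D l : f != 0 -> n0 <= Deg (D - seq_div l) ->
  mul_transfer c f D * path_cmp (D - divf f) l = mul_transfer c f (D - seq_div l) * path_cmp D l * \prod_(x <- l) tame x f.
Proof.
move=> f0; elim: l D => [|x l IH] D large; first by rewrite big_nil seq_div_nil subr0 /= !mulr1.
have dE N : N - seq_div (x :: l) = N - << x >> - seq_div l by rewrite seq_div_cons opprD addrA.
rewrite dE in large; rewrite /= big_cons dE.
have h1 := layer_tame S_ff n0P f0 (le_trans large (Deg_sub_seq_div_le _ l)).
rewrite (mul_transfer_layer S_ff f D x); have h2 := IH _ large.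
rewrite [D - divf f - << x >>]addrAC.
set O := orbit_prod _ _ in h1 *; set A := layer_cmp x (D - divf f) in h1 *.
have -> : mul_transfer c f (D - << x >>) * O * (A * path_cmp (D - << x >> - divf f) l) =
  (mul_transfer c f (D - << x >>) * path_cmp (D - << x >> - divf f) l) * (O * A) by ring.
by rewrite h1 h2; ring.
Qed.

Lemma mul_transfer_neq0 f D : f != 0 -> mul_transfer c f D != 0.
Proof.
move=> f0; apply: orbit_prod_neq0; first exact: (finite_nonzero S_ff).
by move=> v [_ v0]; rewrite mulf_neq0 ?invr_eq0 // wt_neq0 // mulf_neq0.
Qed.

End LargeDegree.

Definition tame_list f l := \prod_(x <- l) tame x f.

(** Everything is compared between [W] and [W] minus the zeros or poles of the two functions. The
    transfers of [f] and [h] commute by [mul_transfer_comm]; moving each along the zeros or poles of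
    the other function produces the tame symbols, and the path comparisons cancel up to
    [swap_sign]. *)
Lemma weil_reciprocity f h (fp fm hp hm : seq (place S)) : f != 0 -> h != 0 ->
  divf f = seq_div fp - seq_div fm -> divf h = seq_div hp - seq_div hm ->
  tame_list f hp * tame_list h fm * \prod_(y <- fp ++ fm) \prod_(x <- hp ++ hm) swap_sign y x =
  tame_list f hm * tame_list h fp.
Proof.
move=> f0 h0 fE hE; have [n0 n0P] := vanishing S_ff.
have [x0 _] := exists_place S_ff.
(* A multiple of one place, large enough that H^1 still vanishes after all the zeros and poles are
   subtracted. *)
pose W := seq_div (nseq (absz n0 + absz (Deg (seq_div (fp ++ fm ++ hp ++ hm))))%N x0).
have WD : Deg W = ((absz n0 + absz (Deg (seq_div (fp ++ fm ++ hp ++ hm)))) * deg x0)%N%:Z.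
  by rewrite /W [LHS]div_deg_seq_div big_nseq iter_addn_0 mulnC.
have WE l : (forall y, count_mem y l <= count_mem y (fp ++ fm ++ hp ++ hm))%N -> n0 <= Deg (W - seq_div l).
  move=> sub.
  have : Deg (seq_div l) <= Deg (seq_div (fp ++ fm ++ hp ++ hm)).
    by apply: div_le_deg => y; rewrite !coeff_seq_div lez_nat.
  have := place_deg_gt0 S_ff x0; rewrite div_degB WD.
  set X := Deg (seq_div l); set Y := Deg _; set d := deg x0 => d0 XY.
  have : (absz n0 + absz Y <= (absz n0 + absz Y) * d)%N by rewrite leq_pmulr.
  by move: XY; lia.
have W2 l l' : (forall y, count_mem y (l ++ l') <= count_mem y (fp ++ fm ++ hp ++ hm))%N -> n0 <= Deg (W - seq_div l - seq_div l').
  by move=> /WE; rewrite seq_div_cat opprD addrA.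
have cnt y l1 l2 : count_mem y (l1 ++ l2) = (count_mem y l1 + count_mem y l2)%N by rewrite count_cat.
have lg : [/\ n0 <= Deg (W - seq_div fp - seq_div hp), n0 <= Deg (W - seq_div fp - seq_div hm),
    n0 <= Deg (W - seq_div fm - seq_div hp) & n0 <= Deg (W - seq_div fm - seq_div hm)].
  by split; apply: W2 => y; rewrite !cnt; lia.
have [lpp lpm lmp lmm] := lg.
have cancel (A B C : divisor S) : A - B - (C - B) = A - C by rewrite opprB addrA subrK.
have fW : W - seq_div fm - divf f = W - seq_div fp by rewrite fE cancel.
have hW : W - seq_div hm - divf h = W - seq_div hp by rewrite hE cancel.
have Df : W - seq_div fm - seq_div hm - divf f = W - seq_div fp - seq_div hm by rewrite [_ - seq_div hm - _]addrAC fW.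
have Dh : W - seq_div fm - seq_div hm - divf h = W - seq_div fm - seq_div hp by rewrite [W - seq_div fm - seq_div hm]addrAC [LHS]addrAC hW addrAC.
have cm := mul_transfer_comm S_ff (W - seq_div fm - seq_div hm) f0 h0; rewrite Df Dh in cm.
have f1 := mul_transfer_path n0P f0 lmm; rewrite fW in f1.
have f2 := mul_transfer_path n0P f0 lmp; rewrite fW in f2.
have C N l l' : N - seq_div l - seq_div l' = N - seq_div l' - seq_div l by rewrite addrAC.
have h1 := mul_transfer_path n0P h0 (D := W - seq_div hm) (l := fm); rewrite hW -[W - seq_div hm - seq_div fm]C in h1.
have {}h1 := h1 lmm.
have h2 := mul_transfer_path n0P h0 (D := W - seq_div hm) (l := fp); rewrite hW -[W - seq_div hm - seq_div fp]C in h2.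
have {}h2 := h2 lpm.
have g1 := path_cmp_swap n0P (D := W) (l' := fp) (l := hm) lpm.
have g2 := path_cmp_swap n0P (D := W) (l' := fm) (l := hp) lmp.
have g3 := path_cmp_swap n0P (D := W) (l' := fm) (l := hm) lmm.
have g4 := path_cmp_swap n0P (D := W) (l' := fp) (l := hp) lpp.
have nz N l := path_cmp_neq0 N l.
move: cm f1 f2 h1 h2 g1 g2 g3 g4; rewrite -!/(tame_list _ _).
set A := mul_transfer c f (W - seq_div fm); set B := mul_transfer c f (W - seq_div fm - seq_div hm); set B' := mul_transfer c f _.
set C' := mul_transfer c h (W - seq_div hm); set E1 := mul_transfer c h (W - seq_div fm - seq_div hm); set E2 := mul_transfer c h _.
set a1 := path_cmp (W - seq_div fp) hm; set a2 := path_cmp (W - seq_div fm) hp.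
set a3 := path_cmp (W - seq_div fm) hm; set a4 := path_cmp (W - seq_div fp) hp.
set b1 := path_cmp (W - seq_div hm) fp; set b2 := path_cmp (W - seq_div hp) fm.
set b3 := path_cmp (W - seq_div hm) fm; set b4 := path_cmp (W - seq_div hp) fp.
set u := path_cmp W fp; set u' := path_cmp W fm; set w := path_cmp W hm; set w' := path_cmp W hp.
set s1 := \prod_(y <- fp) \prod_(x <- hm) _; set s2 := \prod_(y <- fm) \prod_(x <- hp) _.
set s3 := \prod_(y <- fm) \prod_(x <- hm) _; set s4 := \prod_(y <- fp) \prod_(x <- hp) _.
move=> cm f1 f2 h1 h2 g1 g2 g3 g4.
have A0 : A != 0 by apply: mul_transfer_neq0.
have B0 : B != 0 by apply: mul_transfer_neq0.
have C0 : C' != 0 by apply: mul_transfer_neq0.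
have E20 : E2 != 0 by apply: mul_transfer_neq0.
have sq l l' : (\prod_(y <- l) \prod_(x <- l') swap_sign y x) ^+ 2 = 1.
  rewrite -prodrXl; apply: big1 => y _; rewrite -prodrXl; apply: big1 => x _.
  rewrite /swap_sign; case: ifP => _; first by rewrite expr1n.
  by rewrite -exprM mulnC exprM expr2 wilson_sqr expr1n.
have -> : \prod_(y <- fp ++ fm) \prod_(x <- hp ++ hm) swap_sign y x = s1 * s2 * s3 * s4.
  rewrite big_cat /=; under eq_bigr do rewrite big_cat.
  rewrite big_split; under [X in _ * X]eq_bigr do rewrite big_cat.
  by rewrite big_split /= -/s1 -/s2 -/s3 -/s4; ring.
(* The transfer of [f] is followed along the zeros and along the poles of [h], and the common factor
   [A] is eliminated; [k2] does the same for [h], and [k4] closes the rectangle of path comparisons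
   up to signs. *)
have k1 : a1 * B' * a2 * tame_list f hp = a4 * B * a3 * tame_list f hm.
  apply: (mulfI A0); transitivity ((A * a1) * (B' * a2 * tame_list f hp)); first by ring.
  by rewrite f1 -f2; ring.
have k2 : b2 * E2 * b1 * tame_list h fp = b4 * E1 * b3 * tame_list h fm.
  apply: (mulfI C0); transitivity ((C' * b2) * (E2 * b1 * tame_list h fp)); first by ring.
  by rewrite h1 -h2; ring.
have s12 : (s1 * s2) ^+ 2 = 1 by rewrite exprMn !sq mulr1.
have k3 : a1 * a2 * b3 * b4 * (tame_list f hp * tame_list h fm) =
    a3 * a4 * b1 * b2 * (tame_list f hm * tame_list h fp).
  apply: (mulfI (mulf_neq0 B0 E20)).
  transitivity ((a1 * B' * a2 * tame_list f hp) * (b4 * E1 * b3 * tame_list h fm)); last first.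
    by rewrite k1 -k2; ring.
  by rewrite cm; ring.
have k4 : a1 * a2 * b3 * b4 * (s1 * s2) = a3 * a4 * b1 * b2 * (s3 * s4).
  apply: (mulfI (mulf_neq0 (mulf_neq0 (nz W fp) (nz W fm)) (mulf_neq0 (nz W hm) (nz W hp)))).
  rewrite -/u -/u' -/w -/w'.
  transitivity ((u * a1 * s1) * (u' * a2 * s2) * (w * b3) * (w' * b4)); first by ring.
  rewrite g1 g2 -g3 -g4; ring.
have nz4 : a3 * a4 * b1 * b2 != 0 by rewrite !mulf_neq0 // nz.
have nz5 : a1 * a2 * b3 * b4 != 0 by rewrite !mulf_neq0 // nz.
apply: (mulfI nz4).
transitivity (a3 * a4 * b1 * b2 * (s3 * s4) * (s1 * s2) * (tame_list f hp * tame_list h fm)); first by ring.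
rewrite -k4; transitivity ((s1 * s2) ^+ 2 * (a1 * a2 * b3 * b4 * (tame_list f hp * tame_list h fm))); first by ring.
by rewrite s12 mul1r k3.
Qed.

End ReciprocityLaw.

Lemma rmorphism_of (R R' : fieldType) (s : R -> R') : {morph s : a b / a - b} ->
  {morph s : a b / a * b} -> s 1 = 1 -> exists s' : {rmorphism R -> R'}, forall z, s' z = s z.
Proof.
move=> sB sM s1.
pose am := GRing.isZmodMorphism.Build R R' s sB.
pose mm := GRing.isMonoidMorphism.Build R R' s (pair s1 sM).
pose s' : {rmorphism R -> R'} := HB.pack s am mm.
by exists s'.
Qed.

Lemma sum_distinct_dval (F : fieldType) (v : dvaluation F) n (g : nat -> F) :
  (forall i j, (i < n)%N -> (j < n)%N -> g i != 0 -> g j != 0 -> v (g i) = v (g j) -> i = j) ->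
  (forall i, (i < n)%N -> g i = 0) \/
  (exists i, [/\ (i < n)%N, g i != 0, \sum_(i < n) g i != 0 & v (\sum_(i < n) g i) = v (g i)]).
Proof.
elim: n => [|n IH] dis; first by left.
have [|z|[i [lt gi0 s0 vs]]] := IH.
- by move=> i j li lj; apply: dis; apply: ltnW.
- have S0 : \sum_(i < n) g i = 0 by apply: big1 => i _; apply: z.
  have [gn0|gn0] := eqVneq (g n) 0.
    by left=> i; rewrite ltnS leq_eqVlt => /orP[/eqP->|/z].
  by right; exists n; rewrite big_ord_recr /= S0 add0r.
have [gn0|gn0] := eqVneq (g n) 0.
  by right; exists i; rewrite big_ord_recr /= gn0 addr0; split=> //; apply: ltnW.
have ne : v (g i) != v (g n).
  by apply/eqP => e; have := dis i n (leqW lt) (ltnSn n) gi0 gn0 e; move: lt; lia.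
have [h|h] := ltP (v (g i)) (v (g n)).
  have [|n0 vE] := @dvalD_dom _ v (\sum_(i < n) g i) (g n) s0; first by right; lia.
  by right; exists i; rewrite big_ord_recr /= n0 vE ltnW.
have [|n0 vE] := @dvalD_dom _ v (g n) (\sum_(i < n) g i) gn0.
  by right; move: ne h; rewrite vs; lia.
by right; exists n; rewrite big_ord_recr /= addrC.
Qed.

Lemma ramification_eq (A B X W : int) (m e i j : nat) : (0 < e)%N -> W * m%:Z = X *+ e ->
  A *+ e + W * i%:Z = B *+ e + W * j%:Z -> A * m%:Z + X * i%:Z = B * m%:Z + X * j%:Z.
Proof.
have nE (Z : int) : Z *+ e = Z * e%:Z by rewrite -mulr_natr natz.
rewrite !nE => e0 wm eq1; apply: (@mulIf _ e%:Z); first by rewrite eqz_nat -lt0n.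
transitivity ((A * e%:Z + W * i%:Z) * m%:Z); first by rewrite [RHS]mulrDl [W * _ * _]mulrAC wm; ring.
by rewrite eq1 [LHS]mulrDl [W * _ * _]mulrAC wm; ring.
Qed.

(** * Frobenius elements of a Kummer extension *)

Section KummerExtension.
Variables (k : finFieldType) (S : fieldType) (c : {rmorphism k -> S}).
Hypothesis S_ff : function_field c.
Variables (m : nat) (zeta : k).
Hypotheses (m_prime : prime m) (zeta_prim : m.-primitive_root zeta).
Variables (f : S) (x0 : place S).
Hypotheses (f_neq0 : f != 0) (x0f : ~~ (m %| `|x0 f|)%N).
Variables (Q : fieldType) (u : {rmorphism S -> Q}) (y : Q) (y_f : y ^+ m = u f).
Hypothesis Q_gen : forall b : Q, exists r : {poly S}, b = (map_poly u r).[y].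

Local Notation cst := (u \o c : {rmorphism k -> Q}).

Let m_gt0 : (0 < m)%N. Proof. exact: prime_gt0. Qed.

Lemma kummer_root_neq0 : y != 0.
Proof. by apply: contra_neq f_neq0 => y0; apply: (fmorph_inj u); rewrite -y_f y0 expr0n gtn_eqF // mulr0n rmorph0. Qed.

Lemma kummer_repr b : exists h : nat -> S, b = \sum_(i < m) u (h i) * y ^+ i.
Proof.
have [r ->] := Q_gen b.
pose p := 'X^m - f%:P; have sp : size p = m.+1 by rewrite size_XnsubC.
have p0 : p != 0 by rewrite -size_poly_gt0 sp.
exists (fun i => (r %% p)`_i).
rewrite {1}(divp_eq r p) rmorphD rmorphM hornerD hornerM.
have -> : (map_poly u p).[y] = 0.
  by rewrite rmorphB /= map_polyXn map_polyC hornerD hornerN hornerXn hornerC y_f subrr.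
rewrite mulr0 add0r (@horner_coef_wide _ m); last first.
  by rewrite size_map_poly -ltnS -sp ltn_modp.
by apply: eq_bigr => i _; rewrite coef_map.
Qed.

Lemma kummer_transcendental t : transcendental c t -> transcendental cst (u t).
Proof.
move=> tr p p0; rewrite /ev -[map_poly cst p]/(map_poly (u \o c) p) map_poly_comp horner_map fmorph_eq0.
exact: tr.
Qed.

Lemma ev_kummer t p : ev cst (u t) p = u (ev c t p).
Proof. by rewrite /ev -[map_poly cst p]/(map_poly (u \o c) p) map_poly_comp horner_map. Qed.

Lemma kummer_spans t n : spans_over c t n -> spans_over cst (u t) (n * m).
Proof.
move=> [I [b [<- sp]]].
exists (I * 'I_m)%type, (fun ij : I * 'I_m => u (b ij.1) * y ^+ ij.2); split.
  by rewrite card_prod card_ord.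
move=> z; have [h ->] := kummer_repr z.
have [A [d [d0 dP]]] := common_denominator (fun j : 'I_m => h j) sp.
exists (fun ij => A ij.2 ij.1), d; rewrite ev_kummer fmorph_eq0; split=> //.
rewrite -(pair_bigA _ (fun i j => ev cst (u t) (A j i) * (u (b i) * y ^+ j))) /= exchange_big mulr_sumr.
apply: eq_bigr => j _; rewrite mulrA -rmorphM dP rmorph_sum mulr_suml.
by apply: eq_bigr => i _; rewrite rmorphM ev_kummer mulrA.
Qed.

Lemma valuation_ring_place (O : set Q) : subring_set O -> (forall z, O z \/ O z^-1) ->
  (forall r, O (u (c r))) -> (exists z, ~ O z) -> exists w : dvaluation Q, forall h, O h <-> vge w h 0.
Proof.
move=> sO vO Oc nO; have [t [n [t_tr t_sp]]] := function_field_spanned S_ff.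
exact: (place_of_valring (kummer_transcendental t_tr) (kummer_spans t_sp) sO vO Oc nO).
Qed.

(** Chevalley's theorem extends the valuation ring of [x] to [Q]. Units at [x] stay units, so the
    value of [u p] is the ramification index. *)
Lemma place_above_exists x : exists w : dvaluation Q, place_above u w x.
Proof.
have [p0 xp] := unifP x; set p := unif x in p0 xp.
pose R0 : set Q := [set z | exists2 h, vge x h 0 & z = u h].
have sR : subring_set R0.
  split; first by exists 1; [apply: vge1|rewrite rmorph1].
    by move=> _ _ [a ha ->] [b hb ->]; exists (a - b); [apply: vgeB|rewrite rmorphB].
  by move=> _ _ [a ha ->] [b hb ->]; exists (a * b); [apply: vgeMl|rewrite rmorphM].
have [||O [sO RO nO vO]] := chevalley sR (s := u p).
- by exists p => //; right; rewrite xp.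
- rewrite -fmorphV => -[h hh /fmorph_inj e]; move: hh; rewrite -e vgeE ?invr_eq0 // dvalV xp; lia.
have [||w wP] := valuation_ring_place sO vO.
- by move=> r; apply: RO; exists (c r) => //; apply: vge_const.
- by exists (u p)^-1.
have wpos : 0 < w (u p).
  by rewrite ltNge; apply/negP => le; apply: nO; apply/wP; right; rewrite dvalV; lia.
have wint h : vge x h 0 -> vge w (u h) 0 by move=> hh; apply/wP; apply: RO; exists h.
have w0 h : h != 0 -> x h = 0 -> w (u h) = 0.
  move=> h0 xh; have h1 : vge w (u h) 0 by apply: wint; right; rewrite xh.
  have h2 : vge w (u h^-1) 0 by apply: wint; right; rewrite dvalV xh.
  rewrite fmorphV in h2; move: h1 h2; rewrite !vgeE ?invr_eq0 ?fmorph_eq0 // dvalV oppr_ge0.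
  by move=> h1 h2; apply/eqP; rewrite eq_le h1 h2.
exists w; exists (absz (w (u p))); first by lia.
move=> h; have [->|h0] := eqVneq h 0; first by rewrite rmorph0 !dval0 mul0rn.
have hE : h = unit_part x h * p ^ x h.
  by rewrite /unit_part -mulrA -expfzDr // addNr expr0z mulr1.
have [g0 xg] := unit_partP x h0.
rewrite {1}hE rmorphM dvalM ?fmorph_eq0 ?expfz_neq0 // w0 // add0r fmorphXz dvalXz ?fmorph_eq0 //.
by rewrite -mulr_natr natz gtz0_abs // mulrC.
Qed.

(** At a place above [x0] the nonzero terms have pairwise distinct values, since the prime [m] does
    not divide [x0 f]; a sum of such terms is not 0. *)
Lemma kummer_indep (h : nat -> S) : \sum_(i < m) u (h i) * y ^+ i = 0 ->
  forall i, (i < m)%N -> h i = 0.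
Proof.
have [w [e e0 wE]] := place_above_exists x0.
have y0 := kummer_root_neq0.
have wy : w y * m%:Z = x0 f *+ e by rewrite -dvalX // y_f wE.
move=> sum0.
have [|z|[i [lt _ n0 _]]] := @sum_distinct_dval Q w m (fun i => u (h i) * y ^+ i).
- move=> i j im jm; rewrite !mulf_eq0 !negb_or => /andP[ui _] /andP[uj _].
  rewrite !dvalM ?expf_neq0 // !wE !dvalX // => eq1.
  have eq2 := ramification_eq e0 wy eq1.
  have dv : (m %| `|x0 f| * `|i%:Z - j%:Z|)%N.
    rewrite -abszM; apply/dvdnP; exists (absz (x0 (h j) - x0 (h i))).
    by rewrite -[in RHS](absz_nat m) -abszM; congr absz; lia.
  move: dv; rewrite Euclid_dvdM // (negPf x0f) /= => /dvdnP[[|a] ea]; first by move: ea; lia.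
  by move: ea; rewrite mulSn; lia.
- move=> i im; have := z i im => /eqP; rewrite mulf_eq0 fmorph_eq0 => /orP[/eqP//|].
  by rewrite expf_eq0 (negPf y0) andbF.
- by rewrite sum0 eqxx in n0.
Qed.

Lemma zetaX_neq0 j : zeta ^+ j != 0.
Proof.
apply: expf_neq0; apply: contra_eq_neq (prim_expr_order zeta_prim) => ->.
by rewrite expr0n gtn_eqF // eq_sym oner_neq0.
Qed.

Lemma kummer_sum_mod (h : {poly S}) z : z ^+ m = u f ->
  (map_poly u h).[z] = \sum_(i < m) u (h %% ('X^m - f%:P))`_i * z ^+ i.
Proof.
move=> zf; pose p := 'X^m - f%:P; have sp : size p = m.+1 by rewrite size_XnsubC.
have p0 : p != 0 by rewrite -size_poly_gt0 sp.
rewrite {1}(divp_eq h p) rmorphD rmorphM hornerD hornerM.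
have -> : (map_poly u p).[z] = 0.
  by rewrite rmorphB /= map_polyXn map_polyC hornerD hornerN hornerXn hornerC zf subrr.
rewrite mulr0 add0r (@horner_coef_wide _ m); last first.
  by rewrite size_map_poly -ltnS -sp ltn_modp.
by apply: eq_bigr => i _; rewrite coef_map.
Qed.

(** Sending [y] to another root of [f] is well defined: a polynomial vanishing at [y] is 0 modulo
    X^m - f by [kummer_indep], so it vanishes at every root. *)
Lemma kummer_aut (a : k) : a ^+ m = 1 -> exists s : {rmorphism Q -> Q},
  Gal_elt u s /\ s y = u (c a) * y.
Proof.
move=> am; pose z := u (c a) * y.
have zf : z ^+ m = u f by rewrite exprMn -!rmorphXn am !rmorph1 mul1r y_f.
have /choice[P PP] := Q_gen.
pose s b := (map_poly u (P b)).[z].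
have sE (r : {poly S}) : s ((map_poly u r).[y]) = (map_poly u r).[z].
  set b := (map_poly u r).[y].
  have eP : (map_poly u (P b - r)).[y] = 0 by rewrite rmorphB hornerD hornerN -PP subrr.
  apply/eqP; rewrite -subr_eq0 -hornerN -hornerD -rmorphB; apply/eqP.
  rewrite (kummer_sum_mod _ y_f) in eP; rewrite (kummer_sum_mod _ zf).
  by apply: big1 => i _; rewrite (kummer_indep eP) // rmorph0 mul0r.
have sB : {morph s : v w / v - w}.
  move=> v w; rewrite (PP v) (PP w) -hornerN -hornerD -rmorphB !sE.
  by rewrite rmorphB hornerD hornerN.
have sM : {morph s : v w / v * w}.
  by move=> v w; rewrite (PP v) (PP w) -hornerM -rmorphM !sE rmorphM hornerM.
have su h : s (u h) = u h.
  by have := sE h%:P; rewrite map_polyC !hornerC.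
have s1 : s 1 = 1 by rewrite -(rmorph1 u) su.
have [s' s'E] := rmorphism_of sB sM s1; exists s'; split.
  by move=> h; rewrite s'E su.
by rewrite s'E; have := sE 'X; rewrite map_polyX !hornerX.
Qed.

Lemma Gal_elt_ext (s s' : {rmorphism Q -> Q}) : Gal_elt u s -> Gal_elt u s' -> s y = s' y ->
  forall z, s z = s' z.
Proof.
move=> gs gs' e z; have [h ->] := kummer_repr z; rewrite !rmorph_sum; apply: eq_bigr => i _.
by rewrite !rmorphM !rmorphXn gs gs' e.
Qed.

Lemma Gal_elt_root (s : {rmorphism Q -> Q}) : Gal_elt u s ->
  exists2 a : k, a ^+ m = 1 & s y = u (c a) * y.
Proof.
move=> gs; have y0 := kummer_root_neq0.
have sy : (s y / y) ^+ m = 1.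
  by rewrite exprMn exprVn -rmorphXn y_f gs divff // fmorph_eq0.
have zp : m.-primitive_root (u (c zeta)) by rewrite !fmorph_primitive_root.
have [i e] := prim_rootP zp sy; exists (zeta ^+ i).
  by rewrite -exprM mulnC exprM (prim_expr_order zeta_prim) expr1n.
by rewrite !rmorphXn -e divfK.
Qed.

End KummerExtension.

Lemma sum_root_of_unity (F : fieldType) m (z : F) : z ^+ m = 1 -> z != 1 -> \sum_(j < m) z ^+ j = 0.
Proof.
by move=> zm z1; apply/eqP; have := subrX1 z m; rewrite zm subrr => /esym/eqP; rewrite mulf_eq0 subr_eq0 (negPf z1).
Qed.

Lemma expf_pred (k : finFieldType) (a : k) : a != 0 -> a ^+ #|k|.-1 = 1.
Proof.
move=> a0; apply: (mulfI a0).
by rewrite mulr1 -exprS prednK ?expf_card // (ltn_trans _ (finRing_gt1 k)).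
Qed.

(** Fermat's theorem in the residue field: multiplication by a unit [h] permutes the nonzero
    residues and so preserves their product. *)
Lemma residue_frobenius (k : finFieldType) (S : fieldType) (c : {rmorphism k -> S})
    (S_ff : function_field c) (x : place S) h : vge x h 0 ->
  vge x (h - h ^+ (#|k| ^ place_deg c x)) 1.
Proof.
move=> hh; set Qx := (#|k| ^ place_deg c x)%N.
have Q0 : (0 < Qx)%N by rewrite expn_gt0 (ltn_trans _ (finRing_gt1 k)).
case: (pselect (vge x h 1)) => h1.
  by apply: vgeB => //; rewrite -(prednK Q0) exprSr; apply: vgeMl => //; apply: vgeX.
have h0 : h != 0 by apply: contra_notN h1 => /eqP->; apply: vge0.
have xh : x h = 0.
  move: hh h1; rewrite !vgeE // => h1 /negP h2; apply/eqP; rewrite eq_le h1 andbT.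
  by rewrite -ltzD1 add0r ltNge.
pose g (r : residues c x) := res S_ff x (h * rep S_ff r).
have hr (r : residues c x) : vge x (h * rep S_ff r) 0 by apply: vgeMl => //; apply: rep_int.
have ginj : injective g.
  move=> r r' /(res_eqP S_ff (hr r) (hr r')); rewrite -mulrBr => e.
  rewrite -(repK S_ff r) -(repK S_ff r'); apply/res_eqP; try exact: rep_int.
  rewrite -(mulKf h0 (rep S_ff r - _)); apply: vgeMl => //.
  by right; rewrite dvalV xh.
have g0 r : (g r != res0 c x) = (r != res0 c x).
  have gr0 : g (res0 c x) = res0 c x by rewrite /g rep0 mulr0 -(rep0 S_ff x) repK.
  by rewrite -{1}gr0 (inj_eq ginj).
pose P := \prod_(r : residues c x | r != res0 c x) rep S_ff r.
have [P0 xP] : P != 0 /\ x P = 0.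
  by apply: dval_prod => r r0; rewrite rep_eq0 r0 dval_rep.
have e1 : P = \prod_(r : residues c x | r != res0 c x) rep S_ff (g r).
  by rewrite /P (reindex_inj ginj); apply: eq_bigl => r; rewrite g0.
have e2 : h ^+ Qx.-1 * P = \prod_(r : residues c x | r != res0 c x) (h * rep S_ff r).
  by rewrite big_split /= prodr_const /Qx -card_residues -(cardC1 (res0 c x)).
have key : vge x (P - h ^+ Qx.-1 * P) 1.
  rewrite {1}e1 e2; apply: vge_prodB => r r0; [exact: rep_int|exact: hr|].
  by apply: vgeBC; apply: res_rep_near.
have -> : h - h ^+ Qx = h * (P^-1 * (P - h ^+ Qx.-1 * P)).
  by rewrite -{1}(prednK Q0) exprS mulrBr mulVf // mulrCA mulVf // mulr1 mulrBr mulr1.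
by apply: vgeMl => //; apply: vgeMl => //; right; rewrite dvalV xP.
Qed.

Lemma dval_of_fun (F : fieldType) (v : F -> int) : v 0 = 0 ->
  (forall a b, a != 0 -> b != 0 -> v (a * b) = v a + v b) ->
  (forall a b, a != 0 -> b != 0 -> a + b != 0 -> Num.min (v a) (v b) <= v (a + b)) ->
  (exists2 a, a != 0 & v a = 1) -> exists w : dvaluation F, forall a, w a = v a.
Proof. by move=> h0 hM hD hs; exists (DValuation h0 hM hD hs). Qed.

(** * Frobenius elements at unramified places *)

Section Frobenius.
Variables (k : finFieldType) (S : fieldType) (c : {rmorphism k -> S}).
Hypothesis S_ff : function_field c.
Variables (m : nat) (zeta : k).
Hypotheses (m_prime : prime m) (zeta_prim : m.-primitive_root zeta).
Variables (f : S) (x0 : place S).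
Hypotheses (f_neq0 : f != 0) (x0f : ~~ (m %| `|x0 f|)%N).
Variables (Q : fieldType) (u : {rmorphism S -> Q}) (y : Q) (y_f : y ^+ m = u f).
Hypothesis Q_gen : forall b : Q, exists r : {poly S}, b = (map_poly u r).[y].
Local Notation deg := (place_deg c).
Local Notation q := #|k|.
Local Notation cst := (u \o c : {rmorphism k -> Q}).

Let m_gt0 : (0 < m)%N. Proof. exact: prime_gt0. Qed.
Let aut := kummer_aut S_ff m_prime zeta_prim f_neq0 x0f y_f Q_gen.
Let y_neq0 : y != 0 := kummer_root_neq0 m_prime f_neq0 y_f.

Lemma order_dvd_card : (m %| q.-1)%N.
Proof.
rewrite (prim_order_dvd zeta_prim) expf_pred //.
by have := zetaX_neq0 m_prime zeta_prim 1; rewrite expr1.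
Qed.

Lemma order_neq0 : m%:R != 0 :> k.
Proof.
apply/negP => m0; have mk : m \in [pchar k] by rewrite inE m_prime.
have := pFrobenius_autB_comm mk (mulrC zeta 1).
rewrite !pFrobenius_autE (prim_expr_order zeta_prim) expr1n subrr => /eqP.
rewrite expf_eq0 m_gt0 /= subr_eq0 => /eqP z1.
by have := prim_order_dvd zeta_prim 1; rewrite z1 expr1n eqxx Euclid_dvd1.
Qed.

Lemma above_vge0 (w : place Q) x h : place_above u w x -> vge w (u h) 0 <-> vge x h 0.
Proof.
move=> [e e0 wE]; have [->|h0] := eqVneq h 0; first by rewrite rmorph0; split=> _; apply: vge0.
by rewrite !vgeE ?fmorph_eq0 // wE pmulrn_lge0.
Qed.

Lemma above_vge1 (w : place Q) x h : place_above u w x -> vge w (u h) 1 <-> vge x h 1.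
Proof.
move=> [e e0 wE]; have [->|h0] := eqVneq h 0; first by rewrite rmorph0; split=> _; apply: vge0.
by rewrite !vgeE ?fmorph_eq0 // wE -!gtz0_ge1 pmulrn_lgt0.
Qed.

(** The scalar by which a Frobenius element at an unramified [x] multiplies [y], as
    [frobenius_unique] shows. *)
Definition frob_root x : k := tame S_ff x f ^+ (q.-1 %/ m).

Lemma frob_root_neq0 x : frob_root x != 0.
Proof. by rewrite expf_neq0 ?tame_neq0. Qed.

Lemma frob_root_unity x : frob_root x ^+ m = 1.
Proof. by rewrite -exprM divnK ?order_dvd_card // expf_pred ?tame_neq0. Qed.

Section AtPlace.
Variable x : place S.
Hypothesis x_unr : (m %| `|x f|)%N.
Local Notation Qx := (q ^ deg x)%N.

Let j := (x f %/ m)%Z.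
Let jE : x f = j * m%:Z.
Proof. by rewrite /j divzK // dvdzE. Qed.

(** An m-th root of the unit part of [f] at [x], hence a unit above [x]; it exists because [m]
    divides [x f]. *)
Definition local_root := y * u (unif x ^ (- j)).

Lemma local_root_neq0 : local_root != 0.
Proof. by rewrite mulf_neq0 // fmorph_eq0 expfz_neq0 ?unif_neq0. Qed.

Lemma local_rootX : local_root ^+ m = u (unit_part x f).
Proof.
by rewrite exprMn y_f -rmorphXn /= -rmorphM /unit_part jE -mulNr -exprz_exp -exprnP.
Qed.

Lemma dval_local_root w : place_above u w x -> w local_root = 0.
Proof.
move=> [e _ wE]; have := dvalX w m local_root_neq0; rewrite local_rootX wE.
have [_ ->] := unit_partP x f_neq0; rewrite mul0rn => /esym/eqP.
by rewrite mulf_eq0 => /orP[/eqP//|]; rewrite eqz_nat gtn_eqF.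
Qed.

(** The exponent Qx - 1 is m times [norbits] times (q-1)/m. So the Qx-th power multiplies the root
    by a power of the unit part, which [tame_residue] evaluates. *)
Lemma local_root_frobenius w : place_above u w x ->
  vge w (u (c (frob_root x)) * local_root - local_root ^+ Qx) 1.
Proof.
move=> wx; have w0 := dval_local_root wx.
have yi : vge w local_root 0 by right; rewrite w0.
have Q0 : (0 < Qx)%N by rewrite expn_gt0 (ltn_trans _ (finRing_gt1 k)).
have -> : local_root ^+ Qx = u (unit_part x f ^+ norbits S_ff x ^+ (q.-1 %/ m)) * local_root.
  have qE : Qx.-1 = (m * (norbits S_ff x * (q.-1 %/ m)))%N.
    by rewrite -(norbitsE S_ff) -{1}(divnK order_dvd_card) mulnA mulnC.
  by rewrite -{1}(prednK Q0) exprSr qE exprM local_rootX -exprM rmorphXn.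
rewrite -mulrBl mulrC; apply: vgeMl => //; rewrite -rmorphB; apply/(above_vge1 _ wx).
rewrite /frob_root rmorphXn; apply: vge_expBn; first exact: vge_const.
  by apply: vgeX; apply: unit_part_int.
exact: tame_residue.
Qed.

Lemma above_const w (a : k) : place_above u w x -> vge w (u (c a)) 1 -> a = 0.
Proof.
move=> wx /(above_vge1 _ wx); have [//|a0] := eqVneq a 0.
rewrite vgeE ?fmorph_eq0 // (@dval_unity _ x (c a) q.-2) //.
rewrite -rmorphXn /= prednK ?expf_pred ?rmorph1 //.
by rewrite -ltnS prednK ?finRing_gt1 // (ltn_trans _ (finRing_gt1 k)).
Qed.

Lemma frobenius_unique (s : {rmorphism Q -> Q}) : frobenius_at c u x s ->
  s y = u (c (frob_root x)) * y.
Proof.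
move=> [gs [w wx sw]]; have [a _ sy] := Gal_elt_root c m_prime zeta_prim f_neq0 y_f gs.
rewrite sy; congr (u (c _) * _); apply/eqP; rewrite -subr_eq0; apply/eqP.
apply: (above_const wx); have w0 := dval_local_root wx.
have := sw local_root _; rewrite {1}/local_root rmorphM sy gs -mulrA -/local_root => h.
have {}h := vge_trans (h (or_intror _)) (vgeBC (local_root_frobenius wx)).
have {}h := h _; rewrite w0 in h; move: (h (lexx _)).
rewrite -mulrBl -!rmorphB mulrC => hh; rewrite -(mulKf local_root_neq0 (u _)).
by apply: vgeMl => //; right; rewrite dvalV w0.
Qed.

(* Averaging over the conjugates of [b] isolates [m] times each term of its expansion in powers of [y]. *)
Lemma kummer_resolvent (s : nat -> {rmorphism Q -> Q}) (h : nat -> S) i :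
  (forall l, Gal_elt u (s l) /\ s l y = u (c (zeta ^+ l)) * y) -> (i < m)%N ->
  \sum_(l < m) u (c (zeta ^+ ((m - i) * l))) * s l (\sum_(n < m) u (h n) * y ^+ n) =
  u (c m%:R) * (u (h i) * y ^+ i).
Proof.
move=> sP im.
transitivity (\sum_(n < m) u (h n) * y ^+ n * u (c (\sum_(l < m) (zeta ^+ (m - i + n)) ^+ l))).
  under eq_bigr do rewrite rmorph_sum mulr_sumr.
  rewrite exchange_big; apply: eq_bigr => n _; rewrite !rmorph_sum mulr_sumr; apply: eq_bigr => l _.
  have [gs sy] := sP l; rewrite (rmorphM (s l)) (rmorphXn (s l)) gs sy exprMn.
  by rewrite exprD exprMn -!exprM !(rmorphM, rmorphXn) /= [(n * l)%N]mulnC [_ ^+ (l * n)]exprM; ring.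
rewrite (bigD1 (Ordinal im)) //= [X in _ + X]big1 => [|n ni].
  rewrite addr0 (subnK (ltnW im)) (prim_expr_order zeta_prim) mulrC; congr (u (c _) * _).
  by rewrite (eq_bigr (fun=> 1)) ?sumr_const ?card_ord // => l _; rewrite expr1n.
rewrite sum_root_of_unity ?rmorph0 ?mulr0 //.
  by rewrite -exprM mulnC exprM (prim_expr_order zeta_prim) expr1n.
rewrite -(prim_order_dvd zeta_prim); apply: contra ni => dv; apply/eqP/val_inj => /=.
have := ltn_ord n; move: dv => /dvdnP[[|[|b]]]; move: im; lia.
Qed.

Lemma frobenius_exists : exists s : {rmorphism Q -> Q}, frobenius_at c u x s.
Proof.
have [s [gs sy]] := aut (frob_root_unity x); exists s; split=> //.
have [w wx] := place_above_exists S_ff m_prime zeta_prim f_neq0 x0f y_f Q_gen x.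
exists w => //.
have /choice[sg sgP] : forall l, exists t : {rmorphism Q -> Q}, Gal_elt u t /\ t y = u (c (zeta ^+ l)) * y.
  by move=> l; apply: aut; rewrite -exprM mulnC exprM (prim_expr_order zeta_prim) expr1n.
(* The elements integral at [w] and satisfying the Frobenius congruence are closed under products
   and sums, and include [local_root] and the integral elements of the base. *)
pose P b := vge w b 0 /\ vge w (s b - b ^+ Qx) 1.
have PM a b : P a -> P b -> P (a * b).
  move=> [a0 a1] [b0 b1]; split; first exact: vgeMl.
  rewrite rmorphM exprMn; apply: vge_mulB => //; last exact: vgeX.
  by rewrite -(subrK (a ^+ Qx) (s a)); apply: vgeD; [apply: vgeW a1|apply: vgeX].
have PD a b : P a -> P b -> P (a + b).
  move=> [a0 a1] [b0 b1]; split; first exact: vgeD.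
  have [p p_pr pk] := finPcharP k.
  rewrite rmorphD exprDn_pchar; last first.
    have pQ : p \in [pchar Q] by rewrite (fmorph_pchar (u \o c)).
    by rewrite (eq_pnat _ (pcharf_eq pQ)) /= pnatX (card_pprimeChar pk) pnatX pnat_id.
  by rewrite opprD addrACA; apply: vgeD.
have Pu h : vge x h 0 -> P (u h).
  move=> hh; split; first exact/(above_vge0 _ wx).
  by rewrite gs -rmorphXn -rmorphB; apply/(above_vge1 _ wx)/residue_frobenius.
have Py : P local_root.
  split; first by right; rewrite dval_local_root.
  by rewrite rmorphM sy gs -mulrA; apply: local_root_frobenius.
(* If all conjugates of [b] are integral, so are the resolvents, hence each term of the expansion of
   [b], as [m] is invertible. A term is an integral element of the base times a power of
   [local_root]. *)
have Pconj b : (forall l, (l < m)%N -> vge w (sg l b) 0) -> P b.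
  have [h bE] := kummer_repr m_prime y_f Q_gen b; move=> bint; rewrite bE.
  have Pt (i : 'I_m) : P (u (h i) * y ^+ i).
    have ti : vge w (u (h i) * y ^+ i) 0.
      have := kummer_resolvent h sgP (ltn_ord i); rewrite -bE => e.
      have m0 : u (c m%:R) != 0 by rewrite !fmorph_eq0 order_neq0.
      rewrite -(mulKf m0 (u (h i) * _)) -e -!fmorphV; apply: vgeMl; first exact: (vge_const (u \o c)).
      by apply: vge_sum => l _; apply: vgeMl; [exact: (vge_const (u \o c))|exact: bint].
    have p0 := unif_neq0 x.
    have tE : u (h i) * y ^+ i = u (h i * unif x ^ (j * i%:Z)) * local_root ^+ i.
      have e1 : u (unif x ^ (j * i%:Z)) * u (unif x ^ (- j)) ^+ i = 1.
        by rewrite -rmorphXn -rmorphM exprnP exprz_exp -expfzDr // mulNr subrr expr0z rmorph1.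
      transitivity (u (h i) * y ^+ i * (u (unif x ^ (j * i%:Z)) * u (unif x ^ (- j)) ^+ i)).
        by rewrite e1 mulr1.
      by rewrite exprMn rmorphM; ring.
    have Pyi : P (local_root ^+ i).
      elim: (nat_of_ord i) => [|n IH]; last by rewrite exprS; apply: PM.
      by rewrite expr0 -(rmorph1 u); apply: Pu; apply: vge1.
    rewrite tE; apply: PM => //; apply: Pu; apply/(above_vge0 _ wx).
    have r0 : local_root ^+ i != 0 by rewrite expf_neq0 ?local_root_neq0.
    rewrite -(mulfK r0 (u _)) -tE mulrC; apply: vgeMl => //.
    by right; rewrite dvalV dvalX ?local_root_neq0 // dval_local_root // mul0r.
  elim/big_rec: _ => [|i a _ Pa]; last exact: PD.
  by rewrite -(rmorph0 u); apply: Pu; apply: vge0.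
have conj t : exists w' : dvaluation Q, forall b, w' b = w (sg t b).
  have [gt ty] := sgP t.
  have [|t' [gt' t'y]] := @aut (zeta ^+ t)^-1.
    by rewrite exprVn -exprM mulnC exprM (prim_expr_order zeta_prim) expr1n invr1.
  have tt' b : sg t (t' b) = b.
    apply: (Gal_elt_ext m_prime y_f Q_gen (s := sg t \o t') (s' := idfun)) => //=.
      by move=> b' /=; rewrite gt' gt.
    by rewrite t'y rmorphM gt ty mulrA -!rmorphM mulVf ?(zetaX_neq0 m_prime zeta_prim) // !rmorph1 mul1r.
  have [||||w' w'E] := @dval_of_fun Q (fun b => w (sg t b)).
  - by rewrite rmorph0 dval0.
  - by move=> a b a0 b0; rewrite rmorphM dvalM ?fmorph_eq0.
  - by move=> a b a0 b0 ab0; rewrite rmorphD; apply: dvalD; rewrite ?fmorph_eq0 // -rmorphD fmorph_eq0.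
  - have [p p0 wp] := dval_surj w; exists (t' p); first by rewrite fmorph_eq0.
    by rewrite tt'.
  by exists w'.
have /choice[wc wcE] := conj.
have vgec l b n : vge (wc l) b n <-> vge w (sg l b) n.
  by have [->|b0] := eqVneq b 0; [rewrite rmorph0; split=> _; apply: vge0|rewrite !vgeE ?fmorph_eq0 // wcE].
have w0E : wc 0%N = w.
  apply: dval_eq => b; rewrite wcE; congr (w _).
  have [g0 y0] := sgP 0%N; apply: (Gal_elt_ext m_prime y_f Q_gen (s' := idfun)) => //.
  by rewrite y0 expr0 !rmorph1 mul1r.
have [l0 sE] : exists l0 : 'I_m, forall b, s b = sg l0 b.
  have [l0 le] := prim_rootP zeta_prim (frob_root_unity x); exists l0.
  have [gl yl] := sgP l0.
  by apply: (Gal_elt_ext m_prime y_f Q_gen) => //; rewrite sy yl le.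
pose ws := undup [seq wc l | l <- iota 0 m].
have wsP l : (l < m)%N -> wc l \in ws by move=> lm; rewrite mem_undup map_f // mem_iota.
have approx (F : dvaluation Q -> Q) : (forall l, (l < m)%N -> vge (wc l) (F (wc l)) 0) ->
    exists2 b, P b & forall l, (l < m)%N -> vge (wc l) (b - F (wc l)) 1.
  move=> Fi; have [b bP] := @weak_approximation Q ws F 1 (undup_uniq _).
  exists b; last by move=> l lm; apply: bP; apply: wsP.
  apply: Pconj => l lm; apply/vgec; rewrite -(subrK (F (wc l)) b).
  by apply: vgeD (Fi l lm); apply: vgeW (bP _ (wsP l lm)).
(* The automorphism preserves [w]: otherwise an element close to 1 at the conjugate place and to 0
   at [w] would violate its own congruence. *)
have wl0 : wc l0 = w.
  apply: contrapT => /eqP ne.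
  have [|b [b0 Pb] bP] := approx (fun z => if z == wc l0 then 1 else 0).
    by move=> l _; case: ifP => _; [apply: vge1|apply: vge0].
  have wb : vge w b 1.
    by have := bP 0%N m_gt0; rewrite w0E eq_sym (negPf ne) subr0.
  have wsb : vge w (s b) 1.
    rewrite -(subrK (b ^+ Qx) (s b)); apply: vgeD => //.
    have Q0 : (0 < Qx)%N by rewrite expn_gt0 (ltn_trans _ (finRing_gt1 k)).
    by rewrite -(prednK Q0) exprSr; apply: vgeMl => //; apply: vgeX.
  have := bP l0 (ltn_ord l0); rewrite eqxx => b1.
  have {}wsb : vge (wc l0) b 1 by apply/vgec; rewrite -sE.
  have : vge (wc l0) 1 1 by rewrite -(subKr b 1); apply: vgeB.
  by rewrite vgeE ?oner_neq0 // dval1.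
(* A general integral [b] is replaced by some [b'], close to [b] at [w] and to 0 at the other
   conjugate places, so that all its conjugates are integral. *)
move=> b wb; have [|b' [b'0 Pb'] b'P] := approx (fun z => if z == w then b else 0).
  by move=> l _; case: eqP => [->|_] //; apply: vge0.
have := b'P 0%N m_gt0; rewrite w0E eqxx => bb.
have sbb : vge w (s (b' - b)) 1 by rewrite sE; apply/vgec; rewrite wl0.
apply: vge_trans (vge_trans Pb' (vge_expBn _ _ _ bb)) => //.
by rewrite -rmorphB; have := vgeN sbb; rewrite -rmorphN opprB.
Qed.

End AtPlace.

End Frobenius.

Lemma count_mem_filter (X : eqType) (p : pred X) (s : seq X) x :
  count_mem x (filter p s) = if p x then count_mem x s else 0%N.
Proof.
rewrite count_filter; case: ifP => px.
  by apply: eq_count => z /=; case: eqP => // ->.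
by apply/eqP; rewrite -leqn0 leqNgt -has_count; apply/hasPn => z _ /=; case: eqP => // ->; rewrite px.
Qed.

Lemma seq_div_diff_outside (S : fieldType) d (T : 'I_d.+1 -> place S) (D : divisor S) : outside T D ->
  exists s s', [/\ D = seq_div s - seq_div s', forall i, T i \notin s & forall i, T i \notin s'].
Proof.
move=> oD; have [s [s' DE]] := seq_div_diff D; pose p x := [forall i, x != T i].
have pT i : p (T i) = false by apply/negbTE/forallPn; exists i; rewrite eqxx.
exists (filter p s), (filter p s'); split; try by move=> i; rewrite mem_filter pT.
apply: freeg_coeffP => x; rewrite coeffB !coeff_seq_div !count_mem_filter; case: ifP => px.
  by rewrite DE coeffB !coeff_seq_div.
move/forallPn: px => [i]; rewrite negbK => /eqP ->; rewrite oD; exact/esym/subrr.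
Qed.

(** * The Artin map *)

Section ArtinMap.
Variables (k : finFieldType) (S : fieldType) (c : {rmorphism k -> S}).
Hypothesis S_ff : function_field c.
Variables (m : nat) (zeta : k).
Hypotheses (m_prime : prime m) (zeta_prim : m.-primitive_root zeta).
Variables (f : S) (x0 : place S).
Hypotheses (f_neq0 : f != 0) (x0f : ~~ (m %| `|x0 f|)%N).
Variables (Q : fieldType) (u : {rmorphism S -> Q}) (y : Q) (y_f : y ^+ m = u f).
Hypothesis Q_gen : forall b : Q, exists r : {poly S}, b = (map_poly u r).[y].
Variables (d : nat) (T : 'I_d.+1 -> place S).
Hypothesis f_unr : forall x, (forall i, x != T i) -> (m %| `|x f|)%N.
Implicit Types (N D : divisor S) (x : place S).

Let m_gt0 : (0 < m)%N. Proof. exact: prime_gt0. Qed.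
Let aut := kummer_aut S_ff m_prime zeta_prim f_neq0 x0f y_f Q_gen.
Let y_neq0 : y != 0 := kummer_root_neq0 m_prime f_neq0 y_f.
Local Notation frob_root := (frob_root S_ff m f).

(** The scalar by which any Artin symbol of [N] multiplies [y], defined without constructing the
    symbol; see [artin_symbol_root]. *)
Definition artin_root N : k := \prod_(x <- dom N) frob_root x ^ coeff x N.

Lemma artin_rootE N s : uniq s -> {subset dom N <= s} -> artin_root N = \prod_(x <- s) frob_root x ^ coeff x N.
Proof.
move=> us sub; rewrite /artin_root [RHS](bigID (fun x => x \in dom N)) /=.
rewrite [X in _ = _ * X]big1 ?mulr1 => [|x xN]; last by rewrite coeff_outdom // expr0z.
rewrite -[RHS]big_filter; apply: perm_big; apply: uniq_perm; rewrite ?filter_uniq ?uniq_dom //.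
by move=> x; rewrite mem_filter; case: (boolP (x \in dom N)) => // /sub ->.
Qed.

Lemma artin_root0 : artin_root 0 = 1. Proof. by rewrite /artin_root dom0 big_nil. Qed.
Lemma artin_rootU x : artin_root << x >> = frob_root x.
Proof. by rewrite /artin_root domU1 big_seq1 coeffU eqxx mul1r expr1z. Qed.
Lemma artin_rootD D N : artin_root (D + N) = artin_root D * artin_root N.
Proof.
pose s := undup (dom D ++ dom N); have us : uniq s by apply: undup_uniq.
rewrite !(@artin_rootE _ s) //.
- by rewrite -big_split; apply: eq_bigr => x _; rewrite coeffD expfzDr ?frob_root_neq0.
- by move=> x xN; rewrite mem_undup mem_cat xN orbT.
- by move=> x xD; rewrite mem_undup mem_cat xD.
- by move=> x /domD_subset; rewrite mem_undup.
Qed.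
Lemma artin_root_neq0 N : artin_root N != 0.
Proof. by rewrite prodf_seq_neq0; apply/allP => x _ /=; rewrite expfz_neq0 // frob_root_neq0. Qed.
Lemma artin_rootN N : artin_root (- N) = (artin_root N)^-1.
Proof. by apply: (mulIf (artin_root_neq0 N)); rewrite -artin_rootD addNr artin_root0 mulVf ?artin_root_neq0. Qed.
Lemma artin_rootB D N : artin_root (D - N) = artin_root D / artin_root N.
Proof. by rewrite artin_rootD artin_rootN. Qed.
Lemma artin_rootMn D n : artin_root (D *+ n) = artin_root D ^+ n.
Proof. by elim: n => [|n IH]; rewrite ?mulr0n ?artin_root0 // mulrS artin_rootD IH exprS. Qed.
Lemma artin_root_unity N : artin_root N ^+ m = 1.
Proof.
rewrite /artin_root -prodrXl; apply: big1 => x _.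
by rewrite exprnP exprzAC -exprnP (frob_root_unity S_ff m_prime zeta_prim) // exp1rz.
Qed.

Lemma artin_symbol_root N (s : {rmorphism Q -> Q}) : artin_symbol c T u N s ->
  Gal_elt u s /\ s y = u (c (artin_root N)) * y.
Proof.
elim=> {N s} [x s xT fr|N N' s s' t _ [gs sy] _ [gs' s'y] ts].
  split; first by case: fr.
  by rewrite artin_rootU; apply: (frobenius_unique S_ff m_prime zeta_prim f_neq0 y_f (f_unr xT) fr).
have gt : Gal_elt u t by move=> h; rewrite -{1}(gs' h) ts gs.
split=> //; have := ts y; rewrite s'y sy rmorphM gt => e.
by rewrite artin_rootB !(rmorphM, fmorphV) /= mulrAC -e mulrAC mulfV ?mul1r // !fmorph_eq0 artin_root_neq0.
Qed.

Variable D1 : divisor S.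
Hypothesis D1_artin : artin_symbol c T u D1 (idfun : {rmorphism Q -> Q}).

Lemma artin_root_D1 : artin_root D1 = 1.
Proof.
have [_ /=] := artin_symbol_root D1_artin; rewrite -{1}[y]mul1r => /mulIf -/(_ y_neq0) /esym/eqP.
by rewrite !fmorph_eq1 => /eqP.
Qed.

(** The rules for [artin_symbol] only subtract, so 0 is reached as D1 - D1. *)
Lemma artin_exists0 : exists s, artin_symbol c T u 0 s.
Proof. by exists (idfun : {rmorphism Q -> Q}); rewrite -(subrr D1); apply: artin_sub D1_artin D1_artin _. Qed.

Lemma artin_existsB N N' : (exists s, artin_symbol c T u N s) -> (exists s, artin_symbol c T u N' s) ->
  exists s, artin_symbol c T u (N - N') s.
Proof.
move=> [s As] [s' As']; have [t [gt ty]] := aut (artin_root_unity (N - N')).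
have [gs sy] := artin_symbol_root As; have [gs' s'y] := artin_symbol_root As'; exists t; apply: artin_sub As As' _.
apply: (Gal_elt_ext m_prime y_f Q_gen (s := t \o s')) => //=; first by move=> h /=; rewrite gs' gt.
by rewrite s'y rmorphM gt ty sy mulrA -!rmorphM artin_rootB mulrCA divff ?artin_root_neq0 // mulr1.
Qed.

Lemma artin_exists N : outside T N -> exists s, artin_symbol c T u N s.
Proof.
move=> oN; have [s [s' [-> os os']]] := seq_div_diff_outside oN.
suff A r : (forall i, T i \notin r) -> exists s, artin_symbol c T u (seq_div r) s.
  by apply: artin_existsB; apply: A.
elim: r {s s' os os'} => [_|x r IH or]; first by rewrite seq_div_nil; apply: artin_exists0.
have xT i : x != T i by have := or i; rewrite inE negb_or eq_sym => /andP[].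
(* A sum is written with two differences, the only operation among the rules for [artin_symbol]. *)
have -> : seq_div (x :: r) = << x >> - (0 - seq_div r) by rewrite seq_div_cons sub0r opprK.
apply: artin_existsB; last apply: artin_existsB; last 2 first.
- exact: artin_exists0.
- by apply: IH => i; have := or i; rewrite inE negb_or => /andP[].
have [s fs] := frobenius_exists S_ff m_prime zeta_prim f_neq0 x0f y_f Q_gen (f_unr xT).
by exists s; apply: artin_frob.
Qed.

Lemma chi_fE (K : fieldType) (eps : K) (red : K -> k) (s : {rmorphism Q -> Q}) a :
  s y = u (c a) * y -> chi_f m eps red c u y s = root_lift m eps red a.
Proof.
move=> sy; rewrite /chi_f; case: pickP => [z|/(_ a)]; last by rewrite sy eqxx.
by rewrite sy => /eqP/(mulIf y_neq0)/fmorph_inj/fmorph_inj ->.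
Qed.

Lemma chi_artinE (K : fieldType) (eps : K) (red : K -> k) N : outside T N ->
  chi_artin m eps red c u y T N = root_lift m eps red (artin_root N).
Proof.
move=> /artin_exists[s As]; rewrite /chi_artin; case: xgetP => [z _ [s' As' ->]|/(_ (chi_f m eps red c u y s))[]].
  by apply: chi_fE; have [] := artin_symbol_root As'.
by exists s.
Qed.

End ArtinMap.

(** * Character sums over divisor classes *)

Section RootLift.
Variables (m n : nat) (K : fieldType) (eps : K).
Hypotheses (m_prime : prime m) (eps_prim : m.-primitive_root eps).
Hypothesis K_char0 : forall i, (0 < i)%N -> i%:R != 0 :> K.
Variables (k : finFieldType) (red : K -> k).
Hypothesis red_res : residue_map eps (m * n) red.

Local Notation A := (cyclo_ring eps (m * n)).
Local Notation RL := (root_lift m eps red).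
Local Notation zeta := (red eps).

Let m_gt0 : (0 < m)%N. Proof. exact: prime_gt0. Qed.

Lemma cyclo_ring_ev (r : {poly int}) : A (map_poly intr r).[eps].
Proof. by exists r, 0%N; rewrite expr0 mulr1. Qed.

Lemma cyclo_ringX i : A (eps ^+ i).
Proof. by have := cyclo_ring_ev 'X^i; rewrite map_polyXn hornerXn. Qed.

Lemma cyclo_ring_nat i : A i%:R.
Proof. by have := cyclo_ring_ev i%:R%:P; rewrite map_polyC hornerC /= rmorph_nat. Qed.

Lemma cyclo_ring_sum i : A (\sum_(j < i) eps ^+ j).
Proof.
have := cyclo_ring_ev (\sum_(j < i) 'X^j); rewrite rmorph_sum horner_sum.
by under eq_bigr do rewrite /= map_polyXn hornerXn.
Qed.

Lemma red0 : red 0 = 0.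
Proof. by case: red_res => r1 rB _ _; rewrite -{1}(subrr 1) rB ?subrr //; apply: (cyclo_ring_nat 1). Qed.

Lemma redX i : red (eps ^+ i) = zeta ^+ i.
Proof.
case: red_res => r1 _ rM _; elim: i => [|i IH]; first by rewrite !expr0 r1.
by rewrite !exprS rM ?IH //; [apply: (cyclo_ringX 1)|apply: cyclo_ringX].
Qed.

Lemma redD a b : A a -> A b -> red (a + b) = red a + red b.
Proof.
case: red_res => r1 rB rM _ Aa Ab.
have A0 : A 0 by apply: (cyclo_ring_nat 0).
have An : A (- b) by case: Ab => r [e re]; exists (- r), e; rewrite mulNr re rmorphN hornerN.
have redN : red (- b) = - red b by rewrite -(sub0r b) rB // red0 sub0r.
by rewrite -{1}[b]opprK rB // redN opprK.
Qed.

Lemma red_nat i : red i%:R = i%:R.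
Proof.
case: red_res => r1 _ _ _; elim: i => [|i IH]; first exact: red0.
rewrite !mulrSr redD; first by rewrite IH r1.
  exact: cyclo_ring_nat.
exact: (cyclo_ring_nat 1).
Qed.

Lemma red_sum i : red (\sum_(j < i) eps ^+ j) = \sum_(j < i) zeta ^+ j.
Proof.
elim: i => [|i IH]; first by rewrite !big_ord0 red0.
by rewrite !big_ord_recr /= redD ?IH ?redX //; [apply: cyclo_ring_sum|apply: cyclo_ringX].
Qed.

Lemma red_order_neq0 : m%:R != 0 :> k.
Proof.
have m0 := K_char0 m_gt0; case: red_res => r1 _ rM _.
have Ai : A m%:R^-1.
  (* 1/m is n/(mn), with a single factor mn in the denominator. *)
  exists n%:R, 1%N; rewrite expr1 natrM mulrA mulVf // mul1r.
  by rewrite rmorph_nat -[n%:R in RHS]polyC_natr hornerC.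
have := rM m%:R m%:R^-1 (cyclo_ring_nat m) Ai; rewrite divff // r1 red_nat => e.
by apply: contra_eq_neq e => ->; rewrite mul0r oner_neq0.
Qed.

(** If [eps] reduced to 1, the relation 1 + eps + ... + eps^(m-1) = 0 would reduce to m = 0, which
    [red_order_neq0] excludes; as [m] is prime, the order of the residue is [m]. *)
Lemma red_prim : m.-primitive_root zeta.
Proof.
case: red_res => r1 _ _ _.
have zm : zeta ^+ m = 1 by rewrite -redX (prim_expr_order eps_prim) r1.
have e1 : eps != 1.
  by apply: contra_eq_neq (prim_expr_order eps_prim) => e; have := prim_order_dvd eps_prim 1; rewrite e expr1n eqxx Euclid_dvd1.
have z1 : zeta != 1.
  apply: contra_neq red_order_neq0 => z1; have := red_sum m.
  rewrite (sum_root_of_unity (prim_expr_order eps_prim) e1) red0 z1.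
  by under eq_bigr do rewrite expr1n; rewrite sumr_const card_ord => <-.
have [i pz di] := prim_order_exists m_gt0 zm.
have i1 : i != 1%N by apply: contra_neq z1 => i1; have := prim_expr_order pz; rewrite i1 expr1.
by have /(prime_nt_dvdP m_prime i1) <- := di.
Qed.

Lemma root_liftE i : RL (zeta ^+ i) = eps ^+ i.
Proof.
rewrite /root_lift; case: pickP => [j /eqP|/(_ (Ordinal (ltn_pmod i m_gt0)))] /=.
  by rewrite redX => /eqP; rewrite (eq_prim_root_expr red_prim) -(eq_prim_root_expr eps_prim) => /eqP.
by rewrite redX prim_expr_mod ?red_prim // eqxx.
Qed.

Lemma root_lift_repr a : a ^+ m = 1 -> exists i, a = zeta ^+ i.
Proof. by move=> /(prim_rootP red_prim)[i ->]; exists i. Qed.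

Lemma root_liftM a b : a ^+ m = 1 -> b ^+ m = 1 -> RL (a * b) = RL a * RL b.
Proof. by move=> /root_lift_repr[i ->] /root_lift_repr[j ->]; rewrite -exprD !root_liftE exprD. Qed.

Lemma root_lift1 : RL 1 = 1.
Proof. by rewrite -(expr0 zeta) root_liftE. Qed.

Lemma root_liftX a i : a ^+ m = 1 -> RL (a ^+ i) = RL a ^+ i.
Proof. by move=> /root_lift_repr[j ->]; rewrite -exprM !root_liftE exprM. Qed.

Lemma root_lift_prod (I : Type) (r : seq I) (P : pred I) (G : I -> k) :
  (forall i, P i -> G i ^+ m = 1) -> RL (\prod_(i <- r | P i) G i) = \prod_(i <- r | P i) RL (G i).
Proof.
move=> h; suff [] : RL (\prod_(i <- r | P i) G i) = \prod_(i <- r | P i) RL (G i) /\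
  (\prod_(i <- r | P i) G i) ^+ m = 1 by [].
elim/big_rec2: _ => [|i b a Pi [<- am]]; first by rewrite root_lift1 expr1n.
by rewrite exprMn h // am mulr1 root_liftM ?h.
Qed.

Lemma root_lift_eq1 a : a ^+ m = 1 -> RL a = 1 -> a = 1.
Proof.
move=> /root_lift_repr[i ->]; rewrite root_liftE => /eqP.
by rewrite -(prim_order_dvd eps_prim) => /dvdnP[j ->]; rewrite mulnC exprM (prim_expr_order red_prim) expr1n.
Qed.

End RootLift.

(** * Weil reciprocity for the equation of the covering *)

Section Reciprocity.
Variables (k : finFieldType) (S : fieldType) (c : {rmorphism k -> S}).
Hypothesis S_ff : function_field c.
Variables (m : nat) (f : S).
Hypotheses (m_gt0 : (0 < m)%N) (f_neq0 : f != 0) (m_dvd : (m %| #|k|.-1)%N).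
Variables (d : nat) (T : 'I_d.+1 -> place S) (a : 'I_d.+1 -> nat) (Dbar : divisor S).
Hypothesis f_div : is_div f (\sum_i << T i >> *+ a i + Dbar *+ m).
Local Notation q := #|k|.
Local Notation deg := (place_deg c).
Local Notation r := (q.-1 %/ m)%N.
Local Notation artin_root := (artin_root S_ff m f).
Local Notation tame := (tame S_ff).

Lemma f_outside x : (forall i, x != T i) -> (m %| `|x f|)%N.
Proof.
move=> xT; case: f_div => _ fE; rewrite -fE coeffD coeff_sum big1 => [|i _].
  by rewrite add0r coeffMn -mulr_natr natz abszM absz_nat dvdn_mull.
have /negPf e : T i != x by rewrite eq_sym xT.
by rewrite coeffMn coeffU e mulr0 mul0rn.
Qed.

Definition replicate (X : Type) n (l : seq X) := flatten (nseq n l).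
Definition branch_list := flatten [seq nseq (a i) (T i) | i <- enum 'I_d.+1].

Lemma seq_div_replicate n (l : seq (place S)) : seq_div (replicate n l) = seq_div l *+ n.
Proof. by elim: n => [|n IH]; rewrite /replicate /= ?seq_div_nil // seq_div_cat IH mulrS. Qed.

Lemma prod_replicate n (X : Type) (l : seq X) (G : X -> k) :
  \prod_(x <- replicate n l) G x = (\prod_(x <- l) G x) ^+ n.
Proof. by elim: n => [|n IH]; rewrite /replicate /= ?big_nil // big_cat IH exprS. Qed.

Lemma seq_div_branch : seq_div branch_list = \sum_i << T i >> *+ a i.
Proof.
rewrite /branch_list /seq_div big_flatten big_map big_enum; apply: eq_bigr => i _.
by rewrite big_nseq; elim: (a i) => //= n ->; rewrite mulrS.
Qed.

Lemma prod_branch (G : place S -> k) : \prod_(x <- branch_list) G x = \prod_i G (T i) ^+ a i.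
Proof.
rewrite /branch_list big_flatten big_map big_enum; apply: eq_bigr => i _.
by rewrite big_nseq; elim: (a i) => //= n ->; rewrite exprS.
Qed.

Lemma artin_root_seq_div l : artin_root (seq_div l) = tame_list S_ff f l ^+ r.
Proof.
elim: l => [|x l IH]; first by rewrite seq_div_nil artin_root0 /tame_list big_nil expr1n.
by rewrite seq_div_cons artin_rootD // artin_rootU IH /tame_list big_cons exprMn.
Qed.

(** Weil reciprocity for [f] and [h], raised to the power (q-1)/m. The part [Dbar *+ m] contributes
    (q-1)-th powers, equal to 1, so only the tame symbols of [h] at the branch points remain. *)
Lemma artin_root_divf h : h != 0 -> (forall i, T i h = 0) ->
  artin_root (divf h) = \prod_i tame (T i) h ^+ (a i * r).
Proof.
move=> h0 hT; have oh : outside T (divf h) by move=> i; rewrite (coeff_divf S_ff).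
have [hp [hm [hE hpT hmT]]] := seq_div_diff_outside oh.
have [bp [bm bE]] := seq_div_diff Dbar.
have fE : divf f = seq_div (branch_list ++ replicate m bp) - seq_div (replicate m bm).
  by rewrite -(is_div_unique S_ff f_div) bE seq_div_cat !seq_div_replicate seq_div_branch mulrnBl addrA.
pose G z := \prod_(x <- hp ++ hm) swap_sign c z x.
have := congr1 (fun z => z ^+ r) (weil_reciprocity S_ff f_neq0 h0 fE hE).
have Xm (z : k) : z != 0 -> z ^+ m ^+ r = 1.
  by move=> z0; rewrite -exprM mulnC divnK // expf_pred.
have e0 x z : swap_sign c x z != 0.
  rewrite /swap_sign; case: ifP => _; rewrite ?oner_neq0 // expf_neq0 //.
  by apply: contra_eq_neq (wilson_sqr k) => ->; rewrite mul0r eq_sym oner_neq0.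
have G0 z : G z != 0.
  by rewrite prodf_seq_neq0; apply/allP => x _; rewrite /= e0.
(* [h] has as many zeros as poles, counted with degree, so the sign at [T i] has an even
   exponent. *)
have GT i : G (T i) = 1.
  have deg_eq : (\sum_(x <- hp) deg x = \sum_(x <- hm) deg x)%N.
    have := div_deg_divf S_ff h0; rewrite hE div_degB !div_deg_seq_div => /eqP.
    by rewrite subr_eq0 => /eqP[].
  rewrite /G big_seq (eq_bigr (fun x => wilson k ^+ (deg (T i) * deg x))) => [|x]; last first.
    rewrite mem_cat /swap_sign; case: eqP => // <-.
    by rewrite (negPf (hpT i)) (negPf (hmT i)).
  rewrite -big_seq -expr_sum -big_distrr big_cat /= deg_eq addnn -muln2 mulnA exprM.
  by rewrite exprAC expr2 wilson_sqr expr1n.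
rewrite -[X in (_ * X) ^+ _ = _]/(\prod_(z <- _) G z) !exprMn big_cat /= -!artin_root_seq_div /tame_list !(big_cat, prod_replicate, prod_branch) /=.
have -> : \prod_i G (T i) ^+ a i = 1 by apply: big1 => i _; rewrite GT expr1n.
rewrite !exprMn expr1n !Xm ?prodf_seq_neq0; try (by apply/allP => x _ /=; rewrite ?tame_neq0).
rewrite !(mul1r, mulr1) => e; rewrite hE artin_rootB // e mulrC mulKf ?artin_root_neq0 // -prodrXl.
by apply: eq_bigr => i _; rewrite -exprM.
Qed.

Lemma tame_rational x h b : deg x = 1%N -> h != 0 -> x h = 0 -> vge x (h - c b) 1 -> tame x h = b.
Proof.
move=> dx h0 xh hb; have := tame_residue S_ff x h0.
have -> : norbits S_ff x = 1%N.
  have q1 : (0 < q.-1)%N by rewrite -ltnS prednK ?finRing_gt1 // (ltn_trans _ (finRing_gt1 k)).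
  by apply/eqP; rewrite -(eqn_pmul2r q1) norbitsE dx expn1 mul1n.
rewrite expr1 /unit_part xh oppr0 expr0z mulr1 => hc.
apply/eqP; rewrite -subr_eq0; apply/eqP; have := vge_trans hc hb; rewrite -rmorphB.
have [//|n0] := eqVneq (tame x h - b) 0.
have := vge_const c x (tame x h - b)^-1 => h1 h2; have := vgeMl h1 h2.
by rewrite -rmorphM mulVf // rmorph1 vgeE ?oner_neq0 // dval1.
Qed.

End Reciprocity.

Lemma partition_big_seq (R : nmodType) (I J : eqType) (s : seq I) (t : seq J) (p : I -> J) (G : I -> R) :
  uniq t -> {in s, forall i, p i \in t} ->
  \sum_(i <- s) G i = \sum_(j <- t) \sum_(i <- s | p i == j) G i.
Proof.
move=> ut pt; rewrite (exchange_big_dep xpredT) //= [LHS]big_seq [RHS]big_seq.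
apply: eq_bigr => i /pt pit; rewrite (eq_bigl (fun j => j == p i)) => [|j]; last by rewrite eq_sym.
by rewrite -big_filter filter_pred1_uniq // big_seq1.
Qed.

(** * Sections and their values at the branch points *)

Section Residues.
Variables (k : finFieldType) (S : fieldType) (c : {rmorphism k -> S}).
Hypothesis S_ff : function_field c.
Variables (d : nat) (T : 'I_d.+1 -> place S).
Hypotheses (T_inj : injective T) (T_rat : forall i, place_deg c (T i) = 1%N).
Local Notation q := #|k|.
Local Notation deg := (place_deg c).
Local Notation Deg := (div_deg c).
Local Notation E := (\sum_i << T i >> : divisor S).

Definition values (h : S) : {ffun 'I_d.+1 -> k} :=
  [ffun i => xget 0 [set b : k | vge (T i) (h - c b) 1]].

Lemma vge_const1 x (b : k) : vge x (c b) 1 -> b = 0.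
Proof.
have [//|b0] := eqVneq b 0; move=> hb; have := vgeMl (vge_const c x b^-1) hb.
by rewrite -rmorphM mulVf // rmorph1 vgeE ?oner_neq0 // dval1.
Qed.

Lemma valuesP h i : vge (T i) h 0 -> vge (T i) (h - c (values h i)) 1.
Proof.
move=> hi; rewrite ffunE; apply: (@xgetPex _ 0 [set b : k | vge (T i) (h - c b) 1]).
have inj : injective (fun b : k => res S_ff (T i) (c b)).
  move=> b b' /res_eqP e; apply/eqP; rewrite -subr_eq0; apply/eqP/(@vge_const1 (T i)).
  by rewrite rmorphB; apply: e; apply: vge_const.
have [|g gK Kg] := inj_card_bij inj; first by rewrite card_residues T_rat expn1.
exists (g (res S_ff (T i) h)); apply/(res_eqP S_ff) => //; exact: vge_const.
Qed.

Lemma valuesE h i b : vge (T i) (h - c b) 1 -> values h i = b.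
Proof.
move=> hb; have hi : vge (T i) h 0.
  by rewrite -(subrK (c b) h); apply: vgeD (vge_const _ _ _); apply: vgeW hb.
have := vge_trans (vgeBC (valuesP hi)) hb; rewrite -rmorphB => /vge_const1/eqP.
by rewrite subr_eq0 => /eqP.
Qed.

Lemma values_neq0 h i : h != 0 -> vge (T i) h 0 -> (values h i != 0) = (T i h == 0).
Proof.
move=> h0 hi; apply/idP/eqP => [v0|xh].
  have c0 : c (values h i) != 0 by rewrite fmorph_eq0.
  have xc : T i (c (values h i)) = 0.
    have := vge_const c (T i) (values h i); have := vge_const c (T i) (values h i)^-1.
    rewrite fmorphV !vgeE ?invr_eq0 // dvalV oppr_ge0 => h1 h2.
    by apply/eqP; rewrite eq_le h1 h2.
  have lt1 : T i (c (values h i)) < 1 by rewrite xc.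
  by have [_ ->] := dval_near c0 lt1 (valuesP hi).
apply/eqP => v0; have := valuesP hi; rewrite v0 rmorph0 subr0 vgeE // xh //.
Qed.

Lemma coeff_branch x : coeff x E = (x \in codom T)%:Z.
Proof.
rewrite coeff_sum; case: codomP => [[i ->]|nx].
  rewrite (bigD1 i) //= coeffU eqxx big1 => [|j ji].
    by rewrite addr0 mulr1.
  by rewrite coeffU (inj_eq T_inj) (negPf ji) mulr0.
rewrite big1 // => i _; rewrite coeffU; case: eqP => [e|_]; last by rewrite mulr0.
by case: nx; exists i.
Qed.

Lemma branch_seq_div : E = seq_div [seq T i | i <- enum 'I_d.+1].
Proof. by rewrite /seq_div big_map big_enum. Qed.

Section Sections.
Variable D0 : divisor S.
Hypothesis D0_out : outside T D0.

Lemma section_integral h i : sections D0 h -> vge (T i) h 0.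
Proof. by move=> /(_ (T i)); rewrite /stalk /= D0_out oppr0. Qed.

Lemma values_sectionsB v w : sections D0 v -> sections D0 w -> values v = values w ->
  sections (D0 - E) (v - w).
Proof.
move=> hv hw e x; rewrite /stalk /= coeffB coeff_branch; case: codomP => [[i ->]|_].
  rewrite D0_out sub0r opprK; have := valuesP (section_integral i hv); rewrite e => h.
  exact: vge_trans h (vgeBC (valuesP (section_integral i hw))).
by rewrite subr0; apply: vgeB; [apply: hv|apply: hw].
Qed.

Lemma values_sectionsD v w : sections D0 v -> sections (D0 - E) w ->
  sections D0 (v + w) /\ values (v + w) = values v.
Proof.
move=> hv hw; split.
  apply: sectionsD hv (sections_le _ hw) => x; rewrite coeffB coeff_branch.
  by rewrite gerBl.
apply/ffunP => i; apply: valuesE; have := hw (T i).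
rewrite /stalk /= coeffB coeff_branch D0_out sub0r opprK codom_f addrAC => hi.
by apply: vgeD => //; apply: valuesP; apply: section_integral.
Qed.

Lemma values_big (R : nmodType) (im : pred {ffun 'I_d.+1 -> k}) (G : {ffun 'I_d.+1 -> k} -> R) :
  (forall z, im z <-> exists2 v, sections D0 v & values v = z) ->
  \sum_(h <- fset_set (sections D0) | [forall i, values h i != 0]) G (values h) =
  (\sum_(z | im z && [forall i, z i != 0]) G z) *+ (q ^ ell c (D0 - E)).
Proof.
move=> imP; pose H (z : {ffun 'I_d.+1 -> k}) := if [forall i, z i != 0] then G z else 0.
rewrite big_mkcond -(cardL_ell S_ff).
rewrite (@big_fibers _ _ _ _ _ (finite_sections S_ff _) values_sectionsB values_sectionsD _ 0 +%R im H) //.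
rewrite -sumrMnl big_mkcondr; apply: eq_bigr => z _.
by rewrite iter_addr_0 /H; case: ifP; rewrite // mul0rn.
Qed.

Variable n : nat.
Hypothesis D0_deg : Deg D0 = n%:Z.

Definition eff_out : set (divisor S) := [set D | [/\ effective D, outside T D & Deg D = n%:Z]].

Lemma finite_eff_out : finite_set eff_out.
Proof. by apply: sub_finite_set (finite_effective S_ff n) => D []. Qed.

Lemma section_divisor h : sections D0 h -> [forall i, values h i != 0] ->
  h != 0 /\ eff_out (D0 + divf h).
Proof.
move=> hh /forallP hT; have h0 : h != 0.
  apply: contraTneq (hT ord0) => ->; rewrite negbK; apply/eqP/valuesE.
  by rewrite rmorph0 subrr; apply: vge0.
split=> //; split.
- by move=> x; rewrite coeff0 coeffD (coeff_divf S_ff) // addrC; have /(sectionsP D0 h0) := hh.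
- move=> i; rewrite coeffD D0_out (coeff_divf S_ff) // add0r.
  by apply/eqP; rewrite -values_neq0 //; apply: section_integral.
by rewrite div_degD div_deg_divf // addr0.
Qed.

Lemma divisor_section D : eff_out D -> lin_equiv D D0 ->
  exists h, [/\ sections D0 h, [forall i, values h i != 0] & D = D0 + divf h].
Proof.
move=> [eD oD dD] [h hdiv]; have h0 : h != 0 by case: hdiv.
have DE : D = D0 + divf h by rewrite -(is_div_unique S_ff hdiv) addrC subrK.
have hs : sections D0 h.
  by apply/(sectionsP _ h0) => x; have := eD x; rewrite DE coeff0 coeffD (coeff_divf S_ff) // addrC.
exists h; split=> //; apply/forallP => i; rewrite values_neq0 //; last exact: section_integral.
by have := oD i; rewrite DE coeffD D0_out add0r (coeff_divf S_ff) // => ->.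
Qed.

Lemma values_scale (a : k) h i : vge (T i) h 0 -> values (c a * h) i = a * values h i.
Proof.
move=> hi; apply: valuesE; rewrite rmorphM -mulrBr.
by apply: vgeMl; [apply: vge_const|apply: valuesP].
Qed.

Lemma values_scale_neq0 (a : k) h : a != 0 -> sections D0 h ->
  [forall i, values (c a * h) i != 0] = [forall i, values h i != 0].
Proof.
move=> a0 hh; apply: eq_forallb => i.
by rewrite values_scale ?mulf_eq0 ?(negPf a0) //; apply: section_integral.
Qed.

Lemma count_sections D : eff_out D -> lin_equiv D D0 ->
  count (fun h => [forall i, values h i != 0] && (D0 + divf h == D)) (fset_set (sections D0)) = q.-1.
Proof.
move=> DE DL; have [h [hh hT ->]] := divisor_section DE DL; have finA := finite_sections S_ff D0.
have [h0 _] := section_divisor hh hT.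
rewrite -size_filter -(cardC1 (0 : k)) cardE -(size_map (fun a => c a * h)).
apply/perm_size/uniq_perm; first by rewrite filter_uniq ?fset_uniq.
  by rewrite map_inj_uniq ?enum_uniq // => a b /(mulIf h0)/fmorph_inj.
move=> v; rewrite mem_filter in_fset_set //; apply/andP/mapP => [[/andP[vT /eqP ve] /set_mem hv]|[a]].
  have [v0 _] := section_divisor hv vT.
  by have [a a0 ->] := divf_eq S_ff v0 h0 (addrI _ ve); exists a => //; rewrite mem_enum inE.
rewrite mem_enum inE => a0 ->; rewrite values_scale_neq0 // hT; split; last first.
  by apply: mem_set; apply: sections_scale.
by rewrite (divfM S_ff) ?fmorph_eq0 // (divf_const S_ff) // add0r eqxx.
Qed.

(* Effective divisors in the class of [D0] are sections up to [k^*]. *)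
Lemma class_sum (R : pzSemiRingType) (F : divisor S -> R) :
  (\sum_(D <- fset_set eff_out | `[< lin_equiv D D0 >]) F D) *+ q.-1 =
  \sum_(h <- fset_set (sections D0) | [forall i, values h i != 0]) F (D0 + divf h).
Proof.
have finA := finite_sections S_ff D0; have finE := finite_eff_out.
transitivity (\sum_(h <- fset_set (sections D0) | [forall i, values h i != 0])
    \sum_(D <- fset_set eff_out | `[< lin_equiv D D0 >] && (D0 + divf h == D)) F D); last first.
  rewrite big_seq_cond [RHS]big_seq_cond; apply: eq_bigr => h.
  rewrite in_fset_set // => /andP[/set_mem hh hT]; have [h0 hE] := section_divisor hh hT.
  have DL : `[< lin_equiv (D0 + divf h) D0 >].
    by apply/asboolP; exists h; rewrite addrC addKr; apply: (is_div_divf S_ff).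
  rewrite (eq_bigl (fun D => D == D0 + divf h)) => [|D]; last first.
    by rewrite eq_sym; case: eqP => [->|]; rewrite ?DL ?andbF.
  rewrite -big_filter filter_pred1_uniq ?fset_uniq ?big_seq1 // in_fset_set //; exact: mem_set.
rewrite (exchange_big_dep (fun D => `[< lin_equiv D D0 >])) => [|h D _ /andP[]//] /=.
rewrite -sumrMnl big_seq_cond [RHS]big_seq_cond; apply: eq_bigr => D.
rewrite in_fset_set // => /andP[/set_mem DE DL].
rewrite (eq_bigl (fun h => [forall i, values h i != 0] && (D0 + divf h == D))) => [|h]; last by rewrite DL.
by rewrite big_const_seq iter_addr_0 count_sections //; apply/asboolP.
Qed.

End Sections.
End Residues.

Lemma values_surj (k : finFieldType) (S : fieldType) (c : {rmorphism k -> S}) (S_ff : function_field c)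
    (d : nat) (T : 'I_d.+1 -> place S) (D : divisor S) :
  injective T -> (forall i, place_deg c (T i) = 1%N) -> outside T D ->
  (forall al, adele al -> exists h, adele_le (D - \sum_i << T i >>) (fun x => al x - h)) ->
  forall z : {ffun 'I_d.+1 -> k}, exists2 v, sections D v & values c T v = z.
Proof.
move=> T_inj T_rat oD van z.
pose al x := if [pick i | T i == x] is Some i then c (z i) else 0.
have alT i : al (T i) = c (z i).
  by rewrite /al; case: pickP => [j /eqP/T_inj-> //|/(_ i)]; rewrite eqxx.
have [|||v [hv vz]] := @local_section _ D [seq T i | i <- enum 'I_d.+1] al.
- by rewrite map_inj_uniq ?enum_uniq.
- by rewrite -branch_seq_div.
- by move=> x /mapP[i _ ->]; rewrite alT oD oppr0; apply: vge_const.
exists v => //; apply/ffunP => i; apply: (valuesE S_ff T_rat); rewrite -alT.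
by have := vz (T i); rewrite oD subr0; apply; apply: map_f; rewrite mem_enum.
Qed.

(** * Character sums over the torus and over the hyperplane *)

Section CharacterSums.
Variables (m n : nat) (K : fieldType) (eps : K).
Hypotheses (m_prime : prime m) (eps_prim : m.-primitive_root eps).
Hypothesis K_char0 : forall i, (0 < i)%N -> i%:R != 0 :> K.
Variables (k : finFieldType) (red : K -> k).
Hypothesis red_res : residue_map eps (m * n) red.
Local Notation q := #|k|.
Local Notation RL := (root_lift m eps red).
Local Notation chi := (chi_p m eps red).

Let m_gt0 : (0 < m)%N. Proof. exact: prime_gt0. Qed.
Let zeta_prim := red_prim m_prime eps_prim K_char0 red_res.
Let m_dvd := order_dvd_card m_prime zeta_prim.

Lemma chi_base_unity (b : k) : b != 0 -> (b ^+ (q.-1 %/ m)) ^+ m = 1.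
Proof. by move=> b0; rewrite -exprM divnK // expf_pred. Qed.

Lemma chi_pE (b : k) : chi b = RL (b ^+ (q.-1 %/ m)).
Proof. by rewrite /chi_p subn1. Qed.

Lemma chi_pM (a b : k) : a != 0 -> b != 0 -> chi (a * b) = chi a * chi b.
Proof.
move=> a0 b0; rewrite !chi_pE exprMn.
by rewrite (root_liftM m_prime eps_prim K_char0 red_res) ?chi_base_unity.
Qed.

Lemma chi_pX_mod (b : k) j : b != 0 -> (m %| j)%N -> chi b ^+ j = 1.
Proof.
move=> b0 /dvdnP[i ->]; rewrite mulnC exprM chi_pE.
rewrite -(root_liftX m_prime eps_prim K_char0 red_res) ?chi_base_unity //.
by rewrite (root_lift1 m_prime eps_prim K_char0 red_res) expr1n.
Qed.

(** The polynomial X^(j(q-1)/m) - 1 has fewer than q - 1 roots when j < m. *)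
Lemma chi_p_nontrivial j : (0 < j < m)%N -> exists2 b : k, b != 0 & chi b ^+ j != 1.
Proof.
move=> /andP[j0 jm]; apply: contrapT => no.
have q1 : (0 < q.-1)%N by rewrite -ltnS prednK ?finRing_gt1 // (ltn_trans _ (finRing_gt1 k)).
have r0 : (0 < q.-1 %/ m)%N by rewrite divn_gt0 // dvdn_leq.
have := @max_unity_roots k (q.-1 %/ m * j) (enum [pred b : k | b != 0]).
rewrite muln_gt0 r0 j0 enum_uniq => /(_ isT) H.
have {}H : (q.-1 <= q.-1 %/ m * j)%N.
  rewrite -{1}(cardC1 (0 : k)) cardE; apply: H => //; apply/allP => b; rewrite mem_enum inE => b0.
  apply/unity_rootP; apply: (root_lift_eq1 m_prime eps_prim K_char0 red_res).
    by rewrite -exprM mulnAC divnK // exprM expf_pred // expr1n.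
  rewrite exprM (root_liftX m_prime eps_prim K_char0 red_res) ?chi_base_unity // -chi_pE.
  by apply: contrapT => /eqP ne; apply: no; exists b.
by move: H; rewrite -{1}(divnK m_dvd) leq_pmul2l // leqNgt jm.
Qed.

Lemma chi_p_sum0 j : (0 < j < m)%N -> \sum_(b : k | b != 0) chi b ^+ j = 0.
Proof.
move=> jm; have [a a0 ca] := chi_p_nontrivial jm; apply/eqP.
have e : \sum_(b : k | b != 0) chi b ^+ j = chi a ^+ j * \sum_(b : k | b != 0) chi b ^+ j.
  rewrite {1}(reindex_inj (mulfI a0)) mulr_sumr.
  rewrite (eq_bigl (fun b => b != 0)) => [|b]; last by rewrite mulf_eq0 negb_or a0.
  by apply: eq_bigr => b b0; rewrite chi_pM // exprMn.
move/eqP: e; rewrite -subr_eq0 -{1}[X in X - _]mul1r -mulrBl mulf_eq0 subr_eq0 eq_sym.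
by rewrite (negPf ca).
Qed.

Lemma torus_sum0 d (a : 'I_d.+1 -> nat) : (forall i, (0 < a i < m)%N) ->
  \sum_(z : {ffun 'I_d.+1 -> k} | [forall i, z i != 0]) \prod_i chi (z i) ^+ a i = 0.
Proof.
move=> am; rewrite (eq_bigl (fun z : {ffun 'I_d.+1 -> k} => z \in ffun_on (fun b => b != 0))) => [|z]; last first.
  by apply/forallP/ffun_onP.
rewrite -(bigA_distr_big _ (fun i b => chi b ^+ a i)) /=.
by rewrite big_ord_recl chi_p_sum0 // mul0r.
Qed.

(** Write z = (b, -) with the remaining coordinates equal to b w. The characters of [b] collect to
    an exponent divisible by [m], hence to 1; the equation becomes sum of w = -1, and [b] takes q -
    1 values. *)
Lemma hyperplane_sum d (a : 'I_d.+1 -> nat) : (m %| \sum_i a i)%N ->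
  \sum_(z : {ffun 'I_d.+1 -> k} | (z ord0 == - \sum_(i < d) z (lift ord0 i)) && [forall i, z i != 0])
     \prod_i chi (z i) ^+ a i =
  (\sum_(w : {ffun 'I_d -> k} | [forall i, w i != 0] && (\sum_i w i == -1))
     \prod_i chi (w i) ^+ a (lift ord0 i)) *+ q.-1.
Proof.
move=> am; rewrite (partition_big (fun z : {ffun 'I_d.+1 -> k} => z ord0) (fun b => b != 0)) /=; last first.
  by move=> z /andP[_ /forallP].
rewrite -(cardC1 (0 : k)) -sumr_const; apply: eq_big => b; first by rewrite !inE.
move=> b0.
pose h (w : {ffun 'I_d -> k}) : {ffun 'I_d.+1 -> k} :=
  [ffun i => if unlift ord0 i is Some j then b * w j else b].
pose h' (z : {ffun 'I_d.+1 -> k}) : {ffun 'I_d -> k} := [ffun j => z (lift ord0 j) / b].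
have h0 w : h w ord0 = b by rewrite ffunE unlift_none.
have hl w j : h w (lift ord0 j) = b * w j by rewrite ffunE liftK.
have h'h w : h' (h w) = w by apply/ffunP => j; rewrite ffunE hl mulrC mulKf.
rewrite (reindex_onto h h') => [|z /andP[_ /eqP zb]]; last first.
  apply/ffunP => i; rewrite ffunE; case: unliftP => [j ->|->] //.
  by rewrite ffunE mulrC divfK.
have hN w : [forall i, h w i != 0] = [forall i, w i != 0].
  apply/forallP/forallP => hw i; first by have := hw (lift ord0 i); rewrite hl mulf_eq0 (negPf b0).
  by case: (unliftP ord0 i) => [j ->|->]; rewrite ?h0 // hl mulf_neq0.
apply: eq_big => [w|w /andP[/andP[/andP[_ /forallP hw] _] _]].
  rewrite h'h eqxx andbT h0 eqxx andbT andbC; rewrite hN; congr (_ && _).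
  under eq_bigr do rewrite hl.
  rewrite -mulr_sumr -subr_eq0 opprK -{1}[b]mulr1 -mulrDr mulf_eq0 (negPf b0) /=.
  by rewrite addrC addr_eq0.
rewrite big_ord_recl h0.
transitivity (chi b ^+ (\sum_i a i) * \prod_i chi (w i) ^+ a (lift ord0 i)); last first.
  by rewrite chi_pX_mod // mul1r.
rewrite big_ord_recl exprD -mulrA; congr (_ * _).
rewrite expr_sum -big_split; apply: eq_bigr => i _ /=.
have w0 : w i != 0 by have := hw (lift ord0 i); rewrite hl mulf_eq0 (negPf b0).
by rewrite hl chi_pM // exprMn.
Qed.

End CharacterSums.

(** * Linear equivalence and ray classes *)

Section Equivalence.
Variables (k : finFieldType) (S : fieldType) (c : {rmorphism k -> S}).
Hypothesis S_ff : function_field c.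
Variables (d : nat) (T : 'I_d.+1 -> place S).
Implicit Types (D N : divisor S).
Local Notation Deg := (div_deg c).

Lemma lin_equivP D N : lin_equiv D N <-> exists2 h, h != 0 & D = N + divf h.
Proof.
split=> [[h hd]|[h h0 ->]].
  by exists h; [case: hd|rewrite -(is_div_unique S_ff hd) addrC subrK].
by exists h; rewrite addrC addKr; apply: (is_div_divf S_ff).
Qed.

Lemma lin_equiv_refl D : lin_equiv D D.
Proof. by apply/lin_equivP; exists (c 1); rewrite ?(divf_const S_ff) ?addr0 ?fmorph_eq0 ?oner_neq0. Qed.

Lemma lin_equiv_sym D N : lin_equiv D N -> lin_equiv N D.
Proof.
move=> /lin_equivP[h h0 ->]; apply/lin_equivP; exists h^-1; rewrite ?invr_eq0 //.
by rewrite (divfV S_ff) // addrK.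
Qed.

Lemma lin_equiv_trans D N N' : lin_equiv D N -> lin_equiv N N' -> lin_equiv D N'.
Proof.
move=> /lin_equivP[h h0 ->] /lin_equivP[h' h'0 ->]; apply/lin_equivP; exists (h * h'); rewrite ?mulf_neq0 //.
by rewrite (divfM S_ff) // addrA addrAC.
Qed.

Lemma mequivP D N : mequiv T D N <->
  exists h, [/\ h != 0, D = N + divf h & forall i, vge (T i) (h - 1) 1].
Proof.
split=> [[h hd h1]|[h [h0 -> h1]]].
  by exists h; split=> //; [case: hd|rewrite -(is_div_unique S_ff hd) addrC subrK].
by exists h => //; rewrite addrC addKr; apply: (is_div_divf S_ff).
Qed.

Lemma one_unit_dval (x : place S) h : vge x (h - 1) 1 -> x h = 0.
Proof.
move=> h1; have lt : x 1 < 1 by rewrite dval1.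
by have [_ ->] := dval_near (oner_neq0 S) lt h1; rewrite dval1.
Qed.

Lemma mequiv_refl D : mequiv T D D.
Proof.
apply/mequivP; exists (c 1); split; rewrite ?(divf_const S_ff) ?addr0 ?fmorph_eq0 ?oner_neq0 //.
by move=> i; rewrite rmorph1 subrr; apply: vge0.
Qed.

Lemma mequiv_sym D N : mequiv T D N -> mequiv T N D.
Proof.
move=> /mequivP[h [h0 -> h1]]; apply/mequivP; exists h^-1; split; rewrite ?invr_eq0 ?(divfV S_ff) // ?addrK //.
move=> i; have -> : h^-1 - 1 = h^-1 * (1 - h) by rewrite mulrBr mulVf // mulr1.
by apply: vgeMl; [right; rewrite dvalV (one_unit_dval (h1 i))|apply: vgeBC].
Qed.

Lemma mequiv_trans D N N' : mequiv T D N -> mequiv T N N' -> mequiv T D N'.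
Proof.
move=> /mequivP[h [h0 -> h1]] /mequivP[h' [h'0 -> h'1]]; apply/mequivP; exists (h * h'); split.
- by rewrite mulf_neq0.
- by rewrite (divfM S_ff) // addrA addrAC.
move=> i; rewrite -[X in _ - X](mulr1 1); apply: vge_mulB => //; last exact: vge1.
by right; rewrite (one_unit_dval (h1 i)).
Qed.

Lemma mequivDr D N N' : mequiv T D N -> mequiv T (D + N') (N + N').
Proof. by move=> /mequivP[h [h0 -> h1]]; apply/mequivP; exists h; split=> //; rewrite addrAC. Qed.

Lemma mequiv_deg D N : mequiv T D N -> Deg D = Deg N.
Proof. by move=> /mequivP[h [h0 -> _]]; rewrite div_degD (div_deg_divf S_ff h0) addr0. Qed.

Lemma mclass_eq D N : mequiv T D N -> mclass T D = mclass T N.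
Proof.
move=> DN; apply/seteqP; split=> D' [oD' D'D]; split=> //; first exact: mequiv_trans DN.
exact: mequiv_trans (mequiv_sym DN).
Qed.

(* Each effective divisor of degree [n] prime to [T] is counted in exactly one ray class. *)
Lemma ray_class_sum (R : pzSemiRingType) (D1 : divisor S) n (F G : divisor S -> R) :
  Deg D1 = 1 -> outside T D1 ->
  (forall N D, outside T N -> outside T D -> mequiv T D (N + D1 *+ n) -> F N = G D) ->
  \sum_(N \in mclasses0 c T) (Lm T D1 (xget 0 N) n)%:R * F (xget 0 N) =
  \sum_(D <- fset_set (eff_out c T n)) G D.
Proof.
move=> D1d oD1 FG; have finE := finite_eff_out S_ff T n.
pose p D := mclass T (D - D1 *+ n).
have outn : outside T (D1 *+ n) by move=> i; rewrite coeffMn oD1 mul0rn.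
have pM D : eff_out c T n D -> mclasses0 c T (p D).
  move=> [_ oD dD]; exists (D - D1 *+ n) => //; split.
    by rewrite div_degB div_degMn dD D1d -mulr_natr natz mul1r subrr.
  by move=> i; rewrite coeffB oD outn subrr.
have cls (N : set (divisor S)) : mclasses0 c T N -> [/\ outside T (xget 0 N), Deg (xget 0 N) = 0 & N = mclass T (xget 0 N)].
  move=> [N' [dN' oN'] <-].
  have [ox xN'] : mclass T N' (xget 0 (mclass T N')).
    by apply: (@xgetPex _ 0 (mclass T N')); exists N'; split=> //; apply: mequiv_refl.
  by split=> //; [rewrite (mequiv_deg xN')|apply/esym/mclass_eq].
have term (N : set (divisor S)) : mclasses0 c T N -> (Lm T D1 (xget 0 N) n)%:R * F (xget 0 N) =
    \sum_(D <- fset_set (eff_out c T n) | p D == N) G D.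
  move=> /cls[ox dx NE].
  have pN D : eff_out c T n D -> (p D == N) = `[< mequiv T D (xget 0 N + D1 *+ n) >].
    move=> [_ oD dD]; apply/eqP/asboolP => [pD|DM].
      have : N (xget 0 N) by rewrite {1}NE; split=> //; apply: mequiv_refl.
      rewrite -[X in X (xget _ _)]pD => -[_ /(mequivDr (D1 *+ n))]; rewrite subrK.
      exact: mequiv_sym.
    rewrite NE; apply: mclass_eq; have := mequivDr (- (D1 *+ n)) DM.
    by rewrite addrK.
  have AE : [set D | [/\ effective D, outside T D & mequiv T D (xget 0 N + D1 *+ n)]] =
      eff_out c T n `&` [set D | p D == N].
    apply/seteqP; split=> [D [eD oD DM]|D [DE /= pD]] /=.
      have DE : eff_out c T n D.
        split=> //; rewrite (mequiv_deg DM) div_degD div_degMn dx D1d add0r.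
        by rewrite -mulr_natr natz mul1r.
      by split=> //; rewrite /= pN //; apply/asboolP.
    by move: pD; rewrite pN // => /asboolP DM; case: DE.
  have finA : finite_set (eff_out c T n `&` [set D | p D == N]) by apply: finite_setIl.
  have pe : perm_eq (fset_set (eff_out c T n `&` [set D | p D == N]))
      [seq D <- fset_set (eff_out c T n) | p D == N].
    apply: uniq_perm; rewrite ?filter_uniq ?fset_uniq // => D.
    rewrite mem_filter !in_fset_set //; apply/idP/andP => [/set_mem[DE pD]|[pD /set_mem DE]].
      by split=> //; apply: mem_set.
    exact: mem_set.
  rewrite /Lm AE -sum1_size natr_sum mulr_suml -[RHS]big_filter -(perm_big _ pe) /=.
  rewrite big_seq [RHS]big_seq; apply: eq_bigr => D; rewrite in_fset_set // => /set_mem[DE /= pD].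
  rewrite mul1r; apply: FG => //; first by case: DE.
  by move: pD; rewrite pN // => /asboolP.
pose t := undup [seq p D | D <- fset_set (eff_out c T n)].
have tM (N : set (divisor S)) : N \in t -> mclasses0 c T N.
  rewrite mem_undup => /mapP[D + ->]; rewrite in_fset_set // => /set_mem; exact: pM.
rewrite (@fsbigE _ _ _ _ _ t) ?undup_uniq //.
- rewrite (@partition_big_seq _ _ _ _ t p) ?undup_uniq //; last first.
    by move=> D DE; rewrite mem_undup map_f.
  rewrite big_seq_cond [RHS]big_seq; apply: eq_big => N.
    case: (boolP (N \in t)) => //= /tM NM; exact: mem_set.
  by move=> /andP[_ /set_mem NM]; apply: term.
- move=> N NM Nt; rewrite term //; rewrite big_seq_cond big1 // => D /andP[DE /eqP pD].
  by case/negP: Nt; rewrite -pD mem_undup map_f.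
Qed.

End Equivalence.

(** * The sum over effective divisors prime to the branch points *)

Section EigenspaceSum.
Variables (m n : nat) (K : fieldType) (eps : K).
Hypotheses (m_prime : prime m) (eps_prim : m.-primitive_root eps).
Hypothesis K_char0 : forall i, (0 < i)%N -> i%:R != 0 :> K.
Variables (k : finFieldType) (red : K -> k).
Hypothesis red_res : residue_map eps (m * n) red.
Variables (S : fieldType) (c : {rmorphism k -> S}).
Hypothesis S_ff : function_field c.
Variables (d : nat) (T : 'I_d.+1 -> place S).
Hypotheses (T_inj : injective T) (T_rat : forall i, place_deg c (T i) = 1%N).
Variables (f : S) (a : 'I_d.+1 -> nat) (Dbar : divisor S).
Hypotheses (a_bounds : forall i, (0 < a i < m)%N).
Hypothesis f_div : is_div f (\sum_i << T i >> *+ a i + Dbar *+ m).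
Local Notation q := #|k|.
Local Notation RL := (root_lift m eps red).
Local Notation chi := (chi_p m eps red).
Local Notation E := (\sum_i << T i >> : divisor S).
Local Notation artin_root := (artin_root S_ff m f).
Local Notation Deg := (div_deg c).

Let f_neq0 : f != 0. Proof. by case: f_div. Qed.
Let zeta_prim := red_prim m_prime eps_prim K_char0 red_res.
Let m_dvd := order_dvd_card m_prime zeta_prim.
Let q1 : (0 < q.-1)%N.
Proof. by rewrite -ltnS prednK ?finRing_gt1 // (ltn_trans _ (finRing_gt1 k)). Qed.

(** div(f) has degree 0 and the points [T i] are rational. *)
Lemma branch_sum_dvd : (m %| \sum_i a i)%N.
Proof.
have := is_div_deg S_ff f_div.
rewrite div_degD div_degMn div_deg_sum (eq_bigr (fun i => (a i)%:Z)) => [|i _]; last first.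
  by rewrite div_degMn div_degU T_rat natz.
rewrite -(big_morph _ PoszD (erefl _)) => /eqP; rewrite addr_eq0 => /eqP e.
by rewrite -[(\sum_i a i)%N]/(`|(\sum_i a i)%N|%N) e abszN -mulr_natr natz abszM absz_nat dvdn_mull.
Qed.

Lemma branch_gt0 : (0 < d)%N.
Proof.
rewrite lt0n; apply/eqP => d0; have := branch_sum_dvd.
rewrite (eq_bigl (fun i => i == ord0)) => [|i]; last by case: i => -[|i] //=; rewrite d0.
by rewrite big_pred1_eq; have /andP[a0 am] := a_bounds ord0; move/(dvdn_leq a0); rewrite leqNgt am.
Qed.

Lemma branch_coprime : ~~ (m %| `|T ord0 f|)%N.
Proof.
have [_ fE] := f_div; rewrite -fE coeffD coeffMn coeff_sum (bigD1 ord0) //= big1 => [|i i0]; last first.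
  by rewrite coeffMn coeffU (inj_eq T_inj) (negPf i0) mulr0 mul0rn.
rewrite coeffMn coeffU eqxx mulr1 addr0 natz -mulr_natr natz.
have /andP[a0 am] := a_bounds ord0.
rewrite -[m in (m %| _)%N]absz_nat -dvdzE rpredDr ?dvdz_mull // dvdzE /=.
by apply: contraL am => /(dvdn_leq a0); rewrite -leqNgt.
Qed.

Lemma artin_root_tame D h : h != 0 -> (forall i, T i h = 0) ->
  RL (artin_root (D + divf h)) = RL (artin_root D) * \prod_i chi (values c T h i) ^+ a i.
Proof.
move=> h0 hT; rewrite artin_rootD // (root_liftM m_prime eps_prim K_char0 red_res); last 2 first.
- exact: (artin_root_unity S_ff m_prime zeta_prim f_neq0).
- exact: (artin_root_unity S_ff m_prime zeta_prim f_neq0).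
have hi i : vge (T i) h 0 by right; rewrite hT.
have v0 i : values c T h i != 0 by rewrite (values_neq0 S_ff T_rat) // hT.
congr (_ * _); rewrite (artin_root_divf S_ff f_neq0 m_dvd f_div) //.
rewrite (root_lift_prod m_prime eps_prim K_char0 red_res) => [|i _]; last first.
  by rewrite -exprM -mulnA divnK // mulnC exprM expf_pred ?expr1n // tame_neq0.
apply: eq_bigr => i _; rewrite (tame_rational S_ff (T_rat i) h0 (hT i) (valuesP S_ff T_rat (hi i))).
rewrite mulnC exprM (root_liftX m_prime eps_prim K_char0 red_res) ?chi_pE //.
by rewrite -exprM divnK // expf_pred.
Qed.

Lemma artin_root_mequiv D N : mequiv T D N -> RL (artin_root D) = RL (artin_root N).
Proof.
move=> /(mequivP S_ff)[h [h0 -> h1]]; rewrite artin_root_tame // => [|i]; last exact: one_unit_dval (h1 i).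
rewrite big1 ?mulr1 // => i _; rewrite (@valuesE _ _ _ S_ff _ _ T_rat _ _ 1) ?rmorph1 //.
by rewrite chi_pE expr1n (root_lift1 m_prime eps_prim K_char0 red_res) expr1n.
Qed.

Lemma class_character_sum D0 e (im : pred {ffun 'I_d.+1 -> k}) : outside T D0 -> Deg D0 = e%:Z ->
  (forall z, im z <-> exists2 v, sections D0 v & values c T v = z) ->
  (\sum_(D <- fset_set (eff_out c T e) | `[< lin_equiv D D0 >]) RL (artin_root D)) *+ q.-1 =
  RL (artin_root D0) * (\sum_(z : {ffun 'I_d.+1 -> k} | im z && [forall i, z i != 0]) \prod_i chi (z i) ^+ a i) *+
    (q ^ ell c (D0 - E)).
Proof.
move=> oD0 dD0 imP; rewrite (class_sum S_ff T_rat oD0 dD0 (fun D => RL (artin_root D))).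
rewrite -mulrnAr -(values_big S_ff T_inj T_rat oD0 (fun z => \prod_i chi (z i) ^+ a i) imP) mulr_sumr.
rewrite big_seq_cond [RHS]big_seq_cond; apply: eq_bigr => h.
rewrite in_fset_set; last exact: (finite_sections S_ff).
move=> /andP[/set_mem hh hT]; have [h0 [_ oh _]] := section_divisor S_ff T_rat oD0 dD0 hh hT.
apply: artin_root_tame => // i; have := oh i; by rewrite coeffD oD0 add0r (coeff_divf S_ff).
Qed.

Variables (g : nat) (g_genus : genus c = g) (kappa C : divisor S).
Hypothesis kappa_can : canonical_divisor c kappa.
Hypothesis C_equiv : lin_equiv C (kappa + E).
Variables (io : 'I_d.+1 -> S -> k).
Hypothesis io_level : mlevel_structure c T C io.
Hypothesis io_omega : forall (z : 'I_d -> k) (r : k),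
  omega_graph C io z r <-> r = - \sum_i z i.
Variables (e : nat) (N : divisor S).
Hypotheses (N_deg : Deg N = e%:Z) (N_level : level_divisor T C io N).

Lemma effective_sum :
  \sum_(D <- fset_set (eff_out c T e)) RL (artin_root D) =
  RL (artin_root N) * (q ^ g)%:R *
  \sum_(w : {ffun 'I_d -> k} | [forall i, w i != 0] && (\sum_i w i == -1))
    \prod_i chi (w i) ^+ a (lift ord0 i).
Proof.
have [oN [s0 [Ds [sD s1 NC]]]] := N_level; have s00 : s0 != 0 by case: sD.
(* Every [io i] is 1 on [s0], so multiplication by [s0] identifies O(D0) with O(C) and turns the
   level structure into evaluation at the points [T i]. *)
have DsE := is_div_unique S_ff sD; pose D0 := C + divf s0.
have {}NC : mequiv T N D0 by rewrite /D0 -DsE addrC.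
have dD0 : Deg D0 = e%:Z by rewrite -(mequiv_deg S_ff NC).
have oD0 : outside T D0.
  have [h [h0 NE h1]] := (mequivP S_ff T N D0).1 NC; move=> i; have := oN i.
  by rewrite NE coeffD (coeff_divf S_ff) // (one_unit_dval (h1 i)) addr0.
have [h0 h00 CE] := (lin_equivP S_ff C _).1 C_equiv.
have D0E : D0 - E = kappa - divf (h0 * s0)^-1.
  rewrite /D0 CE (divfV S_ff) ?mulf_neq0 // opprK (divfM S_ff) //.
  by rewrite -!addrA; congr (_ + _); rewrite addrC -!addrA addNr addr0.
have [om omW [om_neq0 om_kappa]] := kappa_can.
(* The sections of O(D0) vanishing on [T] form a copy of L(kappa); this is the origin of the factor
   q^g. *)
have ellD0 : ell c (D0 - E) = g.
  by rewrite D0E ell_divf ?invr_eq0 ?mulf_neq0 // (ell_canonical S_ff omW om_neq0 om_kappa).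
have secC v : sections D0 v <-> sections C (s0 * v).
  have := sectionsM S_ff D0 v (h := s0); rewrite /D0 addrK; exact.
have ioE v i : sections D0 v -> io i (s0 * v) = values c T v i.
  move=> hv; have [_ ioM _] := io_level i; have [st io1] := s1 i.
  rewrite mulrC (ioM v s0 (values c T v i)) ?io1 ?mulr1 //.
  by apply: valuesP => //; apply: section_integral hv.
pose im := [pred z : {ffun 'I_d.+1 -> k} | z ord0 == - \sum_i z (lift ord0 i)].
have imP (z : {ffun 'I_d.+1 -> k}) : im z <-> exists2 v, sections D0 v & values c T v = z.
  split=> [/eqP z0|[v hv <-]]; last first.
    apply/eqP/(io_omega (fun i => values c T v (lift ord0 i))).
    by exists (s0 * v); split=> [|i|]; [apply/secC|apply: ioE|apply: ioE].
  have [s [hs sz s_0]] := (io_omega (fun i => z (lift ord0 i)) _).2 z0.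
  have hv : sections D0 (s / s0) by apply/secC; rewrite mulrC divfK.
  exists (s / s0) => //; apply/ffunP => i; rewrite -ioE // mulrC divfK //.
  by case: (unliftP ord0 i) => [j ->|->].
have special := class_character_sum oD0 dD0 imP.
rewrite (hyperplane_sum m_prime eps_prim K_char0 red_res branch_sum_dvd) in special.
have qK : q.-1%:R != 0 :> K by apply: K_char0.
have Kmul (x : K) i : x *+ i = x * i%:R by rewrite mulr_natr.
rewrite (bigID (fun D => `[< lin_equiv D D0 >])) /= [X in _ + X](_ : _ = 0) ?addr0.
  apply: (mulIf qK); rewrite -[LHS]Kmul special ellD0 (artin_root_mequiv NC).
  by rewrite [RHS]mulr_natr [_ * _%:R]mulr_natr mulrnAl mulrnAr -!mulrnA mulnC.
rewrite -big_filter; set r := [seq D <- _ | _].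
have rP D : D \in r -> eff_out c T e D /\ ~ lin_equiv D D0.
  rewrite mem_filter in_fset_set; last exact: finite_eff_out.
  by move=> /andP[/asboolPn ? /set_mem].
pose p D := [set D' : divisor S | lin_equiv D' D].
have pE D D' : (p D' == p D) = `[< lin_equiv D' D >].
  apply/eqP/asboolP => [e1|DD].
    have : p D' D' by apply: (lin_equiv_refl S_ff).
    by rewrite e1.
  apply/seteqP; split=> X /= h; first exact: (lin_equiv_trans S_ff h DD).
  exact: (lin_equiv_trans S_ff h (lin_equiv_sym S_ff DD)).
rewrite (@partition_big_seq _ _ _ r (undup (map p r)) p) ?undup_uniq //; last first.
  by move=> D DE; rewrite mem_undup map_f.
rewrite big_seq big1 // => j; rewrite mem_undup => /mapP[D /rP[DE nD] ->].
have [eD oD dD] := DE.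
(* D - E has the degree of kappa and is not equivalent to it, because [D] is not equivalent to
   [D0]. *)
have van al : adele al -> exists h, adele_le (D - E) (fun x => al x - h).
  apply: (nonspecial S_ff omW om_neq0 om_kappa).
    have -> : Deg kappa = Deg (D0 - E).
      by rewrite D0E div_degB (div_deg_divf S_ff) ?invr_eq0 ?mulf_neq0 // subr0.
    by rewrite !div_degB dD dD0.
  move=> /(lin_equivP S_ff)[h hn0 DEk]; apply: nD; apply/(lin_equivP S_ff).
  exists (h * (h0 * s0)^-1); first by rewrite mulf_neq0 ?invr_eq0 ?mulf_neq0.
  rewrite (divfM S_ff) ?invr_eq0 ?mulf_neq0 // -[D](subrK E) DEk -[D0](subrK E) D0E.
  by rewrite [RHS]addrAC [divf h + _]addrC addrA subrK addrAC.
have allP (z : {ffun 'I_d.+1 -> k}) : xpredT z <-> exists2 v, sections D v & values c T v = z.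
  by split=> // _; apply: values_surj van z.
have := class_character_sum oD dD allP.
rewrite /= (torus_sum0 m_prime eps_prim K_char0 red_res a_bounds) mulr0 mul0rn => /eqP.
rewrite Kmul mulf_eq0 (negPf qK) orbF => /eqP H.
rewrite -[RHS]H big_filter_cond; apply: eq_bigl => D'; rewrite pE andbC.
case: (boolP `[< lin_equiv D' D >]) => //= /asboolP DD; apply/asboolPn => D'0.
by apply: nD; apply: (lin_equiv_trans S_ff (lin_equiv_sym S_ff DD) D'0).
Qed.

End EigenspaceSum.

Theorem theorem1
  (* the cyclotomic field K = Q(eps), the ring A = Z[eps, 1/(mn)] *)
  (m n : nat) (m_prime : prime m) (n_gt0 : (0 < n)%N)
  (K : fieldExtType rat) (eps : K) (eps_prim : m.-primitive_root eps)
  (K_gen : forall z : K, exists r : {poly rat}, z = (map_poly (in_alg K) r).[eps])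
  (* the residue field k, of characteristic p, of a maximal ideal of A *)
  (p : nat) (k : finFieldType) (k_char : p \in [pchar k])
  (red : K -> k) (red_res : residue_map eps (m * n) red)
  (* the curve X, with function field S, and the points x_0, ..., x_d *)
  (S : fieldType) (c : {rmorphism k -> S}) (S_ff : function_field c)
  (g : nat) (g_genus : genus c = g)
  (d : nat) (T : 'I_d.+1 -> place S) (T_inj : injective T)
  (T_rat : forall i, place_deg c (T i) = 1%N)
  (* the covering Y, with function field Q = S(y), y^m = f *)
  (f : S) (a : 'I_d.+1 -> nat) (Dbar : divisor S)
  (a_bounds : forall i, (0 < a i < m)%N)
  (f_div : is_div f (\sum_i << T i >> *+ a i + Dbar *+ m))
  (Q : fieldType) (u : {rmorphism S -> Q}) (y : Q) (y_f : y ^+ m = u f)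
  (Q_gen : forall b : Q, exists r : {poly S}, b = (map_poly u r).[y])
  (* D_1 *)
  (D1 : divisor S) (D1_deg : div_deg c D1 = 1) (D1_out : outside T D1)
  (D1_artin : artin_symbol c T u D1 (idfun : {rmorphism Q -> Q}))
  (* kappa, L = O(C), iota and M *)
  (kappa : divisor S) (kappa_can : canonical_divisor c kappa)
  (C : divisor S) (C_eff : effective C)
  (C_equiv : lin_equiv C (kappa + \sum_i << T i >>))
  (C_x0 : coeff (T ord0) C = 0)
  (io : 'I_d.+1 -> S -> k) (io_level : mlevel_structure c T C io)
  (io_x0 : io ord0 1 = 1)
  (io_omega : forall (z : 'I_d -> k) (r : k),
     omega_graph C io z r <-> r = - \sum_i z i)
  (M : divisor S) (M_deg : div_deg c M = 0) (M_out : outside T M)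
  (M_level : level_divisor T C io (M + D1 *+ (2 * g + d - 1)))
  (* an algebraic closure Om of Q, and E = Q_l(eps) *)
  (l : nat) (l_prime : prime l) (l_p : l != p)
  (Om : closedFieldType) (v : {rmorphism Q -> Om})
  (Om_alg : forall z : Om, algebraicOver v z)
  (E : fieldType) (w : dvaluation E) (iota : {rmorphism K -> E})
  (E_compl : ladic_completion l w iota)
  (* the characteristic polynomial P of Frobenius on the chi_f-eigenspace *)
  (P : {poly K})
  (P_char : frobenius_char_poly c u v w
     (fun s => iota (chi_f m eps red c u y s)) (map_poly iota P))
  (P_formula : P = \sum_(0 <= i < 2 * g + d)
     (\sum_(N \in mclasses0 c T)
        (Lm T D1 (xget 0 N) i)%:R * chi_artin m eps red c u y T (xget 0 N))
     *: 'X^(2 * g + d - 1 - i)) :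
  P.[0] = (-1) ^+ d.+1 * chi_artin m eps red c u y T M * (#|k| ^ g)%:R *
          jacobi_sum m eps red (fun i : 'I_d => a (fintype.lift ord0 i)).
Proof.
have K_char0 i : (0 < i)%N -> i%:R != 0 :> K.
  by move=> i0; rewrite -[i%:R](rmorph_nat (in_alg K)) fmorph_eq0 pnatr_eq0 -lt0n.
have zeta_prim := red_prim m_prime eps_prim K_char0 red_res.
have f0 : f != 0 by case: f_div.
have f_ram := branch_coprime T_inj a_bounds f_div.
have f_unr := f_outside f_div.
have chiE := chi_artinE S_ff m_prime zeta_prim f0 f_ram y_f Q_gen f_unr D1_artin eps red.
have psiD1 := artin_root_D1 S_ff m_prime zeta_prim f0 y_f f_unr D1_artin.
set e := (2 * g + d - 1)%N in M_level P_formula *.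
(* [d] is positive, so the truncated subtraction in [e] is exact. *)
have eE : (2 * g + d)%N = e.+1.
  by have := branch_gt0 S_ff T_rat a_bounds f_div; rewrite /e; lia.
(* [D1] has trivial Artin symbol, so its multiples can be added freely. *)
have psiDe N : artin_root S_ff m f (N + D1 *+ e) = artin_root S_ff m f N.
  by rewrite artin_rootD // artin_rootMn // psiD1 expr1n mulr1.
have -> : P.[0] = \sum_(N \in mclasses0 c T)
    (Lm T D1 (xget 0 N) e)%:R * chi_artin m eps red c u y T (xget 0 N).
  rewrite P_formula horner_sum eE big_nat_recr //= hornerZ hornerXn subnn expr0 mulr1.
  rewrite big_nat big1 ?add0r // => i /andP[_ ie].
  by rewrite hornerZ hornerXn expr0n subn_eq0 leqNgt ie mulr0.
rewrite (ray_class_sum S_ff (G := fun D => root_lift m eps red (artin_root S_ff m f D)) D1_deg D1_out); last first.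
  move=> N D oN oD DN; rewrite chiE // -psiDe.
  exact/esym/(artin_root_mequiv m_prime eps_prim K_char0 red_res S_ff T_rat f_div DN).
have N_deg : div_deg c (M + D1 *+ e) = e%:Z.
  by rewrite div_degD div_degMn M_deg D1_deg add0r -mulr_natr natz mul1r.
rewrite (effective_sum m_prime eps_prim K_char0 red_res S_ff T_inj T_rat a_bounds f_div
  g_genus kappa_can C_equiv io_level io_omega N_deg M_level).
(* The sign of the statement cancels the one inside [jacobi_sum]. *)
rewrite psiDe chiE // /jacobi_sum -[LHS](signrMK d.+1) -!mulrA; congr (_ * _).
by rewrite mulrCA; congr (_ * _); rewrite mulrCA.
Qed.
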